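(* Let $1\le r\le2$. For every $f\in L^2(\mathbb R)$, the special affine Fourier transform $\widehat f_{\Lambda_S}$ satisfies $$\left\{\int_{\mathbb R}|x|^r|f(x)|^r\,dx\right\}^{1/r}\left\{\int_{\mathbb R}|\omega|^r\big|\widehat f_{\Lambda_S}(\omega)\big|^r\,d\omega\right\}^{1/r}\ge\frac{|B|^{(r+2)/(2r)}}{2}\,\|f\|_2^2,$$ where the integrals take values in $[0,\infty]$.
   Context: Fix real parameters $A,B,C,D,p,q$ with $AD-BC=1$ and $B\neq0$ (collected in $\Lambda_S$). $z^*$ denotes the complex conjugate of $z$. Put $K_B=\frac1{\sqrt{2\pi B}}$ (principal square root) and $$\mathcal K_{\Lambda_S}(x,\omega)=K_B^*\exp\left\{\frac{i}{2B}\big(Ax^2+2x(p-\omega)-2\omega(Dp-Bq)+D\omega^2\big)\right\}.$$ The special affine Fourier transform (SAFT) is $\widehat f_{\Lambda_S}(\omega)=\int_{\mathbb R}f(x)\mathcal K_{\Lambda_S}(x,\omega)\,dx$ for $f\in L^1(\mathbb R)\cap L^2(\mathbb R)$, extended to a unitary operator on $L^2(\mathbb R)$. *)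

(* Defs.v *)
From HB Require Import structures.
From mathcomp Require Import all_boot all_order all_algebra.
From mathcomp Require Import complex.
From mathcomp Require Import all_classical all_reals all_analysis.

Set Implicit Arguments.
Unset Strict Implicit.
Unset Printing Implicit Defensive.
Import Order.TTheory GRing.Theory Num.Theory.
Import numFieldNormedType.Exports.
Local Open Scope classical_set_scope.
Local Open Scope complex_scope.
Local Open Scope ring_scope.

(* The modulus of a complex number, valued in [R] rather than in [R[i]]. *)
Notation cabs := (@ComplexField.Normc.normc _).

Definition cexp (R : realType) (z : R[i]) : R[i] :=
  (expR (complex.Re z) * cos (complex.Im z)) +i* (expR (complex.Re z) * sin (complex.Im z)).

(* Componentwise Lebesgue integral over the line; meaningful when both
   components are integrable. *)
Definition cintegral (R : realType) (f : R -> R[i]) : R[i] :=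
  (\int[lebesgue_measure]_x complex.Re (f x)) +i* (\int[lebesgue_measure]_x complex.Im (f x)).

Definition cLnorm (R : realType) (p : R) (f : R -> R[i]) : \bar R :=
  'N[lebesgue_measure]_(p%:E)[EFin \o cabs \o f]%E.

Definition cLp (R : realType) (p : R) (f : R -> R[i]) : Prop :=
  [/\ measurable_fun setT (fun x => complex.Re (f x)),
      measurable_fun setT (fun x => complex.Im (f x)) &
      (cLnorm p f < +oo)%E].

Definition L2_cvg (R : realType) (u : nat -> R -> R[i]) (f : R -> R[i]) : Prop :=
  cLnorm 2 (fun x => u n x - f x) @[n --> \oo] --> (0 : \bar R).

(* [sqrtc] is the principal square root, also for negative [B]. *)
Definition saft_const (R : realType) (B : R) : R[i] :=
  (sqrtc (2 * pi * B)%:C)^-1.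

(* [C] enters the transform only through the constraint [A * D - B * C = 1]. *)
Definition saft_kernel (R : realType) (A B D p q x w : R) : R[i] :=
  conjc (saft_const B) *
  cexp ('i%C / (2 * B)%:C *
        (A * x ^+ 2 + 2 * x * (p - w) - 2 * w * (D * p - B * q)
         + D * w ^+ 2)%:C).

(* The integral formula, used on the intersection of L^1 and L^2. *)
Definition saft_int (R : realType) (A B D p q : R) (f : R -> R[i]) (w : R) :
    R[i] :=
  cintegral (fun x => f x * saft_kernel A B D p q x w).

(* [g] represents the value at [f] of the extension by L^2-continuity of
   [saft_int]; such a [g] is unique up to equality almost everywhere. *)
Definition is_saft (R : realType) (A B D p q : R) (f g : R -> R[i]) : Prop :=
  cLp 2 g /\
  exists u : nat -> R -> R[i],
    [/\ forall n, cLp 1 (u n) /\ cLp 2 (u n),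
        L2_cvg u f &
        L2_cvg (fun n => saft_int A B D p q (u n)) g].

(* The SAFT of a square-integrable function, as a chosen representative of its
   class; the default value 0 is never used when [f] is in L^2 and [B != 0]. *)
Definition saft (R : realType) (A B D p q : R) (f : R -> R[i]) : R -> R[i] :=
  xget (fun=> 0) [set g | is_saft A B D p q f g].

(* Main.v *)
Require Import Defs.
From HB Require Import structures.
From mathcomp Require Import all_boot all_order all_algebra.
From mathcomp Require Import complex ring lra.
From mathcomp Require Import all_classical all_reals all_analysis measurable_realfun.

Set Implicit Arguments.
Unset Strict Implicit.
Unset Printing Implicit Defensive.
Import Order.TTheory GRing.Theory Num.Theory.
Import numFieldNormedType.Exports.
Local Open Scope classical_set_scope.
Local Open Scope complex_scope.
Local Open Scope ring_scope.

(** An L2 transform is only a limit of integrals, and a finite weighted norm does not make a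
    function differentiable. Square-integrability together with the weighted norm does force
    integrability. The demodulated transform [h] is therefore integrable, its inverse Fourier
    transform is bounded and continuous, and it replaces the chirped [f], with which it agrees
    almost everywhere. The integration by parts is carried out without a derivative: the difference
    [F (x + e) - F (x - e)] has the multiplier [2 i sin (c w e)], of modulus at most [2 |c w| e], so
    a factor [e] cancels on both sides before [e] tends to 0.

    In bilinear form Hausdorff-Young carries the same exponent [r] on both factors. The dual
    exponent, infinite at [r = 1], never appears, and both functions are deformed by the same rule.

    In [0, oo] a zero factor times an infinite one is 0. Vanishing weighted integrals thus need
    their own argument: the first gives [f = 0] at once, the second gives it through inversion. *)

(**
Up to multiplication by unimodular chirps in [x] and in [w], the special affine
transform is a normalised Fourier transform with kernel [expi (- x * w / B)].
If both weighted integrals are finite, then [f] and its transform are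
integrable, and Fourier inversion writes the chirped [f] as the inverse Fourier
transform of a function [h] whose modulus is that of the transform, up to a
constant.  Integration by parts then gives
[|f|_2^2 <= 2 |int x F(x) conj(F'(x)) dx|], where [F'] is the Fourier transform
of a multiple of [w h(w)], so the bilinear form of the Hausdorff-Young inequality
[|int a Fourier(b)| <= const |a|_r |b|_r], [1 <= r <= 2], bounds the right-hand
side by the product of the two weighted norms.  The constant is then
[(2 pi)^(1/2 - 1/r) <= 1] times the required one.

The Hausdorff-Young inequality is obtained by complex interpolation between
[r = 1] and the [L^2] contraction [r = 2], with Hadamard's three-circle theorem
for polynomials in place of the three-lines theorem.  The contraction and the
inversion formula come from smoothing by the Poisson kernel, whose Fourier
transform is [exp (- e |w|)].
*)

(** * Modulus of complex numbers and the three-circle theorem *)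

Section cabs_theory.
Context {R : realType}.
Implicit Types z w : R[i].

Lemma cabs_def z : cabs z = Num.sqrt (complex.Re z ^+ 2 + complex.Im z ^+ 2).
Proof. by case: z. Qed.

Lemma complexReM z w : complex.Re (z * w) =
  complex.Re z * complex.Re w - complex.Im z * complex.Im w.
Proof. by case: z => ? ?; case: w. Qed.

Lemma complexImM z w : complex.Im (z * w) =
  complex.Re z * complex.Im w + complex.Im z * complex.Re w.
Proof. by case: z => ? ?; case: w. Qed.

Lemma cabs_ge0 z : 0 <= cabs z.
Proof. by rewrite cabs_def sqrtr_ge0. Qed.

Lemma cabsM z w : cabs (z * w) = cabs z * cabs w.
Proof. exact: ComplexField.Normc.normcM. Qed.

Lemma cabsD z w : cabs (z + w) <= cabs z + cabs w.
Proof. exact: le_normcD. Qed.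

Lemma cabsN z : cabs (- z) = cabs z.
Proof. exact: normcN. Qed.

Lemma cabsX z n : cabs (z ^+ n) = cabs z ^+ n.
Proof.
elim: n => [|n ih]; first by rewrite !expr0 ComplexField.Normc.normc1.
by rewrite !exprS cabsM ih.
Qed.

Lemma cabs_real (x : R) : cabs x%:C = `|x|.
Proof. by rewrite cabs_def /= expr0n addr0 sqrtr_sqr. Qed.

Lemma cabs_conj z : cabs (conjc z) = cabs z.
Proof. by case: z => x y /=; rewrite sqrrN. Qed.

Lemma conjcM z w : conjc (z * w) = conjc z * conjc w.
Proof. exact: rmorphM. Qed.

Lemma cabs_sum I (s : seq I) (P : pred I) (F : I -> R[i]) :
  cabs (\sum_(i <- s | P i) F i) <= \sum_(i <- s | P i) cabs (F i).
Proof.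
elim/big_rec2 : _ => [|i x z _ h]; first by rewrite ComplexField.Normc.normc0.
by rewrite (le_trans (cabsD _ _))// lerD2l.
Qed.

Lemma sqr_cabs z : cabs z ^+ 2 = complex.Re z ^+ 2 + complex.Im z ^+ 2.
Proof. by rewrite cabs_def sqr_sqrtr// addr_ge0// sqr_ge0. Qed.

Lemma mulr_conjc z : z * conjc z = (cabs z ^+ 2)%:C.
Proof.
rewrite sqr_cabs; case: z => x y /=; apply/eqP; rewrite eq_complex /=.
by apply/andP; split; apply/eqP; ring.
Qed.

Lemma normr_Re_le z : `|complex.Re z| <= cabs z.
Proof.
rewrite cabs_def -sqrtr_sqr ler_wsqrtr// lerDl sqr_ge0 //.
Qed.

Lemma normr_Im_le z : `|complex.Im z| <= cabs z.
Proof.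
rewrite cabs_def -sqrtr_sqr ler_wsqrtr// lerDr sqr_ge0 //.
Qed.

Lemma cabs_le_ReIm z : cabs z <= `|complex.Re z| + `|complex.Im z|.
Proof.
rewrite cabs_def -(@ler_pXn2r _ 2) ?nnegrE ?sqrtr_ge0 ?addr_ge0//.
rewrite sqr_sqrtr ?addr_ge0 ?sqr_ge0// sqrrD !real_normK ?num_real//.
by rewrite lerD2r lerDl mulrn_wge0// mulr_ge0.
Qed.

Definition expi (t : R) : R[i] := cos t +i* sin t.

Lemma expi0 : expi 0 = 1.
Proof. by rewrite /expi cos0 sin0. Qed.

Lemma expiD s t : expi (s + t) = expi s * expi t.
Proof.
rewrite /expi cosD sinD; apply/eqP; rewrite eq_complex /=.
by apply/andP; split; apply/eqP; ring.
Qed.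

Lemma conjc_expi t : conjc (expi t) = expi (- t).
Proof. by rewrite /expi /= cosN sinN. Qed.

Lemma cabs_expi t : cabs (expi t) = 1.
Proof. by rewrite cabs_def /= cos2Dsin2 sqrtr1. Qed.

Lemma expi_mulrn t n : expi (t *+ n) = expi t ^+ n.
Proof. by elim: n => [|n ih]; rewrite ?mulr0n ?expi0// mulrS expiD ih exprS. Qed.

(** By the half-angle formula [1 - cos t = 2 sin (t / 2) ^ 2], and [t / 2] is a nonzero point of
    []-pi, pi[]. *)
Lemma expi_neq1 t : 0 < `|t| < 2 * pi -> expi t != 1.
Proof.
move=> /andP[t0 tpi]; rewrite eq_complex /= negb_and; apply/orP; left.
have st : sin (t / 2) != 0.
  have [t1|t1] := leP 0 t.
    rewrite gt_eqF// sin_gt0_pi//; move: t0 tpi; rewrite ger0_norm// => *.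
    by apply/andP; split; lra.
  rewrite -oppr_eq0 -sinN gt_eqF// sin_gt0_pi//; move: t0 tpi.
  by rewrite ltr0_norm// => *; apply/andP; split; lra.
have -> : cos t = 1 - 2 * sin (t / 2) ^+ 2.
  have {1}-> : t = t / 2 + t / 2 by lra.
  by rewrite cosD -!expr2 cos2sin2; ring.
by rewrite -subr_eq0 addrAC subrr sub0r oppr_eq0 mulf_neq0// expf_neq0.
Qed.

End cabs_theory.

(** * Cauchy's estimate and the three-circle theorem for polynomials *)

Section three_circles.
Context {R : realType}.
Implicit Types (P : {poly R[i]}).

(** A geometric sum with ratio [y] such that [y ^ N = 1]; the bounds on [m] keep [y] away from 1. It
    is the discrete orthogonality relation behind [cauchy_coef]. *)
Lemma sum_roots_of_unity (N : nat) (m : int) : (0 < N)%N -> m != 0 ->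
  `|m| < N%:Z -> \sum_(j < N) (expi (2 * pi * m%:~R / N%:R) : R[i]) ^+ j = 0.
Proof.
move=> N0 m0 mN; set y := expi _.
have N0' : (0 : R) < N%:R by rewrite ltr0n.
have y1 : y != 1.
  apply: expi_neq1.
  rewrite 3!normrM normfV (ger0_norm (pi_ge0 R)) !normr_nat.
  rewrite divr_gt0//= ?mulr_gt0 ?pi_gt0 ?normr_gt0 ?intr_eq0//.
  rewrite ltr_pdivrMr// ltr_pM2l ?mulr_gt0 ?pi_gt0//.
  by rewrite -intr_norm -[N%:R]/(N%:Z%:~R) ltr_int.
have yN : y ^+ N = 1.
  rewrite /y -expi_mulrn -(mulr_natr (_ / _)) divfK ?gt_eqF//.
  have e2 : expi (2 * pi) = 1 :> R[i].
    by rewrite /expi mulr_natl cos2pi sin2pi.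
  have en n : expi (2 * pi *+ n) = 1 :> R[i] by rewrite expi_mulrn e2 expr1n.
  case: m {m0 mN y y1} => n; first by rewrite -[n%:~R]/(n%:R) mulr_natr.
  rewrite NegzE mulrNz mulrN -[_%:~R]/(n.+1%:R) mulr_natr -conjc_expi en.
  by rewrite conjc1.
have := subrX1 y N; rewrite yN subrr => /esym/eqP.
by rewrite mulf_eq0 subr_eq0 (negbTE y1)/= => /eqP.
Qed.

(** Cauchy's integral is replaced by an average over [N = size P] equidistant points of the circle.
    The average isolates the coefficient exactly, since two indices below [N] differ by less than
    [N]. *)
Lemma cauchy_coef P (rho M : R) k : 0 < rho ->
  (forall z, cabs z = rho -> cabs P.[z] <= M) -> cabs P`_k * rho ^+ k <= M.
Proof.
move=> rho0 PM.
have M0 : 0 <= M.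
  by rewrite (le_trans _ (PM rho%:C _))// ?cabs_ge0// cabs_real gtr0_norm.
have [kP|kP] := leqP (size P) k.
  by rewrite nth_default// ComplexField.Normc.normc0 mul0r.
set N := size P in kP *.
have N0 : (0 < N)%N by exact: leq_ltn_trans kP.
have N0' : (0 : R) < N%:R by rewrite ltr0n.
pose t (j : 'I_N) : R := 2 * pi / N%:R * j%:R.
have E : \sum_(j < N) P.[rho%:C * expi (t j)] * expi (- (t j) *+ k) =
    (N%:R * rho ^+ k)%:C * P`_k.
  transitivity (\sum_(j < N) \sum_(l < N) P`_l * (rho ^+ l)%:C *
      (expi (2 * pi * (l%:Z - k%:Z)%:~R / N%:R) : R[i]) ^+ j).
    apply: eq_bigr => j _; rewrite horner_coef mulr_suml; apply: eq_bigr => l _.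
    rewrite exprMn -!mulrA rmorphXn; congr (_ * (_ * _)).
    rewrite -!expi_mulrn -expiD; congr expi.
    rewrite -[X in X + _]mulr_natr -[X in _ + X]mulr_natr -[RHS]mulr_natr.
    rewrite /t rmorphB /= -!pmulrn; field.
    by rewrite gt_eqF.
  rewrite exchange_big /= (bigD1 (Ordinal kP))//= [X in _ + X]big1 ?addr0.
    under eq_bigr do rewrite subrr mulr0 mul0r expi0 expr1n mulr1.
    by rewrite sumr_const card_ord -[LHS]mulr_natl mulrCA rmorphM rmorph_nat mulrC.
  move=> l lk; rewrite -mulr_sumr sum_roots_of_unity ?mulr0//.
  - by rewrite subr_eq0 eqz_nat.
  - have := ltn_ord l; have := kP; move: (le0z_nat l) (le0z_nat k).
    rewrite -!ltz_nat.
    by rewrite ltr_norml => *; apply/andP; split; lra.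
have : cabs (\sum_(j < N) P.[rho%:C * expi (t j)] * expi (- (t j) *+ k)) <=
    N%:R * M.
  rewrite (le_trans (cabs_sum _ _ _))// mulr_natl -[X in _ *+ X]card_ord -sumr_const.
  apply: ler_sum => j _; rewrite cabsM cabs_expi mulr1 PM//.
  by rewrite cabsM cabs_expi mulr1 cabs_real gtr0_norm.
rewrite E cabsM cabs_real ger0_norm ?mulr_ge0 ?exprn_ge0 ?(ltW rho0)//.
by rewrite -mulrA ler_pM2l// mulrC.
Qed.

Lemma bernoulli (d : R) n : 0 <= d -> 1 + n%:R * d <= (1 + d) ^+ n.
Proof.
move=> d0; elim: n => [|n ih]; first by rewrite mul0r addr0 expr0.
rewrite exprS (le_trans _ (ler_wpM2l _ ih)) ?addr_ge0//.
have : 0 <= n%:R * d ^+ 2 by rewrite mulr_ge0// sqr_ge0.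
by rewrite -natr1; lra.
Qed.

(** If [x > y], then [(x / y) ^ n] grows faster than the linear factor: Bernoulli's inequality,
    squared, already gives quadratic growth. *)
Lemma le_of_expr_le (d : nat) (x y : R) : 0 <= x -> 0 <= y ->
  (forall n, x ^+ n <= (d * n).+1%:R * y ^+ n) -> x <= y.
Proof.
move=> x0; rewrite le_eqVlt => /predU1P[<-|y0] h.
  by have := h 1%N; rewrite !expr1 mulr0.
rewrite leNgt; apply/negP => yx.
pose e := x / y - 1; have e0 : 0 < e by rewrite subr_gt0 ltr_pdivlMr// mul1r.
have q n : (1 + e) ^+ n <= (d * n).+1%:R.
  rewrite /e addrC subrK expr_div_n ler_pdivrMr ?exprn_gt0//.
(* The exponent used is [2 m]: there the hypothesis bounds [(1 + m e) ^ 2] by [2 d m + 1], while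
   this choice of [m] gives [m ^ 2 e ^ 2 > 2 d m]. *)
have [m m1] : exists m : nat, 2 * d%:R < m%:R * e ^+ 2.
  exists (Num.truncn (2 * d%:R / e ^+ 2)).+1.
  by rewrite -ltr_pdivrMr ?exprn_gt0// truncnS_gt.
have m0 : 0 < (m%:R : R).
  rewrite ltr0n lt0n; apply/eqP => m0; move: m1; rewrite m0 mul0r.
  by rewrite ltNge mulr_ge0.
have : (1 + m%:R * e) ^+ 2 <= (d * (m * 2)).+1%:R.
  rewrite (le_trans _ (q _))// exprM lerXn2r ?nnegrE ?bernoulli ?ltW//.
  by rewrite addr_gt0// mulr_gt0.
  by rewrite exprn_gt0// addr_gt0.
rewrite -natr1 !natrM => h2.
have : 2 * d%:R * m%:R < m%:R * e ^+ 2 * m%:R by rewrite ltr_pM2r.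
have : 0 < m%:R * e by rewrite mulr_gt0.
nra.
Qed.

(* Hadamard's three-circle theorem.  Cauchy's estimate interpolates between the
   two outer circles coefficient by coefficient; applied to [P ^+ n] it loses
   only a factor linear in [n], which the n-th root removes in the limit. *)
Lemma three_circles P (r0 r1 M0 M1 th : R) : 0 < r0 -> 0 < r1 ->
  0 <= M0 -> 0 <= M1 -> 0 <= th <= 1 ->
  (forall z, cabs z = r0 -> cabs P.[z] <= M0) ->
  (forall z, cabs z = r1 -> cabs P.[z] <= M1) ->
  forall z, cabs z = r0 `^ (1 - th) * r1 `^ th ->
  cabs P.[z] <= M0 `^ (1 - th) * M1 `^ th.
Proof.
move=> r00 r10 M00 M10 /andP[th0 th1] P0 P1 z zr.
apply: (@le_of_expr_le (size P).-1); rewrite ?cabs_ge0 ?mulr_ge0 ?powR_ge0//.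
move=> n; rewrite -cabsX -horner_exp.
set Q := P ^+ n.
have Q0 k : cabs Q`_k * r0 ^+ k <= M0 ^+ n.
  apply: cauchy_coef => // w /P0 h.
  by rewrite horner_exp cabsX lerXn2r// nnegrE cabs_ge0.
have Q1 k : cabs Q`_k * r1 ^+ k <= M1 ^+ n.
  apply: cauchy_coef => // w /P1 h.
  by rewrite horner_exp cabsX lerXn2r// nnegrE cabs_ge0.
have pw (x : R) k t : 0 <= x -> (x `^ t) ^+ k = (x ^+ k) `^ t.
  move=> x0; rewrite -(powR_mulrn k (powR_ge0 x t)) -(powR_mulrn k x0).
  by rewrite -!powRrM mulrC.
have Qz k : cabs Q`_k * cabs z ^+ k <= (M0 `^ (1 - th) * M1 `^ th) ^+ n.
  have [->|Qk] := eqVneq (cabs Q`_k) 0.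
    by rewrite mul0r exprn_ge0// mulr_ge0// powR_ge0.
  have {1}-> : cabs Q`_k = cabs Q`_k `^ (1 - th) * cabs Q`_k `^ th.
    rewrite -powRD ?subrK ?powRr1 ?cabs_ge0//.
    by rewrite Qk implybT.
  have [r00' r10'] := (ltW r00, ltW r10).
  rewrite zr !exprMn !pw// mulrACA -!powRM ?exprn_ge0 ?cabs_ge0//.
  by apply: ler_pM; rewrite ?powR_ge0//; apply: ge0_ler_powR;
    rewrite ?nnegrE ?subr_ge0 ?mulr_ge0 ?cabs_ge0 ?exprn_ge0.
rewrite horner_coef (le_trans (cabs_sum _ _ _))//.
apply: (@le_trans _ _ (\sum_(i < size Q) (M0 `^ (1 - th) * M1 `^ th) ^+ n)).
  by apply: ler_sum => k _; rewrite cabsM cabsX.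
rewrite sumr_const card_ord -[leLHS]mulr_natl ler_wpM2r ?exprn_ge0 ?mulr_ge0 ?powR_ge0//.
by rewrite ler_nat size_exp_leq.
Qed.

End three_circles.

(** Declared as a hint so that the filter lemmas ([filterS], [filterS2]) apply directly to
    almost-everywhere statements. *)
Lemma lebesgue_ae_filter {R : realType} :
  Filter (almost_everywhere (@lebesgue_measure R)).
Proof. exact: ae_filter_ringOfSetsType. Qed.

#[global] Hint Extern 0 (Filter (nbhs (almost_everywhere _))) =>
  (exact: lebesgue_ae_filter) : typeclass_instances.

(** * Integration of complex-valued functions *)

Section complex_measurability.
Context {R : realType} d (T : measurableType d).
Implicit Types f g : T -> R[i].

Definition cmeasurable f :=
  measurable_fun setT (fun x => complex.Re (f x)) /\
  measurable_fun setT (fun x => complex.Im (f x)).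

Lemma cmeasurable_cst z : cmeasurable (fun=> z).
Proof. by split; exact: measurable_cst. Qed.

Lemma cmeasurableD f g : cmeasurable f -> cmeasurable g ->
  cmeasurable (fun x => f x + g x).
Proof.
move=> [f1 f2] [g1 g2]; split.
- rewrite (_ : (fun _ => _) = (fun x => complex.Re (f x) + complex.Re (g x))).
    exact: measurable_funD.
  by apply/funext => x; case: (f x) => ? ?; case: (g x).
- rewrite (_ : (fun _ => _) = (fun x => complex.Im (f x) + complex.Im (g x))).
    exact: measurable_funD.
  by apply/funext => x; case: (f x) => ? ?; case: (g x).
Qed.

Lemma cmeasurableM f g : cmeasurable f -> cmeasurable g ->
  cmeasurable (fun x => f x * g x).
Proof.
move=> [f1 f2] [g1 g2]; split.
- rewrite (_ : (fun _ => _) = (fun x => complex.Re (f x) * complex.Re (g x) -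
    complex.Im (f x) * complex.Im (g x))).
    by apply: measurable_funB; exact: measurable_funM.
  by apply/funext => x; case: (f x) => ? ?; case: (g x).
- rewrite (_ : (fun _ => _) = (fun x => complex.Re (f x) * complex.Im (g x) +
    complex.Im (f x) * complex.Re (g x))).
    by apply: measurable_funD; exact: measurable_funM.
  by apply/funext => x; case: (f x) => ? ?; case: (g x).
Qed.

Lemma cmeasurable_conj f : cmeasurable f -> cmeasurable (fun x => conjc (f x)).
Proof.
move=> [f1 f2]; split.
- rewrite (_ : (fun _ => _) = (fun x => complex.Re (f x)))//.
  by apply/funext => x; case: (f x).
- rewrite (_ : (fun _ => _) = (fun x => - complex.Im (f x))).
    exact: measurable_funN.
  by apply/funext => x; case: (f x).
Qed.

Lemma cmeasurable_real (g : T -> R) : measurable_fun setT g ->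
  cmeasurable (fun x => (g x)%:C).
Proof. by move=> mg; split => //; exact: measurable_cst. Qed.

Lemma cmeasurableZ z f : cmeasurable f -> cmeasurable (fun x => z * f x).
Proof. by apply: cmeasurableM; exact: cmeasurable_cst. Qed.

Lemma cmeasurableN f : cmeasurable f -> cmeasurable (fun x => - f x).
Proof.
move=> /(cmeasurableZ (-1)); rewrite (_ : (fun x => -1 * f x) = fun x => - f x)//.
by apply/funext => x; rewrite mulN1r.
Qed.

Lemma cmeasurableB f g : cmeasurable f -> cmeasurable g ->
  cmeasurable (fun x => f x - g x).
Proof. by move=> mf /cmeasurableN; exact: cmeasurableD. Qed.

Lemma cmeasurable_expi (g : T -> R) : measurable_fun setT g ->
  cmeasurable (fun x => expi (g x)).
Proof.
by move=> mg; split; apply: measurableT_comp => //;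
  apply: continuous_measurable_fun; [exact: continuous_cos|exact: continuous_sin].
Qed.

Lemma measurable_cabs f : cmeasurable f -> measurable_fun setT (fun x => cabs (f x)).
Proof.
move=> [f1 f2]; under eq_fun do rewrite cabs_def.
apply: (@measurableT_comp _ _ _ _ _ _ (@Num.sqrt R)).
  by apply: continuous_measurable_fun; exact: sqrt_continuous.
by apply: measurable_funD; exact: measurable_funX.
Qed.

End complex_measurability.

Lemma cmeasurable_comp {R : realType} d d' (T : measurableType d)
    (U : measurableType d') (f : U -> R[i]) (h : T -> U) :
  measurable_fun setT h -> cmeasurable f -> cmeasurable (fun x => f (h x)).
Proof.
by move=> mh [f1 f2]; split; [exact: (measurableT_comp f1)|exact: (measurableT_comp f2)].
Qed.

Section complex_integral.
Context {R : realType}.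
Local Notation mu := (@lebesgue_measure R).
Implicit Types (f g : R -> R[i]) (z : R[i]).

Definition cintegrable f :=
  cmeasurable f /\ (\int[mu]_x (cabs (f x))%:E < +oo)%E.

Lemma integrable_Re f : cintegrable f ->
  mu.-integrable setT (EFin \o (fun x => complex.Re (f x))).
Proof.
move=> [[f1 f2] fi]; apply/integrableP; split; first exact/measurable_EFinP.
apply: le_lt_trans fi; apply: ge0_le_integral => //=.
- by apply/measurable_EFinP; exact: measurableT_comp.
- by apply/measurable_EFinP; exact: measurable_cabs.
- by move=> x _; rewrite lee_fin normr_Re_le.
Qed.

Lemma integrable_Im f : cintegrable f ->
  mu.-integrable setT (EFin \o (fun x => complex.Im (f x))).
Proof.
move=> [[f1 f2] fi]; apply/integrableP; split; first exact/measurable_EFinP.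
apply: le_lt_trans fi; apply: ge0_le_integral => //=.
- by apply/measurable_EFinP; exact: measurableT_comp.
- by apply/measurable_EFinP; exact: measurable_cabs.
- by move=> x _; rewrite lee_fin normr_Im_le.
Qed.

Lemma integrable_cabs f : cintegrable f ->
  mu.-integrable setT (EFin \o (fun x => cabs (f x))).
Proof.
move=> [mf fi]; apply/integrableP; split.
  by apply/measurable_EFinP; exact: measurable_cabs.
by under eq_integral do rewrite /= ger0_norm ?cabs_ge0//.
Qed.

Lemma cintegrable_le f (G : R -> R) : cmeasurable f ->
  mu.-integrable setT (EFin \o G) -> (forall x, cabs (f x) <= G x) ->
  cintegrable f.
Proof.
move=> mf /integrableP[mG iG] fG; split => //; apply: le_lt_trans iG.
apply: ge0_le_integral => //=.
- by move=> x _; rewrite lee_fin cabs_ge0.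
- by apply/measurable_EFinP; exact: measurable_cabs.
- by apply/measurable_EFinP/measurableT_comp => //; exact/measurable_EFinP.
- by move=> x _; rewrite lee_fin (le_trans (fG _))// ler_norm.
Qed.

Lemma cintegrable_le_cabs f g : cmeasurable f -> cintegrable g ->
  (forall x, cabs (f x) <= cabs (g x)) -> cintegrable f.
Proof. by move=> mf /integrable_cabs; exact: cintegrable_le. Qed.

Lemma cintegrableD f g : cintegrable f -> cintegrable g ->
  cintegrable (fun x => f x + g x).
Proof.
move=> fi gi; apply: (@cintegrable_le _ (fun x => cabs (f x) + cabs (g x))).
- by apply: cmeasurableD; [case: fi|case: gi].
- exact: (integrableD measurableT (integrable_cabs fi) (integrable_cabs gi)).
- by move=> x; exact: cabsD.
Qed.

Lemma cintegrable_mul_bounded (M : R) f g : cmeasurable f -> cintegrable g ->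
  (forall x, cabs (f x) <= M) -> cintegrable (fun x => f x * g x).
Proof.
move=> mf gi fM; apply: (@cintegrable_le _ (fun x => M * cabs (g x))).
- by apply: cmeasurableM => //; case: gi.
- exact: (integrableZl measurableT M (integrable_cabs gi)).
- by move=> x; rewrite cabsM ler_wpM2r ?cabs_ge0.
Qed.

Lemma cintegrableZ z f : cintegrable f -> cintegrable (fun x => z * f x).
Proof.
by move=> fi; apply: (@cintegrable_mul_bounded (cabs z)) => //; exact: cmeasurable_cst.
Qed.

Lemma cintegrableN f : cintegrable f -> cintegrable (fun x => - f x).
Proof.
move=> fi; apply: (cintegrable_le_cabs _ fi); first by apply: cmeasurableN; case: fi.
by move=> x; rewrite cabsN.
Qed.

Lemma cintegrableB f g : cintegrable f -> cintegrable g ->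
  cintegrable (fun x => f x - g x).
Proof. by move=> fi /cintegrableN; exact: cintegrableD. Qed.

Lemma cintegrable_conj f : cintegrable f -> cintegrable (fun x => conjc (f x)).
Proof.
move=> fi; apply: (cintegrable_le_cabs _ fi); first by apply: cmeasurable_conj; case: fi.
by move=> x; rewrite cabs_conj.
Qed.

Lemma cintegrable0 : cintegrable (fun=> 0).
Proof.
split; first exact: cmeasurable_cst.
by under eq_integral do rewrite ComplexField.Normc.normc0; rewrite integral0 ltry.
Qed.

Lemma cintegrable_sum I (s : seq I) (F : I -> R -> R[i]) :
  (forall i, cintegrable (F i)) -> cintegrable (fun x => \sum_(i <- s) F i x).
Proof.
move=> mF; elim: s => [|i s ih].
  by under eq_fun do rewrite big_nil; exact: cintegrable0.
by under eq_fun do rewrite big_cons; exact: cintegrableD.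
Qed.

Lemma eq_cintegral f g : f =1 g -> cintegral f = cintegral g.
Proof. by move=> /funext ->. Qed.

Lemma cintegralD f g : cintegrable f -> cintegrable g ->
  cintegral (fun x => f x + g x) = cintegral f + cintegral g.
Proof.
move=> fi gi; apply/eqP; rewrite eq_complex; apply/andP; split; apply/eqP => /=.
- rewrite -(RintegralD measurableT (integrable_Re fi) (integrable_Re gi)).
  by apply: eq_Rintegral => x _; case: (f x) => ? ?; case: (g x).
- rewrite -(RintegralD measurableT (integrable_Im fi) (integrable_Im gi)).
  by apply: eq_Rintegral => x _; case: (f x) => ? ?; case: (g x).
Qed.

Lemma cintegralZ z f : cintegrable f ->
  cintegral (fun x => z * f x) = z * cintegral f.
Proof.
move=> fi; have fr := integrable_Re fi; have fj := integrable_Im fi.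
case: z => a b; apply/eqP; rewrite eq_complex; apply/andP; split; apply/eqP => /=.
- rewrite -!RintegralZl// -RintegralB//; last 2 first.
  + exact: (integrableZl measurableT a fr).
  + exact: (integrableZl measurableT b fj).
  by apply: eq_Rintegral => x _; case: (f x).
- rewrite -!RintegralZl// -RintegralD//; last 2 first.
  + exact: (integrableZl measurableT a fj).
  + exact: (integrableZl measurableT b fr).
  by apply: eq_Rintegral => x _; case: (f x).
Qed.

Lemma cintegralN f : cintegrable f ->
  cintegral (fun x => - f x) = - cintegral f.
Proof.
move=> fi; rewrite -mulN1r -cintegralZ//.
by apply: eq_cintegral => x; rewrite mulN1r.
Qed.

Lemma cintegralB f g : cintegrable f -> cintegrable g ->
  cintegral (fun x => f x - g x) = cintegral f - cintegral g.
Proof.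
by move=> fi gi; rewrite cintegralD// ?cintegralN//; exact: cintegrableN.
Qed.

Lemma cintegral0 : cintegral (fun=> 0 : R[i]) = 0 :> R[i].
Proof.
apply/eqP; rewrite eq_complex /= /Rintegral /=.
by rewrite !integral0_eq ?eqxx.
Qed.

Lemma cintegral_sum I (s : seq I) (F : I -> R -> R[i]) :
  (forall i, cintegrable (F i)) ->
  cintegral (fun x => \sum_(i <- s) F i x) = \sum_(i <- s) cintegral (F i).
Proof.
move=> mF; elim: s => [|i s ih].
  by under eq_cintegral do rewrite big_nil; rewrite cintegral0 big_nil.
under eq_cintegral do rewrite big_cons.
by rewrite big_cons cintegralD// ?ih//; exact: cintegrable_sum.
Qed.

Lemma cintegral_conj f : cintegrable f ->
  cintegral (fun x => conjc (f x)) = conjc (cintegral f).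
Proof.
move=> fi; apply/eqP; rewrite eq_complex; apply/andP; split; apply/eqP => /=.
- by apply: eq_Rintegral => x _; case: (f x).
- rewrite -mulN1r -RintegralZl//; last exact: integrable_Im.
  by apply: eq_Rintegral => x _; rewrite mulN1r; case: (f x).
Qed.

Lemma cintegral_real (g : R -> R) :
  cintegral (fun x => (g x)%:C) = (\int[mu]_x g x)%R%:C.
Proof.
apply/eqP; rewrite eq_complex /= eqxx /= /Rintegral.
by rewrite integral0_eq.
Qed.

(** The integral is defined by components, so the bound comes from a rotation: [|I| ^ 2] is the
    integral of the real part of [conjc I * f], which is at most [|I|] times the integral of
    [|f|]. *)
Lemma cabs_cintegral_Rint f : cintegrable f ->
  cabs (cintegral f) <= \int[mu]_x cabs (f x).
Proof.
move=> fi; set I := cintegral f.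
have J0 : 0 <= \int[mu]_x cabs (f x).
  by apply: Rintegral_ge0 => x _; rewrite cabs_ge0.
have [I0|I0] := eqVneq (cabs I) 0; first by rewrite I0.
have Ipos : 0 < cabs I by rewrite lt_def I0 cabs_ge0.
have : cabs I ^+ 2 <= cabs I * \int[mu]_x cabs (f x).
  have -> : cabs I ^+ 2 = \int[mu]_x complex.Re (conjc I * f x).
    have := cintegralZ (conjc I) fi; rewrite -/I mulrC mulr_conjc.
    by move/(congr1 (@complex.Re R)) => /= <-.
  rewrite -RintegralZl//; last exact: integrable_cabs.
  apply: le_Rintegral => //.
  - by apply: integrable_Re; exact: cintegrableZ.
  - exact: (integrableZl measurableT (cabs I) (integrable_cabs fi)).
  - move=> x _; rewrite (le_trans (ler_norm _))// (le_trans (normr_Re_le _))//.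
    by rewrite cabsM cabs_conj.
by rewrite expr2 ler_pM2l.
Qed.

Lemma Rint_cabsE f : cintegrable f ->
  (\int[mu]_x cabs (f x))%R%:E = (\int[mu]_x (cabs (f x))%:E)%E.
Proof.
by move=> fi; rewrite /Rintegral fineK//; exact: integrable_fin_num (integrable_cabs fi).
Qed.

Lemma cabs_cintegral f : cintegrable f ->
  ((cabs (cintegral f))%:E <= \int[mu]_x (cabs (f x))%:E)%E.
Proof. by move=> fi; rewrite -Rint_cabsE// lee_fin cabs_cintegral_Rint. Qed.

Lemma ae_eq_cintegral f g : cmeasurable f -> cmeasurable g ->
  {ae mu, forall x, f x = g x} -> cintegral f = cintegral g.
Proof.
move=> [f1 f2] [g1 g2] fg; rewrite /cintegral /Rintegral.
congr (fine _ +i* fine _); apply: ae_eq_integral => //;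
  try exact/measurable_EFinP; by move: fg; apply: filterS => x /= -> _.
Qed.

(** Stated through the modulus, so that limits of complex sequences reduce to limits of real ones;
    [ccvgP] passes to components. *)
Definition ccvg (u : nat -> R[i]) (l : R[i]) :=
  cabs (u n - l) @[n --> \oo] --> (0 : R).

Lemma ccvgP u l : ccvg u l <->
  (complex.Re (u n) @[n --> \oo] --> complex.Re l) /\
  (complex.Im (u n) @[n --> \oo] --> complex.Im l).
Proof.
have Re_B z w : complex.Re (z - w) = complex.Re z - complex.Re w.
  by case: z => ? ?; case: w.
have Im_B z w : complex.Im (z - w) = complex.Im z - complex.Im w.
  by case: z => ? ?; case: w.
split=> [ul|[/cvgrPdist_lt h1 /cvgrPdist_lt h2]].
  split; apply/cvgrPdist_lt => e e0; have /cvgrPdist_lt/(_ _ e0) := ul;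
  apply: filterS => n; rewrite sub0r normrN (ger0_norm (cabs_ge0 _)) distrC.
  + by rewrite -Re_B; apply: le_lt_trans; exact: normr_Re_le.
  + by rewrite -Im_B; apply: le_lt_trans; exact: normr_Im_le.
apply/cvgrPdist_lt => e e0; have e2 : 0 < e / 2 by rewrite divr_gt0.
have := h2 _ e2; have := h1 _ e2; apply: filterS2 => n a b.
rewrite sub0r normrN (ger0_norm (cabs_ge0 _)) (le_lt_trans (cabs_le_ReIm _))//.
by rewrite Re_B Im_B [e]splitr ltrD// distrC.
Qed.

Lemma ccvg_unique u l l' : ccvg u l -> ccvg u l' -> l = l'.
Proof.
move=> /ccvgP[a1 a2] /ccvgP[b1 b2]; apply/eqP; rewrite eq_complex.
by rewrite (cvg_unique _ a1 b1)// (cvg_unique _ a2 b2)// !eqxx.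
Qed.

Lemma ccvg_cst l : ccvg (fun=> l) l.
Proof. by apply/ccvgP; split; exact: cvg_cst. Qed.

Lemma ccvgM u v l m : ccvg u l -> ccvg v m -> ccvg (fun n => u n * v n) (l * m).
Proof.
move=> /ccvgP[a1 a2] /ccvgP[b1 b2]; apply/ccvgP; split.
- rewrite complexReM; under eq_cvg do rewrite complexReM.
  by apply: cvgB; exact: cvgM.
- rewrite complexImM; under eq_cvg do rewrite complexImM.
  by apply: cvgD; exact: cvgM.
Qed.

Lemma ccvg_le u l (B : nat -> R) : (forall n, cabs (u n - l) <= B n) ->
  B n @[n --> \oo] --> (0 : R) -> ccvg u l.
Proof.
move=> uB B0; apply: (@squeeze_cvgr _ _ _ _ (fun=> 0)) B0; last exact: cvg_cst.
by apply: nearW => n; rewrite cabs_ge0 uB.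
Qed.

Lemma ccvg_cabs u l : ccvg u l -> cabs (u n) @[n --> \oo] --> cabs l.
Proof.
move=> ul; apply/cvgrPdist_lt => e e0; have /cvgrPdist_lt/(_ _ e0) := ul.
apply: filterS => n; rewrite sub0r normrN (ger0_norm (cabs_ge0 _)).
apply: le_lt_trans; rewrite ler_norml lerNl opprB.
apply/andP; split.
  by rewrite lerBlDr (le_trans _ (cabsD _ _))// subrK.
rewrite lerBlDr -[cabs (u n - l)]cabsN opprB (le_trans _ (cabsD _ _))//.
by rewrite subrK.
Qed.

Lemma dominated_ccvg (F : nat -> R -> R[i]) f (G : R -> R) :
  (forall n, cmeasurable (F n)) -> cmeasurable f ->
  mu.-integrable setT (EFin \o G) -> (forall n x, cabs (F n x) <= G x) ->
  (forall x, ccvg (F ^~ x) (f x)) ->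
  ccvg (fun n => cintegral (F n)) (cintegral f).
Proof.
move=> mF mf iG FG Ff.
have real_dct (H : nat -> R -> R) (h : R -> R) :
    (forall n, measurable_fun setT (H n)) -> measurable_fun setT h ->
    (forall n x, `|H n x| <= G x) -> (forall x, H n x @[n --> \oo] --> h x) ->
    (\int[mu]_x H n x)%R @[n --> \oo] --> (\int[mu]_x h x)%R.
  move=> mH mh HG Hh.
  have [] := @dominated_convergence _ _ R mu setT measurableT
    (fun n => EFin \o H n) (EFin \o h) (EFin \o G).
  - by move=> n; apply/measurable_EFinP; exact: mH.
  - exact/measurable_EFinP.
  - by apply/aeW => x _; apply/fine_cvgP; split; [exact: nearW|exact: Hh].
  - exact: iG.
  - by apply/aeW => x n _; rewrite /= lee_fin.
  move=> ih _ cv.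
  by apply: fine_cvg; rewrite fineK//; exact: integrable_fin_num ih.
apply/ccvgP; split => /=.
- apply: real_dct; [by move=> n; case: (mF n)|by case: mf| |].
  + by move=> n x; rewrite (le_trans (normr_Re_le _)).
  + by move=> x; have /ccvgP[] := Ff x.
- apply: real_dct; [by move=> n; case: (mF n)|by case: mf| |].
  + by move=> n x; rewrite (le_trans (normr_Im_le _)).
  + by move=> x; have /ccvgP[] := Ff x.
Qed.

End complex_integral.

(** * Invariance of the integral under reflection and translation *)

Section change_of_variables.
Context {R : realType}.
Local Notation mu := (@lebesgue_measure R).

Definition lebesgue_preserving (h : R -> R) :=
  measurable_fun setT h /\
  forall A, measurable A -> pushforward mu (h : R -> measurableTypeR R) A = mu A.

Lemma lebesgue_preserving_opp : lebesgue_preserving -%R.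
Proof. by split; [exact: oppr_measurable|exact: lebesgue_measureN]. Qed.

(** The image measure agrees with Lebesgue measure on half-open intervals, which determine it. *)
Lemma lebesgue_preserving_shift (a : R) : lebesgue_preserving (fun x => x + a).
Proof.
have mh : measurable_fun setT (fun x : R => x + a).
  by apply: measurable_funD => //; exact: measurable_cst.
split => // A mA.
pose h := (fun x => x + a) : measurableTypeR R -> measurableTypeR R.
have mh' : measurable_fun setT h by [].
pose m1 := isMeasurableFun.Build _ _ _ _ h mh'.
pose hp : {mfun _ >-> _} := HB.pack h m1.
apply/esym; apply: (@lebesgue_measure_unique R (pushforward mu hp)) => // _ [[x y]] _ <-.
transitivity (mu `]x - a, y - a]%classic); last first.
  by congr (mu _); apply/seteqP; split => z /=;
    rewrite /h !in_itv/= ltrBlDr lerBrDr.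
rewrite !lebesgue_measure_itv /= !lte_fin ltrD2r -!EFinB.
by rewrite opprB addrA subrK.
Qed.

Lemma ge0_integral_preserving (h : R -> R) (f : R -> \bar R) :
  lebesgue_preserving h -> measurable_fun setT f -> (forall x, 0 <= f x)%E ->
  (\int[mu]_x f (h x) = \int[mu]_x f x)%E.
Proof.
move=> [mh hmu] mf f0.
transitivity (\int[pushforward mu (h : R -> measurableTypeR R)]_x f x)%E.
  by rewrite ge0_integral_pushforward.
by apply: eq_measure_integral => A mA _; exact: hmu.
Qed.

Lemma Rintegral_preserving (h f : R -> R) :
  lebesgue_preserving h -> measurable_fun setT f ->
  (\int[mu]_x f (h x) = \int[mu]_x f x)%R.
Proof.
move=> hh mf; rewrite /Rintegral; congr fine.
have mf' : measurable_fun setT (fun x => (f x)%:E) by exact/measurable_EFinP.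
rewrite integralE [RHS]integralE; congr (_ - _)%E.
- rewrite -[RHS](ge0_integral_preserving hh (measurable_funepos mf'))//.
  by apply: eq_integral => x _; rewrite !funeposE.
- rewrite -[RHS](ge0_integral_preserving hh (measurable_funeneg mf'))//.
  by apply: eq_integral => x _; rewrite !funenegE.
Qed.

Lemma cintegral_preserving (h : R -> R) (f : R -> R[i]) :
  lebesgue_preserving h -> cmeasurable f ->
  cintegral (fun x => f (h x)) = cintegral f.
Proof.
move=> hh [f1 f2]; rewrite /cintegral.
by rewrite (Rintegral_preserving hh f1) (Rintegral_preserving hh f2).
Qed.

Lemma cintegrable_preserving (h : R -> R) (f : R -> R[i]) :
  lebesgue_preserving h -> cintegrable f -> cintegrable (fun x => f (h x)).
Proof.
move=> hh [mf fi]; split; first by apply: cmeasurable_comp mf; case: hh.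
rewrite (ge0_integral_preserving hh (f := fun x => (cabs (f x))%:E))//.
- by apply/measurable_EFinP; exact: measurable_cabs.
- by move=> x; rewrite lee_fin cabs_ge0.
Qed.

End change_of_variables.

(** * Fubini's theorem for complex integrands *)

Section fubini.
Context {R : realType}.
Local Notation mu := (@lebesgue_measure R).

Lemma measurable_integral2 (f : R * R -> \bar R) : measurable_fun setT f ->
  measurable_fun setT (fun x => \int[mu]_y f (x, y))%E.
Proof.
move=> mf; rewrite (_ : (fun _ => _) = fun x =>
    (\int[mu]_y f^\+ (x, y) - \int[mu]_y f^\- (x, y))%E); last first.
  apply/funext => x; rewrite integralE.
  by congr (_ - _)%E; apply: eq_integral => y _; rewrite ?funeposE ?funenegE.
apply: emeasurable_funB.
- apply: (measurable_fun_fubini_tonelli_F (m2 := mu) f^\+%E) => //.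
  exact: measurable_funepos.
- apply: (measurable_fun_fubini_tonelli_F (m2 := mu) f^\-%E) => //.
  exact: measurable_funeneg.
Qed.

Lemma cmeasurable_cintegral (F : R -> R -> R[i]) :
  cmeasurable (fun z : R * R => F z.1 z.2) ->
  cmeasurable (fun x => cintegral (F x)).
Proof.
move=> [F1 F2]; split => /=.
- apply: (@measurableT_comp _ _ _ _ _ _ fine) => //.
  by apply: (measurable_integral2 (f := fun z => (complex.Re (F z.1 z.2))%:E));
    exact/measurable_EFinP.
- apply: (@measurableT_comp _ _ _ _ _ _ fine) => //.
  by apply: (measurable_integral2 (f := fun z => (complex.Im (F z.1 z.2))%:E));
    exact/measurable_EFinP.
Qed.

Lemma cmeasurable_slice1 (F : R -> R -> R[i]) x :
  cmeasurable (fun z : R * R => F z.1 z.2) -> cmeasurable (F x).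
Proof.
by apply: (cmeasurable_comp (h := fun y => (x, y))); exact: measurable_pair1.
Qed.

Lemma cmeasurable_slice2 (F : R -> R -> R[i]) y :
  cmeasurable (fun z : R * R => F z.1 z.2) -> cmeasurable (F ^~ y).
Proof.
by apply: (cmeasurable_comp (h := fun x => (x, y))); exact: measurable_pair2.
Qed.

(** Integrability of every slice makes the inner integrals finite, so that [fine] can be undone and
    the extended-real theorem applies. *)
Lemma Rfubini (F : R -> R -> R) :
  measurable_fun setT (fun z : R * R => F z.1 z.2) ->
  (\int[mu]_x \int[mu]_y `|F x y|%:E < +oo)%E ->
  (forall x, mu.-integrable setT (EFin \o F x)) ->
  (forall y, mu.-integrable setT (EFin \o (F ^~ y))) ->
  (\int[mu]_x \int[mu]_y F x y = \int[mu]_y \int[mu]_x F x y)%R.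
Proof.
move=> mF iF i1 i2; rewrite /Rintegral; congr fine.
transitivity (\int[mu]_x \int[mu]_y (F x y)%:E)%E.
  by apply: eq_integral => x _; rewrite fineK//; exact: integrable_fin_num (i1 x).
transitivity (\int[mu]_y \int[mu]_x (F x y)%:E)%E; last first.
  by apply: eq_integral => y _; rewrite fineK//; exact: integrable_fin_num (i2 y).
have mE : measurable_fun setT (fun z : R * R => (F z.1 z.2)%:E) by exact/measurable_EFinP.
apply: (Fubini (m1 := mu) (m2 := mu) (f := fun z => (F z.1 z.2)%:E)).
by apply/integrable12ltyP.
Qed.

Lemma cfubini (F : R -> R -> R[i]) :
  cmeasurable (fun z : R * R => F z.1 z.2) ->
  (\int[mu]_x \int[mu]_y (cabs (F x y))%:E < +oo)%E ->
  (forall x, cintegrable (F x)) -> (forall y, cintegrable (F ^~ y)) ->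
  cintegral (fun x => cintegral (F x)) = cintegral (fun y => cintegral (F ^~ y)).
Proof.
move=> mF iF i1 i2.
have le1 (G : R -> R -> R) : measurable_fun setT (fun z : R * R => G z.1 z.2) ->
    (forall x y, `|G x y| <= cabs (F x y)) ->
    (\int[mu]_x \int[mu]_y `|G x y|%:E < +oo)%E.
  move=> mG GF; apply: le_lt_trans iF; apply: ge0_le_integral => //.
  - by move=> x _; exact: integral_ge0.
  - apply: (measurable_integral2 (f := fun z => `|G z.1 z.2|%:E)).
    by apply/measurable_EFinP; exact: measurableT_comp mG.
  - apply: (measurable_integral2 (f := fun z => (cabs (F z.1 z.2))%:E)).
    by apply/measurable_EFinP; exact: measurable_cabs mF.
  - move=> x _; apply: ge0_le_integral => //.
    + apply/measurable_EFinP/measurableT_comp => //.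
      apply: (measurableT_comp mG (g := fun y => (x, y))).
      exact: measurable_pair1.
    + by apply/measurable_EFinP; exact: measurable_cabs (i1 x).1.
    + by move=> y _; rewrite lee_fin.
apply/eqP; rewrite eq_complex; apply/andP; split; apply/eqP => /=.
- apply: (Rfubini (F := fun x y => complex.Re (F x y))).
  + by case: mF.
  + by apply: le1 => [|x y]; [case: mF|exact: normr_Re_le].
  + by move=> x; exact: integrable_Re (i1 x).
  + by move=> y; exact: integrable_Re (i2 y).
- apply: (Rfubini (F := fun x y => complex.Im (F x y))).
  + by case: mF.
  + by apply: le1 => [|x y]; [case: mF|exact: normr_Im_le].
  + by move=> x; exact: integrable_Im (i1 x).
  + by move=> y; exact: integrable_Im (i2 y).
Qed.

(** The integrand is dominated by [M |u x| |v y|], whose double integral factors, and each slice is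
    a bounded multiple of [u] or of [v]. *)
Lemma cfubini_kernel (u v : R -> R[i]) (K : R -> R -> R[i]) (M : R) :
  cintegrable u -> cintegrable v -> cmeasurable (fun z : R * R => K z.1 z.2) ->
  (forall x y, cabs (K x y) <= M) ->
  cintegral (fun x => u x * cintegral (fun y => v y * K x y)) =
  cintegral (fun y => v y * cintegral (fun x => u x * K x y)).
Proof.
move=> ui vi mK KM.
have M0 : 0 <= M by rewrite (le_trans _ (KM 0 0))// cabs_ge0.
have mF : cmeasurable (fun z : R * R => u z.1 * (v z.2 * K z.1 z.2)).
  apply: cmeasurableM; first by apply: (cmeasurable_comp measurable_fst); case: ui.
  apply: cmeasurableM => //; first by apply: (cmeasurable_comp measurable_snd); case: vi.
have vK x : cintegrable (fun y => v y * K x y).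
  rewrite (_ : (fun _ => _) = fun y => K x y * v y); last first.
    by apply/funext => y; rewrite mulrC.
  exact: (cintegrable_mul_bounded (cmeasurable_slice1 x mK) vi (KM x)).
have uK y : cintegrable (fun x => u x * K x y).
  rewrite (_ : (fun _ => _) = fun x => K x y * u x); last first.
    by apply/funext => x; rewrite mulrC.
  exact: (cintegrable_mul_bounded (cmeasurable_slice2 y mK) ui (KM ^~ y)).
transitivity (cintegral (fun x => cintegral (fun y => u x * (v y * K x y)))).
  by apply: eq_cintegral => x; rewrite cintegralZ.
rewrite cfubini//; last 3 first.
- apply: (@le_lt_trans _ _ (\int[mu]_x ((M * fine (\int[mu]_y (cabs (v y))%:E)) *
    cabs (u x))%:E)%E).
    have Nv : ((fine (\int[mu]_y (cabs (v y))%:E))%:E = \int[mu]_y (cabs (v y))%:E)%E.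
      by rewrite fineK//; exact: integrable_fin_num (integrable_cabs vi).
    apply: ge0_le_integral => //.
    + by move=> x _; apply: integral_ge0 => y _; rewrite lee_fin cabs_ge0.
    + apply: (measurable_integral2 (f := fun z => (cabs (u z.1 * (v z.2 * K z.1 z.2)))%:E)).
      by apply/measurable_EFinP; exact: measurable_cabs.
    + apply/measurable_EFinP/measurable_funM; first exact: measurable_cst.
      by apply: measurable_cabs; case: ui.
    + move=> x _; rewrite mulrAC EFinM Nv -ge0_integralZl//; last 3 first.
      * by apply/measurable_EFinP; apply: measurable_cabs; case: vi.
      * by move=> y _; rewrite lee_fin cabs_ge0.
      * by rewrite lee_fin mulr_ge0// cabs_ge0.
      apply: ge0_le_integral => //.
      * by move=> y _; rewrite lee_fin cabs_ge0.
      * by apply/measurable_EFinP; apply: measurable_cabs; exact: (cintegrableZ (u x) (vK x)).1.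
      * apply/measurable_EFinP/measurable_funM; first exact: measurable_cst.
        by apply: measurable_cabs; case: vi.
      * move=> y _; rewrite -EFinM lee_fin !cabsM.
        rewrite [M * _]mulrC -mulrA ler_wpM2l ?cabs_ge0// mulrC.
        by rewrite ler_wpM2r ?cabs_ge0.
  under eq_integral do rewrite EFinM.
  rewrite ge0_integralZl//; last 3 first.
  + by apply/measurable_EFinP; apply: measurable_cabs; case: ui.
  + by move=> y _; rewrite lee_fin cabs_ge0.
  + rewrite lee_fin mulr_ge0// fine_ge0// integral_ge0// => y _.
    by rewrite lee_fin cabs_ge0.
  apply: lte_mul_pinfty => //; last by case: ui.
  rewrite lee_fin mulr_ge0// fine_ge0// integral_ge0// => y _.
  by rewrite lee_fin cabs_ge0.
- by move=> x; exact: cintegrableZ.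
- move=> y; rewrite (_ : (fun _ => _) = fun x => v y * (u x * K x y)); last first.
    by apply/funext => x; rewrite mulrCA.
  exact: cintegrableZ.
apply: eq_cintegral => y; rewrite -cintegralZ//.
by apply: eq_cintegral => x; rewrite mulrCA.
Qed.

End fubini.

(** * The Fourier transform of integrable functions *)

Section fourier.
Context {R : realType}.
Local Notation mu := (@lebesgue_measure R).
Implicit Types (u v : R -> R[i]) (c : R).

(** With the frequency scale [c] as a parameter, the forward transform ([- c]), the inverse one
    ([c]) and their conjugates are instances of one definition. *)
Definition fourier c u (w : R) : R[i] :=
  cintegral (fun x => u x * expi (c * x * w)).

Lemma cmeasurable_expi2 c : cmeasurable (fun z : R * R => expi (c * z.1 * z.2)).
Proof.
apply: cmeasurable_expi; apply: measurable_funM => //.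
by apply: measurable_funM => //; exact: measurable_cst.
Qed.

Lemma cintegrable_expi (g : R -> R) u : cintegrable u ->
  measurable_fun setT g -> cintegrable (fun x => u x * expi (g x)).
Proof.
move=> ui mg; apply: (cintegrable_le_cabs _ ui).
  by apply: cmeasurableM; [case: ui|exact: cmeasurable_expi].
by move=> x; rewrite cabsM cabs_expi mulr1.
Qed.

Lemma cintegrable_fourier_arg c u w : cintegrable u ->
  cintegrable (fun x => u x * expi (c * x * w)).
Proof.
move=> ui; apply: (cintegrable_expi ui).
by apply: measurable_funM => //; apply: measurable_funM.
Qed.

Lemma cmeasurable_fourier c u : cmeasurable u -> cmeasurable (fourier c u).
Proof.
move=> mu'; apply: (cmeasurable_cintegral (F := fun w x => u x * expi (c * x * w))).
apply: cmeasurableM; first exact: (cmeasurable_comp measurable_snd).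
apply: cmeasurable_expi; apply: measurable_funM => //.
by apply: measurable_funM => //; exact: measurable_cst.
Qed.

Lemma fourier_le c u w : cintegrable u ->
  cabs (fourier c u w) <= (\int[mu]_x cabs (u x))%R.
Proof.
move=> ui; rewrite (le_trans (cabs_cintegral_Rint (cintegrable_fourier_arg c w ui)))//.
by under eq_Rintegral do rewrite cabsM cabs_expi mulr1.
Qed.

Lemma fourierB c u v w : cintegrable u -> cintegrable v ->
  fourier c (fun x => u x - v x) w = fourier c u w - fourier c v w.
Proof.
move=> ui vi; rewrite /fourier -cintegralB; try exact: cintegrable_fourier_arg.
by apply: eq_cintegral => x; rewrite mulrBl.
Qed.

Lemma fourierZ c z u w : cintegrable u ->
  fourier c (fun x => z * u x) w = z * fourier c u w.
Proof.
move=> ui; rewrite /fourier -cintegralZ; last exact: cintegrable_fourier_arg.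
by apply: eq_cintegral => x; rewrite mulrA.
Qed.

Lemma fourier_sum c I (s : seq I) (F : I -> R -> R[i]) w :
  (forall i, cintegrable (F i)) ->
  fourier c (fun x => \sum_(i <- s) F i x) w = \sum_(i <- s) fourier c (F i) w.
Proof.
move=> Fi; rewrite /fourier -cintegral_sum; last first.
  by move=> i; exact: cintegrable_fourier_arg.
by apply: eq_cintegral => x; rewrite mulr_suml.
Qed.

Lemma fourier_conj c u w : cintegrable u ->
  conjc (fourier c u w) = fourier (- c) (fun x => conjc (u x)) w.
Proof.
move=> ui; rewrite /fourier -cintegral_conj; last exact: cintegrable_fourier_arg.
by apply: eq_cintegral => x; rewrite conjcM conjc_expi !mulNr.
Qed.

(** The multiplication formula: the kernel is bounded and symmetric in its two variables, so Fubini
    moves the transform to the other factor. *)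
Lemma fourier_mult c u v : cintegrable u -> cintegrable v ->
  cintegral (fun w => v w * fourier c u w) = cintegral (fun x => u x * fourier c v x).
Proof.
move=> ui vi.
have mK : cmeasurable (fun z : R * R => expi (c * z.2 * z.1)).
  apply: cmeasurable_expi; apply: measurable_funM => //.
  by apply: measurable_funM => //; exact: measurable_cst.
have K1 (w x : R) : cabs (expi (c * x * w)) <= 1 by rewrite cabs_expi.
apply: etrans.
  exact: (@cfubini_kernel _ v u (fun w x => expi (c * x * w)) 1 vi ui mK K1).
apply: eq_cintegral => x; congr (_ * _); apply: eq_cintegral => w.
by rewrite mulrAC.
Qed.

Lemma ccvg_expi (a : nat -> R) (l : R) : a n @[n --> \oo] --> l ->
  ccvg (fun n => expi (a n)) (expi l).
Proof.
move=> al; apply/ccvgP; split => /=.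
- by apply: (cvg_comp _ _ al); exact: continuous_cos.
- by apply: (cvg_comp _ _ al); exact: continuous_sin.
Qed.

Lemma ccvg_fourier c u (w : nat -> R) (l : R) : cintegrable u ->
  w n @[n --> \oo] --> l -> ccvg (fun n => fourier c u (w n)) (fourier c u l).
Proof.
move=> ui wl; apply: (dominated_ccvg (G := fun x => cabs (u x))).
- by move=> n; case: (cintegrable_fourier_arg c (w n) ui).
- by case: (cintegrable_fourier_arg c l ui).
- exact: integrable_cabs.
- by move=> n x; rewrite cabsM cabs_expi mulr1.
- move=> x; apply: ccvgM; first exact: ccvg_cst.
  by apply: ccvg_expi; apply: cvgMr.
Qed.

End fourier.

(** * The Poisson kernel *)

Section derivative_rules.
Context {R : realType}.
Implicit Types f g : R -> R.

Lemma is_derive_mulf f g (x df dg : R) : is_derive x 1 f df -> is_derive x 1 g dg ->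
  is_derive x 1 (fun w => f w * g w) (df * g x + f x * dg).
Proof.
move=> hf hg; rewrite (_ : (fun w => f w * g w) = f * g)//.
by apply: (is_derive_eq (is_deriveM hf hg)); rewrite addrC [df * _]mulrC.
Qed.

Lemma is_derive_addf f g (x df dg : R) : is_derive x 1 f df -> is_derive x 1 g dg ->
  is_derive x 1 (fun w => f w + g w) (df + dg).
Proof. by move=> hf hg; exact: is_deriveD. Qed.

Lemma is_derive_scalef f (k x df : R) : is_derive x 1 f df ->
  is_derive x 1 (fun w => k * f w) (k * df).
Proof. by move=> hf; exact: (is_deriveZ k hf). Qed.

Lemma is_derive_compf f g (x a b : R) : is_derive (g x) 1 f a -> is_derive x 1 g b ->
  is_derive x 1 (fun w => f (g w)) (a * b).
Proof. exact: is_derive1_comp. Qed.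

Lemma is_derive_linear (k x : R) : is_derive x 1 (fun w => k * w) k.
Proof.
rewrite -[X in is_derive _ _ _ X]mulr1.
exact: (is_derive_scalef k (is_derive_id x 1)).
Qed.

Lemma continuous_mulf f g : continuous f -> continuous g ->
  continuous (fun x => f x * g x).
Proof. by move=> cf cg x; apply: cvgM; [exact: cf|exact: cg]. Qed.

Lemma continuous_compf f g : continuous f -> continuous g ->
  continuous (fun x => f (g x)).
Proof. by move=> cf cg x; apply: continuous_comp; [exact: cg|exact: cf]. Qed.

Lemma continuous_linear (k : R) : continuous (fun x : R => k * x).
Proof. exact: mulrl_continuous. Qed.

(** Here [f] may contain the absolute value of [x]. The function [g] is its smooth form on the
    half-line, where the fundamental theorem applies before symmetry doubles the result. *)
Lemma integral_even (f g F : R -> R) (l : R) : (forall x, 0 <= f x) ->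
  continuous f -> (forall x, f (- x) = f x) -> (forall x, 0 <= x -> f x = g x) ->
  (forall x : R, is_derive x 1 F (g x)) -> F x @[x --> +oo] --> l ->
  (\int[@lebesgue_measure R]_x (f x)%:E = (2 * (l - F 0))%:E)%E.
Proof.
move=> f0 cf evf fg dF Fl.
have cF x : {for x, continuous F}.
  by apply/differentiable_continuous/derivable1_diffP; apply: ex_derive.
rewrite ge0_symfun_integralT//; last by move=> x /=; rewrite evf.
rewrite (_ : [set x | _] = `[0, +oo[%classic); last first.
  by apply/seteqP; split => x/=; rewrite in_itv/= andbT.
rewrite (@ge0_continuous_FTC2y _ f F 0 l)// => [||x].
- by apply: continuous_subspaceT.
- by apply: cvg_at_right_filter; exact: cF.
- by rewrite in_itv/= andbT => x0; rewrite derive1E fg ?(ltW x0)//; exact: derive_val.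
Qed.

End derivative_rules.

Section poisson_kernel.
Context {R : realType}.
Local Notation mu := (@lebesgue_measure R).
Variable e : R.
Hypothesis e0 : 0 < e.

Lemma cvg_expR_scale : expR (- e * x) @[x --> +oo] --> (0 : R).
Proof.
have h : e * x @[x --> +oo] --> (+oo : set_system R) by exact: gt0_cvgMry.
under eq_cvg do rewrite mulNr.
exact: (cvg_comp _ _ h (@cvgr_expR R)).
Qed.

Let ne0 : e != 0. Proof. by rewrite gt_eqF. Qed.

Definition expabs (w : R) : R := expR (- e * `|w|).

Lemma expabs_ge0 w : 0 <= expabs w.
Proof. exact: expR_ge0. Qed.

Lemma continuous_expabs : continuous expabs.
Proof.
apply: (@continuous_compf _ expR); first exact: continuous_expR.
apply: (@continuous_compf _ (fun x => - e * x)); first exact: continuous_linear.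
exact: norm_continuous.
Qed.

Lemma measurable_expabs : measurable_fun setT expabs.
Proof. exact: continuous_measurable_fun continuous_expabs. Qed.

Lemma integral_expabs : (\int[mu]_x (expabs x)%:E = (2 / e)%:E)%E.
Proof.
have dF (x : R) : is_derive x 1 (fun x => - e^-1 * expR (- e * x)) (expR (- e * x)).
  have h := is_derive_compf (is_derive_expR _) (is_derive_linear (- e) x).
  apply: (is_derive_eq (is_derive_scalef (- e^-1) h)).
  by rewrite mulrCA mulrNN mulVf// mulr1.
have Fl : - e^-1 * expR (- e * x) @[x --> +oo] --> (0 : R).
  by rewrite -[X in _ --> X](mulr0 (- e^-1)); apply: cvgMr; exact: cvg_expR_scale.
have fg (x : R) : 0 <= x -> expabs x = expR (- e * x).
  by move=> x0; rewrite /expabs ger0_norm.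
have ev (x : R) : expabs (- x) = expabs x by rewrite /expabs normrN.
rewrite (integral_even expabs_ge0 continuous_expabs ev fg dF Fl).
by rewrite mulr0 expR0 mulr1 sub0r opprK.
Qed.

Lemma integrable_expabs : mu.-integrable setT (EFin \o expabs).
Proof.
apply/integrableP; split; first by apply/measurable_EFinP; exact: measurable_expabs.
under eq_integral do rewrite /= ger0_norm ?expabs_ge0//.
by rewrite integral_expabs ltry.
Qed.

Lemma cintegrable_expabs : cintegrable (fun w => (expabs w)%:C).
Proof.
apply: (@cintegrable_le _ _ expabs).
- exact: cmeasurable_real measurable_expabs.
- exact: integrable_expabs.
- by move=> x; rewrite cabs_real ger0_norm ?expabs_ge0.
Qed.

(** Adding 1 to the cosine keeps the integrand nonnegative, as [integral_even] requires;
    [integral_expabs] is subtracted afterwards. *)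
Lemma integral_expabs_cos t : (\int[mu]_x (expabs x * (1 + cos (t * x)))%:E =
  (2 / e + 2 * e / (e ^+ 2 + t ^+ 2))%:E)%E.
Proof.
have d0 : e ^+ 2 + t ^+ 2 != 0.
  by rewrite gt_eqF// ltr_pwDl ?exprn_gt0// sqr_ge0.
(* [expR (- e x) * G x] is the primitive obtained by integrating the cosine term by parts twice; it
   tends to 0 because [G] is bounded. *)
pose G x := - e^-1 + (t * sin (t * x) - e * cos (t * x)) / (e ^+ 2 + t ^+ 2).
pose f x := expabs x * (1 + cos (t * x)).
have f0 x : 0 <= f x.
  by rewrite mulr_ge0 ?expabs_ge0// -lerBlDl sub0r cos_geN1.
have cf : continuous f.
  apply: continuous_mulf; first exact: continuous_expabs.
  move=> x; apply: cvgD; first exact: cvg_cst.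
  apply: (@continuous_compf _ cos); first exact: continuous_cos.
  exact: continuous_linear.
have ev x : f (- x) = f x by rewrite /f /expabs normrN mulrN cosN.
have fg x : 0 <= x -> f x = expR (- e * x) * (1 + cos (t * x)).
  by move=> x0; rewrite /f /expabs ger0_norm.
have dF (x : R) : is_derive x 1 (fun x => expR (- e * x) * G x)
    (expR (- e * x) * (1 + cos (t * x))).
  have h := is_derive_compf (is_derive_expR _) (is_derive_linear (- e) x).
  have hs := is_derive_compf (is_derive_sin _) (is_derive_linear t x).
  have hc := is_derive_compf (is_derive_cos _) (is_derive_linear t x).
  have hG : is_derive x 1 G ((t * (cos (t * x) * t) + - e * (- sin (t * x) * t)) / (e ^+ 2 + t ^+ 2)).
    have h1 := is_derive_addf (is_derive_scalef t hs) (is_derive_scalef (- e) hc).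
    have h2 := is_derive_addf (is_derive_cst (- e^-1) x 1)
       (is_derive_scalef (e ^+ 2 + t ^+ 2)^-1 h1).
    rewrite (_ : G = fun w => cst (- e^-1) w +
      (e ^+ 2 + t ^+ 2)^-1 * (t * sin (t * w) + - e * cos (t * w))); last first.
      by apply/funext => w; rewrite /G [in RHS]mulrC mulNr.
    by apply: (is_derive_eq h2); rewrite add0r mulrC.
  apply: (is_derive_eq (is_derive_mulf h hG)); rewrite /G; field.
  by rewrite ne0 d0.
have Fl : expR (- e * x) * G x @[x --> +oo] --> (0 : R).
  pose M := e^-1 + (`|t| + e) / (e ^+ 2 + t ^+ 2).
  have GM x : `|G x| <= M.
    rewrite /G (le_trans (ler_normD _ _))// normrN (ger0_norm (ltW _)) ?invr_gt0//.
    rewrite lerD2l normrM normfV (ger0_norm (addr_ge0 (sqr_ge0 e) (sqr_ge0 t))).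
    rewrite ler_wpM2r ?invr_ge0 ?addr_ge0 ?sqr_ge0//.
    rewrite (le_trans (ler_normB _ _))// !normrM (gtr0_norm e0) lerD//.
      by rewrite ler_piMr// ler_norml sin_geN1 sin_le1.
    by rewrite ler_piMr ?(ltW e0)// ler_norml cos_geN1 cos_le1.
  apply/cvgrPdist_lt => d d0'.
  have M0 : 0 < M.
    rewrite /M ltr_pwDl ?invr_gt0// divr_ge0 ?addr_ge0 ?sqr_ge0//.
    exact: ltW.
  have /cvgrPdist_lt/(_ (d / M)) := cvg_expR_scale.
  rewrite divr_gt0// => /(_ isT); apply: filterS => x.
  rewrite !sub0r !normrN normrM (ger0_norm (expR_ge0 _)) ltr_pdivlMr//.
  by apply: le_lt_trans; rewrite ler_wpM2l ?expR_ge0.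
rewrite (integral_even f0 cf ev fg dF Fl).
congr EFin; rewrite /G !mulr0 expR0 sin0 cos0 mulr0 mulr1 mul1r; field.
by rewrite ne0 d0.
Qed.

(** The real part is the difference of the two preceding integrals. The imaginary part has an odd
    integrand, so reflection shows that it equals its own opposite. *)
Lemma cintegral_expabs_expi t :
  cintegral (fun w => (expabs w)%:C * expi (t * w)) =
  (2 * e / (e ^+ 2 + t ^+ 2))%:C :> R[i].
Proof.
have ci : cintegrable (fun w => (expabs w)%:C * expi (t * w)).
  by apply: (cintegrable_expi cintegrable_expabs); apply: measurable_funM.
have mf := ci.1.
apply/eqP; rewrite eq_complex; apply/andP; split; apply/eqP => /=.
- have iR := integrable_Re ci.
  have -> : (\int[mu]_x complex.Re ((expabs x)%:C * expi (t * x)) =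
      \int[mu]_x (expabs x * (1 + cos (t * x))) - \int[mu]_x (expabs x))%R.
    rewrite -RintegralB//.
    + by apply: eq_Rintegral => x _; rewrite complexReM /=; ring.
    + rewrite (_ : _ \o _ = fun x => ((EFin \o expabs) x +
        (EFin \o (fun x => complex.Re ((expabs x)%:C * expi (t * x))%R)) x)%E).
        exact: (integrableD measurableT integrable_expabs iR).
      by apply/funext => x; rewrite /= -EFinD; congr EFin; ring.
    + exact: integrable_expabs.
  rewrite /Rintegral integral_expabs integral_expabs_cos /=; ring.
- have iI := integrable_Im ci.
  set f := fun x => complex.Im ((expabs x)%:C * expi (t * x)).
  have fN x : f (- x) = - f x.
    by rewrite /f !complexImM /= /expabs normrN mulrN sinN; ring.
  have := Rintegral_preserving (f := f) lebesgue_preserving_opp mf.2.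
  under eq_Rintegral do rewrite fN -mulN1r.
  by rewrite RintegralZl// mulN1r; lra.
Qed.

End poisson_kernel.

Section poisson.
Context {R : realType}.
Local Notation mu := (@lebesgue_measure R).
Variable c : R.
Hypothesis c0 : c != 0.

(** The normalisation attached to the kernel [expi (c x w)]: [kap c] is the factor in the inversion
    formula, and its square root turns the transform into an L2 contraction. *)
Definition kap : R := `|c| / (2 * pi).

(** This is the classical Poisson kernel [a / (pi (a ^ 2 + t ^ 2))] of width [a = e / |c|], written
    as [kap] times the transform of [expabs e]. *)
Definition poisson (e t : R) : R := kap * (2 * e / (e ^+ 2 + (c * t) ^+ 2)).

Lemma kap_gt0 : 0 < kap.
Proof. by rewrite divr_gt0 ?mulr_gt0 ?pi_gt0// normr_gt0. Qed.

Variable e : R.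
Hypothesis e0 : 0 < e.

Let den0 t : 0 < e ^+ 2 + (c * t) ^+ 2.
Proof. by rewrite ltr_pwDl ?exprn_gt0// sqr_ge0. Qed.

Lemma poisson_ge0 t : 0 <= poisson e t.
Proof.
by rewrite /poisson mulr_ge0 ?(ltW kap_gt0)// divr_ge0 ?mulr_ge0 ?(ltW e0) ?(ltW (den0 _)).
Qed.

Lemma poissonN t : poisson e (- t) = poisson e t.
Proof. by rewrite /poisson mulrN sqrrN. Qed.

Lemma poisson_le t : poisson e t <= kap * (2 / e).
Proof.
rewrite /poisson ler_wpM2l ?(ltW kap_gt0)// ler_pdivrMr//.
have -> : 2 / e * (e ^+ 2 + (c * t) ^+ 2) = 2 * e + 2 / e * (c * t) ^+ 2.
  by field; rewrite gt_eqF.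
by rewrite lerDl mulr_ge0 ?sqr_ge0// divr_ge0// ltW.
Qed.

Lemma continuous_poisson : continuous (poisson e).
Proof.
move=> x; apply: cvgMr; apply: cvgMr; apply: cvgV.
  by rewrite gt_eqF.
apply: cvgD; first exact: cvg_cst.
apply: (@continuous_compf _ (fun x => x ^+ 2)); first exact: exprn_continuous.
exact: continuous_linear.
Qed.

Lemma measurable_poisson : measurable_fun setT (poisson e).
Proof. exact: continuous_measurable_fun continuous_poisson. Qed.

(** The odd primitive of the Poisson kernel; its limits at infinity are [1/2] and [-1/2]. *)
Definition apoisson (t : R) : R := pi^-1 * atan (`|c| / e * t).

Lemma is_derive_apoisson (t : R) : is_derive t 1 apoisson (poisson e t).
Proof.
have h := is_derive_compf (is_derive1_atan _) (is_derive_linear (`|c| / e) t).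
apply: (is_derive_eq (is_derive_scalef pi^-1 h)).
have n0 := gt_eqF (den0 t).
rewrite /poisson /kap !exprMn -[c ^+ 2]real_normK ?num_real// exprVn.
have n1 : e ^+ 2 + `|c| ^+ 2 * t ^+ 2 != 0.
  by rewrite real_normK ?num_real// -exprMn n0.
move: (@pi R) (lt0r_neq0 (pi_gt0 R)) => P P0.
by field; rewrite exprMn n1 P0 gt_eqF.
Qed.

Lemma integral_poisson : (\int[mu]_x (poisson e x)%:E = 1)%E.
Proof.
have Fl : apoisson x @[x --> +oo] --> (2^-1 : R).
  rewrite (_ : 2^-1 = pi^-1 * (pi / 2)); last first.
    by rewrite mulrA mulVf ?mul1r// gt_eqF ?pi_gt0.
  apply: cvgMr; apply: (cvg_comp _ _ _ (@cvgy_atan R)).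
  by apply: gt0_cvgMry => //; rewrite divr_gt0 ?normr_gt0.
rewrite (integral_even poisson_ge0 continuous_poisson poissonN
  (fun x _ => erefl) is_derive_apoisson Fl).
by rewrite /apoisson mulr0 atan0 mulr0 subr0 divff.
Qed.

Lemma integral_poisson_shift y : (\int[mu]_x (poisson e (x - y))%:E = 1)%E.
Proof.
rewrite -[RHS]integral_poisson.
apply: (ge0_integral_preserving (lebesgue_preserving_shift (- y))
  (f := fun x => (poisson e x)%:E)).
- by apply/measurable_EFinP; exact: measurable_poisson.
- by move=> x; rewrite lee_fin poisson_ge0.
Qed.

(** Integrated against the transform of [u], this damped inverse kernel yields the Poisson smoothing
    of [u] at [x], because its own transform is the kernel centred at [x]. *)
Definition poisson_weight (x w : R) : R[i] := (kap * expabs e w)%:C * expi (c * x * w).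

Lemma cintegrable_poisson_weight x : cintegrable (poisson_weight x).
Proof.
rewrite /poisson_weight; apply: cintegrable_expi; last by apply: measurable_funM.
by under eq_fun do rewrite rmorphM; apply: cintegrableZ; exact: cintegrable_expabs.
Qed.

Lemma fourier_poisson_weight x y :
  fourier (- c) (poisson_weight x) y = (poisson e (x - y))%:C.
Proof.
rewrite /fourier /poisson_weight.
transitivity (kap%:C * cintegral (fun w => (expabs e w)%:C * expi (c * (x - y) * w))).
  rewrite -cintegralZ; last first.
    by apply: (cintegrable_expi (cintegrable_expabs e0)); apply: measurable_funM.
  apply: eq_cintegral => w; rewrite rmorphM -!mulrA -expiD; congr (_ * (_ * expi _)).
  ring.
by rewrite cintegral_expabs_expi// -rmorphM.
Qed.

Lemma poisson_smoothing (u : R -> R[i]) x : cintegrable u ->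
  cintegral (fun w => poisson_weight x w * fourier (- c) u w) =
  cintegral (fun y => u y * (poisson e (x - y))%:C).
Proof.
move=> ui; rewrite fourier_mult//; last exact: cintegrable_poisson_weight.
by apply: eq_cintegral => y; rewrite fourier_poisson_weight.
Qed.

End poisson.

(** * The L2 contraction and inversion *)

Section fourier_contraction.
Context {R : realType}.
Local Notation mu := (@lebesgue_measure R).
Variable c : R.
Hypothesis c0 : c != 0.
Variable u : R -> R[i].
Hypothesis ui : cintegrable u.

Let half_sq_integral : (\int[mu]_x (2^-1 * cabs (u x) ^+ 2)%:E =
  2^-1%:E * \int[mu]_x (cabs (u x) ^+ 2)%:E)%E.
Proof.
under eq_integral do rewrite EFinM; rewrite ge0_integralZl//.
- by apply/measurable_EFinP/measurable_funX; apply: measurable_cabs; case: ui.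
- by move=> x _; rewrite lee_fin sqr_ge0.
Qed.

(* Schur's test: [2 a b <= a^2 + b^2], and the kernel integrates to 1 in each
   of its two variables. *)
Lemma poisson_schur e : 0 < e ->
  (\int[mu]_x \int[mu]_y (cabs (u x) * (cabs (u y) * poisson c e (x - y)))%:E <=
   \int[mu]_x (cabs (u x) ^+ 2)%:E)%E.
Proof.
move=> e0.
have P0 t : 0 <= poisson c e t by exact: poisson_ge0.
have mP : measurable_fun setT (fun z : R * R => poisson c e (z.1 - z.2)).
  by apply: (measurableT_comp (measurable_poisson c e0)); apply: measurable_funB.
have mu1 : measurable_fun setT (fun z : R * R => cabs (u z.1)).
  by apply: (measurableT_comp (f := fun x => cabs (u x))) => //; apply: measurable_cabs; case: ui.
have mu2 : measurable_fun setT (fun z : R * R => cabs (u z.2)).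
  by apply: (measurableT_comp (f := fun x => cabs (u x))) => //; apply: measurable_cabs; case: ui.
pose a z := (2^-1 * cabs (u z.1) ^+ 2 * poisson c e (z.1 - z.2))%:E.
pose b z := (2^-1 * cabs (u z.2) ^+ 2 * poisson c e (z.1 - z.2))%:E.
have ma : measurable_fun setT (a : R * R -> \bar R).
  apply/measurable_EFinP/measurable_funM => //.
  by apply: measurable_funM; [exact: measurable_cst|exact: measurable_funX].
have mb : measurable_fun setT (b : R * R -> \bar R).
  apply/measurable_EFinP/measurable_funM => //.
  by apply: measurable_funM; [exact: measurable_cst|exact: measurable_funX].
have a0 z : (0 <= a z)%E by rewrite lee_fin mulr_ge0 ?P0// mulr_ge0 ?invr_ge0 ?exprn_ge0 ?cabs_ge0.
have b0 z : (0 <= b z)%E by rewrite lee_fin mulr_ge0 ?P0// mulr_ge0 ?invr_ge0 ?exprn_ge0 ?cabs_ge0.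
have ma1 x : measurable_fun setT (fun y => a (x, y)).
  by apply: (measurableT_comp ma); exact: measurable_pair1.
have mb1 x : measurable_fun setT (fun y => b (x, y)).
  by apply: (measurableT_comp mb); exact: measurable_pair1.
have Pu (t : R) y : (\int[mu]_x (2^-1 * t ^+ 2 * poisson c e (x - y))%:E =
    (2^-1 * t ^+ 2)%:E)%E.
  under eq_integral do rewrite EFinM.
  rewrite ge0_integralZl ?integral_poisson_shift ?mule1//.
  - apply/measurable_EFinP; apply: (measurableT_comp (measurable_poisson c e0)).
    by apply: measurable_funB => //; exact: measurable_cst.
  - by move=> x _; rewrite lee_fin P0.
  - by rewrite lee_fin mulr_ge0 ?sqr_ge0.
apply: (@le_trans _ _ (\int[mu]_x \int[mu]_y (a (x, y) + b (x, y)))%E).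
  apply: ge0_le_integral => //.
  - move=> x _; apply: integral_ge0 => y _.
    by rewrite lee_fin mulr_ge0 ?cabs_ge0// mulr_ge0 ?cabs_ge0 ?P0.
  - apply: (measurable_integral2 (f := fun z => (cabs (u z.1) * (cabs (u z.2) * poisson c e (z.1 - z.2)))%:E)).
    by apply/measurable_EFinP/measurable_funM => //; exact: measurable_funM.
  - apply: (measurable_integral2 (f := fun z => (a z + b z)%E)).
    exact: emeasurable_funD.
  - move=> x _; apply: ge0_le_integral => //.
    + by move=> y _; rewrite lee_fin mulr_ge0 ?cabs_ge0// mulr_ge0 ?cabs_ge0 ?P0.
    + apply/measurable_EFinP; apply: (measurableT_comp (f := fun z : R * R => cabs (u z.1) * (cabs (u z.2) * poisson c e (z.1 - z.2))) (g := fun y => (x, y))).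
        by apply: measurable_funM => //; exact: measurable_funM.
      exact: measurable_pair1.
    + exact: (emeasurable_funD (ma1 x) (mb1 x)).
    + move=> y _; rewrite -EFinD lee_fin /= -mulrDl mulrA ler_wpM2r ?P0//.
      have := sqr_ge0 (cabs (u x) - cabs (u y)); nra.
have -> : (\int[mu]_x \int[mu]_y (a (x, y) + b (x, y)) =
    \int[mu]_x \int[mu]_y a (x, y) + \int[mu]_x \int[mu]_y b (x, y))%E.
  rewrite -ge0_integralD//; last 4 first.
  - by move=> x _; exact: integral_ge0.
  - exact: measurable_integral2.
  - by move=> x _; exact: integral_ge0.
  - exact: measurable_integral2.
  by apply: eq_integral => x _; rewrite (ge0_integralD mu measurableT _ (ma1 x) _ (mb1 x)).
have -> : (\int[mu]_x \int[mu]_y a (x, y) = \int[mu]_x (2^-1 * cabs (u x) ^+ 2)%:E)%E.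
  apply: eq_integral => x _; rewrite -(Pu (cabs (u x)) x).
  by apply: eq_integral => y _; rewrite /a /= -poissonN opprB.
have -> : (\int[mu]_x \int[mu]_y b (x, y) = \int[mu]_x (2^-1 * cabs (u x) ^+ 2)%:E)%E.
  rewrite (fubini_tonelli (m1 := mu) (m2 := mu) b)//.
  by apply: eq_integral => y _; exact: (Pu (cabs (u y)) y).
rewrite half_sq_integral -ge0_muleDl// -EFinD.
by rewrite (_ : 2^-1 + 2^-1 = 1 :> R) ?mul1e//; lra.
Qed.

(** The damping makes [v], the conjugate transform times its weight, integrable. The multiplication
    formula then turns the left side into a double integral of [u x * conjc (u y)] against the
    Poisson kernel, which [poisson_schur] bounds. *)
Lemma fourier_contraction_weight e : 0 < e ->
  (\int[mu]_w (kap c * expabs e w * cabs (fourier c u w) ^+ 2)%:E <=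
   \int[mu]_x (cabs (u x) ^+ 2)%:E)%E.
Proof.
move=> e0; apply: le_trans (poisson_schur e0).
have P0 t : 0 <= poisson c e t by exact: poisson_ge0.
have mT : cmeasurable (fourier c u) by apply: cmeasurable_fourier; case: ui.
pose N := (\int[mu]_x cabs (u x))%R.
have TN w : cabs (fourier c u w) <= N by exact: fourier_le.
pose v w := conjc (fourier c u w) * (kap c * expabs e w)%:C.
have vi : cintegrable v.
  apply: (cintegrable_mul_bounded (M := N)).
  - exact: cmeasurable_conj.
  - by under eq_fun do rewrite rmorphM; apply: cintegrableZ; exact: cintegrable_expabs.
  - by move=> w; rewrite cabs_conj.
have Tv x : fourier c v x =
    cintegral (fun y => conjc (u y) * (poisson c e (x - y))%:C).
  rewrite -poisson_smoothing//; last exact: cintegrable_conj.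
  apply: eq_cintegral => w; rewrite -fourier_conj// /v /poisson_weight.
  by rewrite [RHS]mulrC mulrA; congr (_ * expi _); ring.
have uPi x : cintegrable (fun y => conjc (u y) * (poisson c e (x - y))%:C).
  under eq_fun do rewrite mulrC.
  apply: (cintegrable_mul_bounded (M := kap c * (2 / e))).
  - apply: cmeasurable_real; apply: (measurableT_comp (measurable_poisson c e0)).
    by apply: measurable_funB => //; exact: measurable_cst.
  - exact: cintegrable_conj.
  - by move=> y; rewrite cabs_real ger0_norm ?P0 ?poisson_le.
have vTi : cintegrable (fun w => v w * fourier c u w).
  under eq_fun do rewrite mulrC.
  exact: (cintegrable_mul_bounded (M := N)).
have uTi : cintegrable (fun x => u x * fourier c v x).
  under eq_fun do rewrite mulrC.
  apply: (cintegrable_mul_bounded (M := \int[mu]_x cabs (v x))) => //.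
  - by apply: cmeasurable_fourier; case: vi.
  - by move=> x; exact: fourier_le.
have vTE w : v w * fourier c u w = (kap c * expabs e w * cabs (fourier c u w) ^+ 2)%:C.
  by rewrite /v mulrAC [conjc _ * _]mulrC mulr_conjc -rmorphM mulrC.
have -> : (\int[mu]_w (kap c * expabs e w * cabs (fourier c u w) ^+ 2)%:E =
    (cabs (cintegral (fun w => v w * fourier c u w)))%:E)%E.
  rewrite (eq_cintegral vTE) cintegral_real cabs_real ger0_norm; last first.
    by apply: Rintegral_ge0 => w _; rewrite mulr_ge0 ?exprn_ge0 ?cabs_ge0// mulr_ge0 ?expabs_ge0 ?(ltW (kap_gt0 c0)).
  rewrite /Rintegral fineK//.
  have := integrable_Re vTi; under eq_fun do rewrite vTE /=.
  exact: integrable_fin_num.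
rewrite fourier_mult//.
apply: (le_trans (cabs_cintegral uTi)).
apply: ge0_le_integral => //.
- by move=> x _; rewrite lee_fin cabs_ge0.
- by apply/measurable_EFinP/measurable_cabs; case: uTi.
- apply: (measurable_integral2 (f := fun z => (cabs (u z.1) * (cabs (u z.2) * poisson c e (z.1 - z.2)))%:E)).
  have mu0 : measurable_fun setT (fun x => cabs (u x)) by apply: measurable_cabs; case: ui.
  apply/measurable_EFinP/measurable_funM; first exact: (measurableT_comp mu0).
  apply: measurable_funM; first exact: (measurableT_comp mu0).
  by apply: (measurableT_comp (measurable_poisson c e0)); apply: measurable_funB.
- move=> x _; rewrite cabsM EFinM.
  have mW : measurable_fun setT (fun y => (cabs (conjc (u y) * (poisson c e (x - y))%:C))%:E).
    by apply/measurable_EFinP/measurable_cabs; case: (uPi x).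
  apply: (@le_trans _ _ ((cabs (u x))%:E *
      \int[mu]_y (cabs (conjc (u y) * (poisson c e (x - y))%:C))%:E)%E).
    by rewrite lee_wpmul2l ?lee_fin ?cabs_ge0// Tv; exact: cabs_cintegral.
  rewrite -ge0_integralZl//; last 2 first.
  - by move=> y _; rewrite lee_fin cabs_ge0.
  - by rewrite lee_fin cabs_ge0.
  apply: ge0_le_integral => //.
  - by move=> y _; rewrite mule_ge0 ?lee_fin ?cabs_ge0.
  - exact: emeasurable_funM.
  - under eq_fun do rewrite EFinM; apply: emeasurable_funM => //.
    move: mW; congr measurable_fun; apply/funext => y.
    by rewrite cabsM cabs_conj cabs_real ger0_norm ?P0.
  - move=> y _; rewrite -EFinM lee_fin cabsM cabs_conj cabs_real.
    by rewrite ger0_norm ?P0.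
Qed.

(** Along [e = 1 / (n + 1)] the damping factor increases to 1, so monotone convergence removes
    it. *)
Lemma fourier_contraction :
  (\int[mu]_w (kap c * cabs (fourier c u w) ^+ 2)%:E <=
   \int[mu]_x (cabs (u x) ^+ 2)%:E)%E.
Proof.
have mT : measurable_fun setT (fun w => cabs (fourier c u w) ^+ 2).
  by apply: measurable_funX; apply: measurable_cabs; apply: cmeasurable_fourier; case: ui.
pose en n : R := n.+1%:R^-1.
have en0 n : 0 < en n by rewrite invr_gt0.
pose g n w := (kap c * expabs (en n) w * cabs (fourier c u w) ^+ 2)%:E.
have mg n : measurable_fun setT (g n).
  apply/measurable_EFinP/measurable_funM => //; apply: measurable_funM.
    exact: measurable_cst.
  exact: measurable_expabs.
have g0 n w : setT w -> (0 <= g n w)%E.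
  by move=> _; rewrite lee_fin mulr_ge0 ?exprn_ge0 ?cabs_ge0// mulr_ge0 ?expabs_ge0 ?(ltW (kap_gt0 c0)).
have nd w : setT w -> {homo g^~ w : n m / (n <= m)%N >-> (n <= m)%E}.
  move=> _ n m nm; rewrite lee_fin ler_wpM2r ?sqr_ge0// ler_wpM2l ?(ltW (kap_gt0 c0))//.
  rewrite /expabs ler_expR ler_wpM2r// lerN2 /en lef_pV2 ?posrE//.
  by rewrite ler_nat ltnS.
have lim w : g n w @[n --> \oo] --> (kap c * cabs (fourier c u w) ^+ 2)%:E.
  apply/fine_cvgP; split; first exact: nearW.
  have h1 : - en n * `|w| @[n --> \oo] --> (0 : R).
    rewrite -[X in _ --> X](mul0r `|w|); apply: cvgMl; rewrite -[X in _ --> X]oppr0.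
    by apply: cvgN; exact: cvg_harmonic.
  have h2 : expabs (en n) w @[n --> \oo] --> (1 : R).
    by rewrite -[X in _ --> X]expR0; apply: (cvg_comp _ _ h1); exact: continuous_expR.
  have h3 : kap c * expabs (en n) w @[n --> \oo] --> kap c.
    by rewrite -[X in _ --> X]mulr1; exact: cvgMr h2.
  exact: cvgMl h3.
have := @cvg_monotone_convergence _ _ R mu setT measurableT g mg g0 nd.
under eq_integral => w _ do rewrite (cvg_lim _ (lim w))//.
move=> h; rewrite -(cvg_lim _ h)//; apply: lime_le.
  by apply/cvg_ex; eexists; exact: h.
by apply: nearW => n; exact: fourier_contraction_weight.
Qed.

End fourier_contraction.

(** * Functions whose integrals over all intervals vanish *)

Section ae_zero.
Context {R : realType}.
Local Notation mu := (@lebesgue_measure R).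

Definition itvc (a b x : R) : R := \1_(`[a, b]%classic) x.

Lemma itvcE a b x : itvc a b x = (a <= x <= b)%R%:R.
Proof. by rewrite /itvc indicE mem_setE in_itv. Qed.

Lemma itvc_ge0 a b x : 0 <= itvc a b x.
Proof. by rewrite itvcE. Qed.

Lemma itvc_le1 a b x : itvc a b x <= 1.
Proof. by rewrite itvcE lern1; case: (_ <= _ <= _). Qed.

Lemma measurable_itvc a b : measurable_fun setT (itvc a b).
Proof. exact: measurable_indic. Qed.

Lemma cabs_itvc a b x : cabs (itvc a b x)%:C = itvc a b x.
Proof. by rewrite cabs_real ger0_norm ?itvc_ge0. Qed.

Lemma cintegrable_itvc a b : cintegrable (fun x => (itvc a b x)%:C).
Proof.
apply: (@cintegrable_le _ _ (itvc a b)).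
- exact: cmeasurable_real (measurable_itvc a b).
- exact: integrable_indic_itv.
- by move=> x; rewrite cabs_itvc.
Qed.

(** By Lebesgue differentiation [d] is almost everywhere the derivative of its primitive, which is
    constantly 0. *)
Lemma ae_eq0_of_integrals (d : R -> R) : mu.-integrable setT (EFin \o d) ->
  (forall x, \int[mu]_(t in `]-oo, x]) d t = 0)%R -> {ae mu, forall x, d x = 0}.
Proof.
move=> id d0.
have i1 y : mu.-integrable `]-oo, y] (EFin \o d).
  by apply: integrableS id.
have i2 : locally_integrable [set: R] d.
  by rewrite -[d](patch_setT (fun=> 0)); exact: integrable_locally.
have := FTC1Ny i1 i2; apply: filterS => x /= [_ <-].
rewrite (_ : (fun _ => _) = cst 0); first exact: derive1_cst.
by apply/funext => y; rewrite d0.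
Qed.

(** Only local integrability is assumed, so [d] is first restricted to [[-m, m]]; the countably many
    exceptional null sets are then combined. *)
Lemma cae_eq0 (d : R -> R[i]) :
  (forall a b, cintegrable (fun x => (itvc a b x)%:C * d x)) ->
  (forall a b, cintegral (fun x => (itvc a b x)%:C * d x) = 0) ->
  {ae mu, forall x, d x = 0}.
Proof.
move=> di d0.
(* The window cut at [x] is again an interval, so the hypothesis on intervals yields the vanishing
   primitives. *)
have itvI (m : nat) (x y : R) : itvc (- m%:R) m%:R y * (y \in `]-oo, x]%classic)%:R =
    itvc (- m%:R) (Num.min x m%:R) y.
  rewrite !itvcE mem_setE in_itv /= le_min -natrM mulnb.
  by rewrite -andbA [(y <= m%:R) && _]andbC.
have key (m : nat) : {ae mu, forall x, (itvc (- m%:R) m%:R x)%:C * d x = 0}.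
  have part (p : R[i] -> R) :
      p 0 = 0 ->
      (forall (r : R) z, p (r%:C * z) = r * p z) ->
      (forall f, cintegrable f -> mu.-integrable setT (EFin \o (p \o f))) ->
      (forall f, p (cintegral f) = \int[mu]_x p (f x))%R ->
      {ae mu, forall x, p ((itvc (- m%:R) m%:R x)%:C * d x) = 0}.
    move=> p0 pM pi pint; apply: ae_eq0_of_integrals; first exact: pi.
    move=> x; rewrite Rintegral_mkcond.
    transitivity (p (cintegral (fun y => (itvc (- m%:R) (Num.min x m%:R) y)%:C * d y))).
      rewrite pint; apply: eq_Rintegral => y _; rewrite !pM patchE -itvI.
      by case: ifPn => /= _; rewrite ?pM ?mulr1// mulr0 mul0r.
    by rewrite d0 p0.
  have pr : {ae mu, forall x, complex.Re ((itvc (- m%:R) m%:R x)%:C * d x) = 0}.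
    apply: (part (@complex.Re R)) => //.
    + by move=> r z; rewrite complexReM /= mul0r subr0.
    + by move=> f fi; exact: integrable_Re.
  have pj : {ae mu, forall x, complex.Im ((itvc (- m%:R) m%:R x)%:C * d x) = 0}.
    apply: (part (@complex.Im R)) => //.
    + by move=> r z; rewrite complexImM /= mul0r addr0.
    + by move=> f fi; exact: integrable_Im.
  move: pr pj; apply: filterS2 => x r i; apply/eqP; rewrite eq_complex.
  by apply/andP; split; apply/eqP; rewrite ?r ?i.
have := ae_foralln key; apply: filterS => x /= xd.
pose m := (Num.truncn `|x|).+1.
have := xd m; rewrite itvcE (_ : _ && _ = true) ?mul1r//.
by rewrite -ler_norml ltW// truncnS_gt.
Qed.

End ae_zero.

(** * Square-integrable functions *)

Section square_integrable.
Context {R : realType}.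
Local Notation mu := (@lebesgue_measure R).
Implicit Types f g : R -> R[i].

Definition sqnorm f : \bar R := (\int[mu]_x (cabs (f x) ^+ 2)%:E)%E.

Definition sq_integrable f := cmeasurable f /\ (sqnorm f < +oo)%E.

Lemma sqnorm_ge0 f : (0 <= sqnorm f)%E.
Proof. by apply: integral_ge0 => x _; rewrite lee_fin sqr_ge0. Qed.

Lemma measurable_sq f : cmeasurable f -> measurable_fun setT (fun x => cabs (f x) ^+ 2).
Proof. by move=> mf; apply: measurable_funX; exact: measurable_cabs. Qed.

Lemma sq_integrableP f : sq_integrable f ->
  mu.-integrable setT (EFin \o (fun x => cabs (f x) ^+ 2)).
Proof.
move=> [mf fi]; apply/integrableP; split.
  by apply/measurable_EFinP; exact: measurable_sq.
by under eq_integral do rewrite /= ger0_norm ?sqr_ge0//.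
Qed.

Lemma cintegrable_mul_sq f g : sq_integrable f -> sq_integrable g ->
  cintegrable (fun x => f x * g x).
Proof.
move=> fi gi; apply: (@cintegrable_le _ _ (fun x => cabs (f x) ^+ 2 + cabs (g x) ^+ 2)).
- by apply: cmeasurableM; [case: fi|case: gi].
- exact: (integrableD measurableT (sq_integrableP fi) (sq_integrableP gi)).
- move=> x; rewrite cabsM.
  by have := sqr_ge0 (cabs (f x) - cabs (g x)); have := sqr_ge0 (cabs (f x)); have := sqr_ge0 (cabs (g x)); nra.
Qed.

(* AM-GM with a free parameter, in place of the Cauchy-Schwarz inequality. *)
Lemma cabs_cintegral_mul_le f g (t : R) : 0 < t -> sq_integrable f -> sq_integrable g ->
  ((cabs (cintegral (fun x => (f x * g x)%R)))%:E <=
   (t / 2)%:E * sqnorm f + (t^-1 / 2)%:E * sqnorm g)%E.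
Proof.
move=> t0 fi gi.
have [[mf _] [mg _]] := (fi, gi).
apply: (le_trans (cabs_cintegral (cintegrable_mul_sq fi gi))).
have mf2 : measurable_fun setT (fun x => (cabs (f x) ^+ 2)%:E).
  by apply/measurable_EFinP; exact: measurable_sq.
have mg2 : measurable_fun setT (fun x => (cabs (g x) ^+ 2)%:E).
  by apply/measurable_EFinP; exact: measurable_sq.
rewrite /sqnorm -!ge0_integralZl//; last 4 first.
- by move=> x _; rewrite lee_fin sqr_ge0.
- by rewrite lee_fin divr_ge0// invr_ge0 ltW.
- by move=> x _; rewrite lee_fin sqr_ge0.
- by rewrite lee_fin divr_ge0// ltW.
rewrite -ge0_integralD//; last 4 first.
- by move=> x _; rewrite mule_ge0 ?lee_fin ?sqr_ge0// divr_ge0// ltW.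
- by apply: emeasurable_funM.
- by move=> x _; rewrite mule_ge0 ?lee_fin ?sqr_ge0// divr_ge0// invr_ge0 ltW.
- by apply: emeasurable_funM.
apply: ge0_le_integral => //.
- by move=> x _; rewrite lee_fin cabs_ge0.
- by apply/measurable_EFinP/measurable_cabs; exact: cmeasurableM.
- by apply: emeasurable_funD; exact: emeasurable_funM.
- move=> x _; rewrite -!EFinM -EFinD lee_fin cabsM.
  rewrite -(ler_pM2l t0) (_ : t * (_ * _ + _) =
      ((t * cabs (f x)) ^+ 2 + cabs (g x) ^+ 2) / 2); last by field; rewrite gt_eqF.
  by have := sqr_ge0 (t * cabs (f x) - cabs (g x)); nra.
Qed.

Lemma sq_integrableB f g : sq_integrable f -> sq_integrable g ->
  sq_integrable (fun x => f x - g x).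
Proof.
move=> fi gi; have mB : cmeasurable (fun x => f x - g x).
  by apply: cmeasurableB; [case: fi|case: gi].
split => //.
have : mu.-integrable setT (fun x => (2 * cabs (f x) ^+ 2)%:E + (2 * cabs (g x) ^+ 2)%:E)%E.
  by apply: integrableD => //;
    [have := integrableZl measurableT 2 (sq_integrableP fi)
    |have := integrableZl measurableT 2 (sq_integrableP gi)]; apply: eq_integrable.
move=> /integrableP[mfg]; apply: le_lt_trans; apply: ge0_le_integral => //.
- by move=> x _; rewrite lee_fin sqr_ge0.
- by apply/measurable_EFinP; exact: measurable_sq.
- exact: measurableT_comp.
- move=> x _; rewrite -EFinD /= lee_fin ger0_norm; last first.
    by rewrite addr_ge0// mulr_ge0// sqr_ge0.
  have h : cabs (f x - g x) <= cabs (f x) + cabs (g x).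
    by rewrite (le_trans (cabsD _ _))// cabsN.
  have : cabs (f x - g x) ^+ 2 <= (cabs (f x) + cabs (g x)) ^+ 2.
    by rewrite ler_pXn2r// nnegrE ?addr_ge0 ?cabs_ge0.
  move=> /le_trans; apply.
  by have := sqr_ge0 (cabs (f x) - cabs (g x)); nra.
Qed.

Lemma ccvg_mul_sq (u : nat -> R -> R[i]) f g :
  (forall n, sq_integrable (u n)) -> sq_integrable f -> sq_integrable g ->
  sqnorm (fun x => u n x - f x) @[n --> \oo] --> 0%E ->
  ccvg (fun n => cintegral (fun x => u n x * g x)) (cintegral (fun x => f x * g x)).
Proof.
move=> ui fi gi uf; apply/cvgrPdist_le => e e0.
have gfin : sqnorm g \is a fin_num by rewrite ge0_fin_numE ?sqnorm_ge0//; case: gi.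
pose S := fine (sqnorm g); have S0 : 0 <= S by rewrite fine_ge0 ?sqnorm_ge0.
(* The [+ 1] keeps [t] positive when [S = 0]. In the AM-GM bound the term in [g] is then at most
   [e / 4], and so is the other one once [sqnorm (u n - f) <= e / (2 t)]. *)
pose t := 2 * (S + 1) / e.
have S1 : 0 < S + 1 by rewrite ltr_wpDl.
have t0 : 0 < t by apply: divr_gt0 => //; apply: mulr_gt0.
have := (fine_cvgP _ _).1 uf; case=> ufin /cvgrPdist_le/(_ (e / (2 * t))).
have et0 : 0 < e / (2 * t) by apply: divr_gt0 => //; apply: mulr_gt0.
move=> /(_ et0); move: ufin; apply: filterS2 => n ufin.
rewrite !sub0r !normrN (ger0_norm (cabs_ge0 _)) => un.
have di := sq_integrableB (ui n) fi.
rewrite -(cintegralB (cintegrable_mul_sq (ui n) gi) (cintegrable_mul_sq fi gi)).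
under eq_cintegral do rewrite -mulrBl.
rewrite -lee_fin (le_trans (cabs_cintegral_mul_le t0 di gi))//.
rewrite -(fineK ufin) -(fineK gfin) -!EFinM -EFinD lee_fin -/S.
have h1 : t * fine (sqnorm (fun x => u n x - f x)) <= e / 2.
  rewrite (le_trans (ler_wpM2l (ltW t0) (le_trans (ler_norm _) un)))//.
  by rewrite le_eqVlt; apply/orP; left; apply/eqP; field; rewrite gt_eqF.
have h2 : t^-1 * S <= e / 2.
  rewrite mulrC ler_pdivrMr// /t (_ : e / 2 * _ = S + 1); first by rewrite lerDl.
  by field; rewrite gt_eqF.
lra.
Qed.

(** The optimal parameter in the AM-GM bound is [sqrt (G / F)]. Positive upper bounds stand in for
    the norms, which spares the case of a zero norm. *)
Lemma cauchy_schwarz f g (F G : R) : 0 < F -> 0 < G ->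
  sq_integrable f -> sq_integrable g -> (sqnorm f <= F%:E)%E -> (sqnorm g <= G%:E)%E ->
  cabs (cintegral (fun x => f x * g x)) <= Num.sqrt (F * G).
Proof.
move=> F0 G0 fi gi fF gG; pose t := Num.sqrt (G / F).
have t0 : 0 < t by rewrite sqrtr_gt0 divr_gt0.
rewrite -lee_fin (le_trans (cabs_cintegral_mul_le t0 fi gi))//.
apply: (@le_trans _ _ ((t / 2)%:E * F%:E + (t^-1 / 2)%:E * G%:E)%E).
  by apply: leeD; rewrite lee_wpmul2l// lee_fin divr_ge0// ?invr_ge0 ltW.
rewrite -!EFinM -EFinD lee_fin.
have t2 : t ^+ 2 = G / F by rewrite sqr_sqrtr// divr_ge0// ltW.
have -> : Num.sqrt (F * G) = t * F.
  rewrite -[RHS]ger0_norm -?sqrtr_sqr; last by rewrite mulr_ge0// ltW.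
  by congr Num.sqrt; rewrite exprMn t2; field; rewrite gt_eqF.
have -> : G = t ^+ 2 * F by rewrite t2 divfK// gt_eqF.
rewrite le_eqVlt; apply/orP; left; apply/eqP; field.
by rewrite gt_eqF.
Qed.

End square_integrable.

(** * Poisson smoothing of the indicator of an interval *)

Section poisson_interval.
Context {R : realType}.
Local Notation mu := (@lebesgue_measure R).
Variable c : R.
Hypothesis c0 : c != 0.

Let en (n : nat) : R := n.+1%:R^-1.

Let en0 n : 0 < en n. Proof. by rewrite invr_gt0. Qed.

Let en1 n : en n <= 1. Proof. by rewrite invf_le1// ler1n. Qed.

Let P0 n t : 0 <= poisson c (en n) t. Proof. exact: poisson_ge0. Qed.

Definition poisson_itv (n : nat) (a b x : R) : R :=
  (\int[mu]_y (itvc a b y * poisson c (en n) (x - y)))%R.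

Let mPx n (x : R) : measurable_fun setT (fun y : R => poisson c (en n) (x - y)).
Proof.
apply: (measurableT_comp (measurable_poisson c (en0 n))).
by apply: measurable_funB => //; exact: measurable_cst.
Qed.

Let mIP n (a b x : R) : measurable_fun setT (fun y : R => itvc a b y * poisson c (en n) (x - y)).
Proof. by apply: measurable_funM => //; exact: measurable_itvc. Qed.

Lemma poisson_itvE n a b x : a < b -> poisson_itv n a b x =
  apoisson c (en n) (x - a) - apoisson c (en n) (x - b).
Proof.
move=> ab; rewrite /poisson_itv.
transitivity (\int[mu]_(y in `[a, b]) poisson c (en n) (y - x))%R.
  rewrite [RHS]Rintegral_mkcond; apply: eq_Rintegral => y _.
  rewrite patchE itvcE mem_setE in_itv /= -poissonN opprB.
  by case: ifP; rewrite ?mul1r ?mul0r.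
pose F y := apoisson c (en n) (y - x).
have dF (y : R) : is_derive y 1 F (poisson c (en n) (y - x)).
  have h : is_derive y 1 (fun w : R => w + - x) (1 + 0).
    exact: (is_derive_addf (is_derive_id y 1) (is_derive_cst (- x) y 1)).
  have := @is_derive_compf _ (apoisson c (en n)) (fun w => w + - x) y _ _
    (is_derive_apoisson c (en0 n) (y - x)) h.
  by rewrite addr0 mulr1.
have cF (y : R) : {for y, continuous F}.
  by apply/differentiable_continuous/derivable1_diffP; apply: ex_derive.
rewrite /Rintegral (@continuous_FTC2 _ _ F)//.
- by rewrite /F /= /apoisson -[x - a]opprB -[x - b]opprB !mulrN !atanN; ring.
- apply: continuous_subspaceT => y.
  apply: (@continuous_compf _ (poisson c (en n)) (fun y => y - x)).
    exact: continuous_poisson.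
  by move=> z; apply: cvgB; [exact: cvg_id|exact: cvg_cst].
- split; first by move=> y _; exact: ex_derive.
  + by apply: cvg_at_right_filter; exact: cF.
  + by apply: cvg_at_left_filter; exact: cF.
- by move=> y _; rewrite derive1E; exact: derive_val.
Qed.

(** Taken at [x - a] and [x - b], these limits show that the smoothed indicator of [[a, b]] tends to
    the indicator off the endpoints, and to [1/2] at them. *)
Lemma cvg_apoisson t : apoisson c (en n) t @[n --> \oo] --> (Num.sg t / 2 : R).
Proof.
have pos s : 0 < s -> apoisson c (en n) s @[n --> \oo] --> (2^-1 : R).
  move=> s0; rewrite (_ : 2^-1 = pi^-1 * (pi / 2)); last first.
    by rewrite mulrA mulVf ?mul1r// gt_eqF ?pi_gt0.
  apply: cvgMr.
  have h : (n.+1%:R : R) @[n --> \oo] --> (+oo : set_system R).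
    have /cvgryPge h := @cvgr_idn R; apply/cvgryPge => A; have := h A.
    by apply: filterS => n /le_trans; apply; rewrite ler_nat.
  have cs : 0 < `|c| * s by rewrite mulr_gt0// normr_gt0.
  have h' : `|c| / en n * s @[n --> \oo] --> (+oo : set_system R).
    rewrite (_ : (fun n => _) = fun n => (`|c| * s) * n.+1%:R); last first.
      by apply/funext => n; rewrite /en invrK mulrAC.
    by apply: (cvg_comp _ _ h); apply: gt0_cvgMry => //; exact: cvg_id.
  exact: (cvg_comp _ _ h' (@cvgy_atan R)).
have [t0|t0|->] := ltrgtP t 0.
- rewrite ltr0_sg// mulN1r (_ : (fun n => _) = fun n => - apoisson c (en n) (- t)).
    by apply: cvgN; apply: pos; rewrite oppr_gt0.
  by apply/funext => n; rewrite /apoisson mulrN atanN mulrN opprK.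
- by rewrite gtr0_sg// mul1r; exact: pos.
- rewrite sgr0 mul0r (_ : (fun n => _) = cst 0); first exact: cvg_cst.
  by apply/funext => n; rewrite /apoisson mulr0 atan0 mulr0.
Qed.

Lemma poisson_itv_ge0 n a b x : 0 <= poisson_itv n a b x.
Proof. by apply: Rintegral_ge0 => y _; rewrite mulr_ge0 ?itvc_ge0. Qed.

Let iP n (x : R) : mu.-integrable setT (EFin \o (fun y : R => poisson c (en n) (x - y))).
Proof.
apply/integrableP; split; first by apply/measurable_EFinP; exact: mPx.
under eq_integral do rewrite /= ger0_norm// -poissonN opprB.
by rewrite integral_poisson_shift// ltry.
Qed.

Let iIP n (a b x : R) :
  mu.-integrable setT (EFin \o (fun y : R => itvc a b y * poisson c (en n) (x - y))).
Proof.
apply: le_integrable (iP n x) => //; first by apply/measurable_EFinP; exact: mIP.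
move=> y _; rewrite /= lee_fin normrM (ger0_norm (itvc_ge0 _ _ _)).
by rewrite ler_piMl ?itvc_le1.
Qed.

Lemma poisson_itv_le1 n a b x : poisson_itv n a b x <= 1.
Proof.
have -> : 1 = (\int[mu]_y poisson c (en n) (x - y))%R :> R.
  rewrite /Rintegral; under eq_integral do rewrite -poissonN opprB.
  by rewrite integral_poisson_shift.
apply: le_Rintegral => // y _.
by rewrite ler_piMl ?itvc_le1.
Qed.

(* The bound is uniform in [n], so that it dominates the limit [n --> oo]. *)
Lemma poisson_itv_le n (m : nat) a b x : - m%:R <= a -> a < b -> b <= m%:R ->
  poisson_itv n a b x <=
  ((b - a) * (8 * kap c / c ^+ 2) + (1 + (2 * m%:R + 1) ^+ 2)) / (1 + x ^+ 2).
Proof.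
move=> ma ab bm; set K1 := (b - a) * _; set K2 := 1 + _.
have x0 : 0 < 1 + x ^+ 2 by rewrite ltr_pwDl// sqr_ge0.
have c2 : 0 < c ^+ 2 by rewrite exprn_even_gt0.
have K10 : 0 <= K1.
  rewrite /K1 mulr_ge0 ?subr_ge0 ?(ltW ab)// divr_ge0 ?(ltW c2)//.
  by rewrite mulr_ge0// ltW// kap_gt0.
have K20 : 0 <= K2 by rewrite addr_ge0// sqr_ge0.
rewrite ler_pdivlMr//.
(* Near the interval the bound by 1 suffices and produces [K2]. Beyond [2 m + 1], every [y] in the
   interval satisfies [|x - y| >= (|x| + 1) / 2], so the kernel decays like [1 / (1 + x ^ 2)], which
   produces [K1]. *)
have [xm|xm] := leP `|x| (2 * m%:R + 1).
  apply: (@le_trans _ _ (1 * (1 + x ^+ 2))).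
    by rewrite ler_wpM2r ?(ltW x0)// poisson_itv_le1.
  rewrite mul1r; apply: (@le_trans _ _ K2); last by rewrite lerDr.
  by rewrite lerD2l -[x ^+ 2]real_normK ?num_real// ler_pXn2r// nnegrE addr_ge0//.
apply: (@le_trans _ _ K1); last by rewrite lerDl.
have far y : a <= y <= b -> poisson c (en n) (x - y) * (1 + x ^+ 2) <= 8 * kap c / c ^+ 2.
  move=> /andP[ay yb].
  have ym : `|y| <= m%:R by rewrite ler_norml (le_trans ma ay) (le_trans yb bm).
  have d1 : (`|x| + 1) / 2 <= `|x - y|.
    have := ler_normD (x - y) y; rewrite subrK => h; lra.
  have d2 : 1 + x ^+ 2 <= 4 * (x - y) ^+ 2.
    rewrite -[x ^+ 2]real_normK ?num_real// -[(x - y) ^+ 2]real_normK ?num_real//.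
    have := normr_ge0 x; nra.
  rewrite /poisson -[leLHS]mulrA [8 * _]mulrC -[leRHS]mulrA.
  rewrite ler_wpM2l ?(ltW (kap_gt0 c0))//.
  have den : 0 < en n ^+ 2 + (c * (x - y)) ^+ 2.
    by rewrite ltr_pwDl ?exprn_gt0// sqr_ge0.
  rewrite mulrAC ler_pdivrMr// [8 / _ * _]mulrAC ler_pdivlMr//.
  have h1 : 2 * en n * (1 + x ^+ 2) * c ^+ 2 <= 2 * (1 + x ^+ 2) * c ^+ 2.
    rewrite ler_wpM2r ?(ltW c2)// ler_wpM2r ?(ltW x0)//.
    by rewrite ler_piMr.
  have h2 : (1 + x ^+ 2) * c ^+ 2 <= 4 * (x - y) ^+ 2 * c ^+ 2.
    by rewrite ler_wpM2r ?(ltW c2).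
  have := sqr_ge0 (en n); rewrite exprMn; nra.
rewrite mulrC -RintegralZl//.
have -> : K1 = (\int[mu]_y (8 * kap c / c ^+ 2 * itvc a b y))%R.
  rewrite RintegralZl//; last exact: (integrable_indic_itv a b true false).
  rewrite /K1 mulrC; congr (_ * _).
  rewrite /Rintegral /itvc integral_indic//= setIT.
  by rewrite lebesgue_measure_itv /= lte_fin ab.
apply: le_Rintegral => //.
- exact: (integrableZl measurableT (1 + x ^+ 2) (iIP n a b x)).
- exact: (integrableZl measurableT (8 * kap c / c ^+ 2) (integrable_indic_itv a b true false)).
- move=> y _; rewrite itvcE; case: (boolP (a <= y <= b)) => [yab|_]; last by rewrite mul0r !mulr0.
  by rewrite mul1r mulr1 mulrC; exact: far.
Qed.

End poisson_interval.

(** * Inversion for L2 limits of Fourier transforms *)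

Section L2_inversion.
Context {R : realType}.
Local Notation mu := (@lebesgue_measure R).

Lemma ae_neq (a : R) : {ae mu, forall x, x != a}.
Proof.
exists [set a]; split => //; first exact: lebesgue_measure_set1.
by move=> x /= /negP; rewrite negbK => /eqP.
Qed.

Lemma sq_integrable_bounded (f : R -> R[i]) (M : R) : cintegrable f ->
  (forall x, cabs (f x) <= M) -> sq_integrable f.
Proof.
move=> fi fM; split; first by case: fi.
have := integrable_cabs fi => /(integrableZl measurableT M) /integrableP[mMf].
apply: le_lt_trans; apply: ge0_le_integral => //.
- by move=> x _; rewrite lee_fin sqr_ge0.
- by apply/measurable_EFinP; apply: measurable_sq; case: fi.
- exact: measurableT_comp.
- move=> x _; rewrite /= lee_fin (le_trans _ (ler_norm _))// expr2.
  by rewrite ler_wpM2r ?cabs_ge0.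
Qed.

(** The function is [pi] times the Poisson kernel with [c = e = 1], whose integral is known. *)
Lemma cintegrable_oneDsqrV : cintegrable (fun x => ((1 + x ^+ 2)^-1)%:C : R[i]).
Proof.
pose q (x : R) : R := (1 + x ^+ 2)^-1.
have q0 (x : R) : 0 < 1 + x ^+ 2 by rewrite ltr_pwDl// sqr_ge0.
have mq : measurable_fun setT q.
  apply: continuous_measurable_fun => x; apply: cvgV; first by rewrite gt_eqF.
  by apply: cvgD; [exact: cvg_cst|exact: exprn_continuous].
rewrite -/q.
split; first exact: cmeasurable_real.
have one0 : (1 : R) != 0 by [].
have := @integral_poisson R 1 one0 1 ltr01.
have -> : (\int[mu]_x (poisson 1 1 x)%:E =
    \int[mu]_x ((pi^-1)%:E * (cabs (q x)%:C)%:E))%E.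
  apply: eq_integral => x _; rewrite cabs_real -EFinM; congr EFin.
  rewrite ger0_norm ?invr_ge0 ?(ltW (q0 _))// /q /poisson /kap normr1 expr1n !mul1r mulr1.
  move: (@pi R) (lt0r_neq0 (pi_gt0 R)) => P P0.
  by field; rewrite P0 gt_eqF.
rewrite ge0_integralZl//; last 3 first.
- by apply/measurable_EFinP/measurable_cabs; exact: cmeasurable_real.
- by move=> x _; rewrite lee_fin cabs_ge0.
- by rewrite lee_fin invr_ge0 pi_ge0.
move=> hq; rewrite ltey; apply/eqP => hy; move: hq; rewrite hy gt0_muley//.
by rewrite lte_fin invr_gt0 pi_gt0.
Qed.

Variable c : R.
Hypothesis c0 : c != 0.
Variables (f h : R -> R[i]) (u : nat -> R -> R[i]).
Hypotheses (f2 : sq_integrable f) (h1 : cintegrable h) (h2 : sq_integrable h).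
Hypotheses (u1 : forall n, cintegrable (u n)) (u2 : forall n, sq_integrable (u n)).
Hypothesis uf : sqnorm (fun x => u n x - f x) @[n --> \oo] --> 0%E.
Hypothesis uh :
  sqnorm (fun w => fourier (- c) (u n) w - h w) @[n --> \oo] --> 0%E.

Let sq_fourier n : sq_integrable (fourier (- c) (u n)).
Proof.
have nc0 : - c != 0 by rewrite oppr_eq0.
have mT : cmeasurable (fourier (- c) (u n)).
  by apply: cmeasurable_fourier; case: (u1 n).
split => //; have := fourier_contraction nc0 (u1 n).
under eq_integral do rewrite EFinM; rewrite ge0_integralZl//; last 3 first.
- by apply/measurable_EFinP; exact: measurable_sq.
- by move=> x _; rewrite lee_fin sqr_ge0.
- by rewrite lee_fin ltW ?kap_gt0.
move=> /le_lt_trans/(_ (u2 n).2); rewrite -/(sqnorm (fourier (- c) (u n))).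
rewrite !ltey; apply: contraNN => /eqP ->.
by rewrite gt0_muley// lte_fin kap_gt0.
Qed.

Let cintegrable_poissonC e y : 0 < e ->
  cintegrable (fun x => (poisson c e (y - x))%:C).
Proof.
move=> e0; have mP : measurable_fun setT (fun x : R => poisson c e (y - x)).
  apply: (measurableT_comp (measurable_poisson c e0)).
  by apply: measurable_funB => //; exact: measurable_cst.
split; first exact: cmeasurable_real.
under eq_integral do rewrite cabs_real ger0_norm ?poisson_ge0// -poissonN opprB.
by rewrite integral_poisson_shift// ltry.
Qed.

Let cabs_weight e y w : 0 < e -> cabs (poisson_weight c e y w) <= kap c.
Proof.
move=> e0; have k0 := ltW (kap_gt0 c0).
rewrite /poisson_weight cabsM cabs_expi mulr1 cabs_real.
rewrite (ger0_norm (mulr_ge0 k0 (expabs_ge0 _ _))).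
rewrite ler_piMr// /expabs -expR0 ler_expR.
by rewrite mulNr oppr_le0 mulr_ge0// ltW.
Qed.

(** For each [u n] this is [poisson_smoothing]. The kernel and the weight are both
    square-integrable, so both sides pass to the L2 limit. *)
Lemma poisson_smoothing_L2 e y : 0 < e ->
  cintegral (fun x => f x * (poisson c e (y - x))%:C) =
  cintegral (fun w => h w * poisson_weight c e y w).
Proof.
move=> e0.
have P2 : sq_integrable (fun x => (poisson c e (y - x))%:C).
  apply: (sq_integrable_bounded (M := kap c * (2 / e)) (cintegrable_poissonC _ e0)).
  by move=> x; rewrite cabs_real ger0_norm ?poisson_ge0 ?poisson_le.
have W2 : sq_integrable (poisson_weight c e y).
  apply: (sq_integrable_bounded (M := kap c) (cintegrable_poisson_weight _ e0 _)).
  by move=> w; exact: cabs_weight.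
have l1 := ccvg_mul_sq u2 f2 P2 uf.
have l2 := ccvg_mul_sq sq_fourier h2 W2 uh.
apply: (ccvg_unique l1).
rewrite (_ : (fun n => _) =
  fun n => cintegral (fun x => fourier (- c) (u n) x * poisson_weight c e y x))//.
apply/funext => n; rewrite -(poisson_smoothing c e0 y (u1 n)).
by apply: eq_cintegral => w; rewrite mulrC.
Qed.

Let en (n : nat) : R := n.+1%:R^-1.
Let en0 n : 0 < en n. Proof. by rewrite invr_gt0. Qed.

Let q (x : R) : R := (1 + x ^+ 2)^-1.
Let q0 (x : R) : 0 < 1 + x ^+ 2. Proof. by rewrite ltr_pwDl// sqr_ge0. Qed.

Let qK (x t : R) : q x * ((1 + x ^+ 2) * t) = t.
Proof. exact: mulKf (lt0r_neq0 (q0 x)) t. Qed.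

Let mq : measurable_fun setT q.
Proof.
apply: continuous_measurable_fun => x; apply: cvgV; first by rewrite gt_eqF.
by apply: cvgD; [exact: cvg_cst|exact: exprn_continuous].
Qed.

Let q_integrable : cintegrable (fun x => (q x)%:C).
Proof. exact: cintegrable_oneDsqrV. Qed.

Let q_sq : sq_integrable (fun x => (q x)%:C).
Proof.
apply: (sq_integrable_bounded (M := 1) q_integrable) => x.
rewrite cabs_real ger0_norm ?invr_ge0 ?(ltW (q0 _))// invf_le1//.
by rewrite lerDl sqr_ge0.
Qed.

(** Fubini needs an integrable factor and [f] is only square-integrable. Hence [f] is split as [f q]
    times [1 + x ^ 2]: the first is integrable, and the second times the Poisson kernel is bounded
    for [y] in the interval. *)
Let fubini_itv n a b : a < b ->
  cintegral (fun y => (itvc a b y)%:C * cintegral (fun x => f x * (poisson c (en n) (y - x))%:C)) =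
  cintegral (fun x => f x * (poisson_itv c n a b x)%:C).
Proof.
move=> ab; pose m := Num.max `|a| `|b|.
have m0 : 0 <= m by rewrite le_max normr_ge0.
pose K (x y : R) : R[i] := ((1 + x ^+ 2) * (poisson c (en n) (x - y) * itvc a b y))%:C.
(* From [1 + x ^ 2 <= (1 + 2 m ^ 2) + 2 (x - y) ^ 2] for [|y| <= m]: the first summand multiplies
   the maximum of the kernel, the second a bound for [(x - y) ^ 2] times the kernel. *)
pose M := (1 + 2 * m ^+ 2) * (kap c * (2 / en n)) + 2 * (kap c * (2 * en n / c ^+ 2)).
have c2 : 0 < c ^+ 2 by rewrite exprn_even_gt0.
have P0 t : 0 <= poisson c (en n) t by exact: poisson_ge0.
have KM x y : cabs (K x y) <= M.
  rewrite /K cabs_real ger0_norm; last first.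
    by rewrite mulr_ge0 ?(ltW (q0 _))// mulr_ge0 ?itvc_ge0.
  have M1 : 0 <= (1 + 2 * m ^+ 2) * (kap c * (2 / en n)).
    apply: mulr_ge0; first by rewrite addr_ge0// mulr_ge0// sqr_ge0.
    by apply: mulr_ge0; [exact/ltW/kap_gt0|rewrite divr_ge0// ltW].
  have M2 : 0 <= 2 * (kap c * (2 * en n / c ^+ 2)).
    apply: mulr_ge0 => //; apply: mulr_ge0; first exact/ltW/kap_gt0.
    by rewrite divr_ge0 ?(ltW c2)// mulr_ge0// ltW.
  rewrite itvcE; case: (boolP (a <= y <= b)) => [/andP[ay yb]|_]; last first.
    by rewrite !mulr0 addr_ge0.
  rewrite mulr1.
  have ym : `|y| <= m.
    rewrite ler_norml; apply/andP; split.
      by rewrite (le_trans _ ay)// lerNl (le_trans (ler_norm _))// normrN le_max lexx.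
    by rewrite (le_trans yb)// (le_trans (ler_norm _))// le_max lexx orbT.
  have y2 : y ^+ 2 <= m ^+ 2.
    by rewrite -[y ^+ 2]real_normK ?num_real// ler_pXn2r// nnegrE.
  have far : (x - y) ^+ 2 * poisson c (en n) (x - y) <= kap c * (2 * en n / c ^+ 2).
    rewrite /poisson mulrCA ler_wpM2l ?(ltW (kap_gt0 c0))//.
    have den : 0 < en n ^+ 2 + (c * (x - y)) ^+ 2.
      by rewrite ltr_pwDl ?exprn_gt0// sqr_ge0.
    rewrite mulrA ler_pdivrMr// [leRHS]mulrAC ler_pdivlMr//.
    have : 0 <= 2 * en n * en n ^+ 2.
      by rewrite mulr_ge0 ?sqr_ge0// mulr_ge0// ltW.
    by rewrite exprMn; nra.
  have near' := poisson_le c0 (en0 n) (x - y).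
  apply: (@le_trans _ _ ((1 + 2 * m ^+ 2) * poisson c (en n) (x - y) +
      2 * ((x - y) ^+ 2 * poisson c (en n) (x - y)))).
    rewrite mulrA -mulrDl ler_wpM2r//.
    by have := sqr_ge0 (x - 2 * y); nra.
  rewrite lerD//; first by rewrite ler_wpM2l// addr_ge0// mulr_ge0// sqr_ge0.
  by rewrite ler_wpM2l.
have mK : cmeasurable (fun z : R * R => K z.1 z.2).
  apply: cmeasurable_real; apply: measurable_funM.
    apply: measurable_funD; first exact: measurable_cst.
    exact: measurable_funX.
  apply: measurable_funM.
    by apply: (measurableT_comp (measurable_poisson c (en0 n))); exact: measurable_funB.
  exact: (measurableT_comp (measurable_itvc a b)).
have := cfubini_kernel (cintegrable_mul_sq f2 q_sq) (cintegrable_itvc a b) mK KM.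
move=> E; transitivity (cintegral (fun y => (itvc a b y)%:C *
    cintegral (fun x => f x * (q x)%:C * K x y))).
  apply: eq_cintegral => y; rewrite itvcE.
  have [yab|_] := boolP (a <= y <= b); last by rewrite !mul0r.
  congr (_ * _); apply: eq_cintegral => x; rewrite /K itvcE yab mulr1 -mulrA.
  congr (_ * _); rewrite -rmorphM qK.
  by rewrite -poissonN opprB.
rewrite -E; apply: eq_cintegral => x; rewrite -mulrA; congr (_ * _).
rewrite /poisson_itv -cintegral_real -cintegralZ; last first.
  under eq_fun do rewrite mulrC.
  exact: (cintegrable_mul_bounded (cmeasurable_slice1 x mK) (cintegrable_itvc a b) (KM x)).
apply: eq_cintegral => y; rewrite /K -!rmorphM; congr (_ %:C).
rewrite -/en itvcE; case: (a <= y <= b); last by rewrite !(mul0r, mulr0).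
by rewrite !mul1r mulr1 qK.
Qed.

Let F0 y := (kap c)%:C * fourier c h y.

Let N := (\int[mu]_x cabs (h x))%R.

Let Gn n y := cintegral (fun w => h w * poisson_weight c (en n) y w).

Let cintegrable_hw n y : cintegrable (fun w => h w * poisson_weight c (en n) y w).
Proof.
under eq_fun do rewrite mulrC.
apply: (cintegrable_mul_bounded (M := kap c) _ h1).
  by case: (cintegrable_poisson_weight c (en0 n) y).
by move=> w; exact: cabs_weight.
Qed.

(** The damping tends to 1 under the dominating function [kap c * |h|]; the integrability of [h]
    enters here. *)
Let GnF y : ccvg (Gn ^~ y) (F0 y).
Proof.
rewrite /F0 /fourier -cintegralZ; last exact: cintegrable_fourier_arg.
apply: (dominated_ccvg (G := fun w => kap c * cabs (h w))).
- by move=> n; case: (cintegrable_hw n y).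
- by case: (cintegrableZ (kap c)%:C (cintegrable_fourier_arg c y h1)).
- exact: (integrableZl measurableT (kap c) (integrable_cabs h1)).
- by move=> n w; rewrite cabsM mulrC ler_wpM2r ?cabs_ge0 ?cabs_weight.
move=> w; rewrite mulrCA; apply: ccvgM; first exact: ccvg_cst.
rewrite (_ : c * w * y = c * y * w); last by rewrite mulrAC.
apply: ccvgM; last exact: ccvg_cst.
apply/ccvgP; split => /=; last exact: cvg_cst.
rewrite -[X in _ --> X]mulr1; apply: cvgMr; rewrite -[X in _ --> X]expR0.
have h0 : - en n * `|w| @[n --> \oo] --> (0 : R).
  rewrite -[X in _ --> X](mul0r `|w|); apply: cvgMl; rewrite -[X in _ --> X]oppr0.
  by apply: cvgN; exact: cvg_harmonic.
by apply: (cvg_comp _ _ h0); exact: continuous_expR.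
Qed.

Let Gn_le n y : cabs (Gn n y) <= kap c * N.
Proof.
rewrite (le_trans (cabs_cintegral_Rint (cintegrable_hw n y)))// /N.
rewrite -RintegralZl//; last exact: integrable_cabs.
apply: le_Rintegral => //.
- exact: integrable_cabs.
- exact: (integrableZl measurableT (kap c) (integrable_cabs h1)).
- by move=> w _; rewrite cabsM mulrC ler_wpM2r ?cabs_ge0 ?cabs_weight.
Qed.

Let mGn n : cmeasurable (Gn n).
Proof.
apply: (cmeasurable_cintegral (F := fun y w => h w * poisson_weight c (en n) y w)).
apply: cmeasurableM; first by apply: (cmeasurable_comp measurable_snd); case: h1.
apply: cmeasurableM.
  apply: cmeasurable_real; apply: measurable_funM; first exact: measurable_cst.
  exact: (measurableT_comp (measurable_expabs (en n))).
exact: cmeasurable_expi2.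
Qed.

Let cintegrable_itv_F0 (a b : R) : cintegrable (fun y => (itvc a b y)%:C * F0 y).
Proof.
under eq_fun do rewrite mulrC.
apply: (cintegrable_mul_bounded (M := kap c * N)).
- by apply: cmeasurableZ; apply: cmeasurable_fourier; case: h1.
- exact: cintegrable_itvc.
- move=> y; rewrite cabsM cabs_real gtr0_norm ?kap_gt0// ler_wpM2l ?(ltW (kap_gt0 c0))//.
  exact: fourier_le.
Qed.

Let itvc_sq (a b : R) : sq_integrable (fun x => (itvc a b x)%:C).
Proof.
apply: (sq_integrable_bounded (M := 1) (cintegrable_itvc a b)) => x.
by rewrite cabs_itvc itvc_le1.
Qed.

Let cintegrable_itv_f (a b : R) : cintegrable (fun y => (itvc a b y)%:C * f y).
Proof. exact: (cintegrable_mul_sq (itvc_sq a b) f2). Qed.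

(** Both sides are limits of one sequence: [fubini_itv] and [poisson_smoothing_L2] identify the
    integral of [Gn n] over the interval with the integral of [f] against the smoothed indicator. *)
Let itv_eq a b : a < b ->
  cintegral (fun y => (itvc a b y)%:C * f y) = cintegral (fun y => (itvc a b y)%:C * F0 y).
Proof.
(* [k] is the pointwise limit of the smoothed indicator; it differs from [itvc a b] only at [a] and
   [b], a null set. *)
move=> ab; pose k x : R := Num.sg (x - a) / 2 - Num.sg (x - b) / 2.
have lim1 : ccvg (fun n => cintegral (fun y => (itvc a b y)%:C * Gn n y))
    (cintegral (fun y => (itvc a b y)%:C * F0 y)).
  apply: (dominated_ccvg (G := fun y => kap c * N * itvc a b y)).
  - move=> n; apply: cmeasurableM; last exact: mGn.
    exact: cmeasurable_real (measurable_itvc a b).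
  - by case: (cintegrable_itv_F0 a b).
  - exact: (integrableZl measurableT (kap c * N) (integrable_indic_itv a b true false)).
  - by move=> n y; rewrite cabsM cabs_itvc mulrC ler_wpM2r ?itvc_ge0 ?Gn_le.
  - by move=> y; apply: ccvgM; [exact: ccvg_cst|exact: GnF].
have mk : measurable_fun setT k.
  have ms (a' : R) : measurable_fun setT (fun x : R => Num.sg (x - a') / 2).
    apply: measurable_funM; last exact: measurable_cst.
    rewrite (_ : (fun _ => _) = fun x => (a' < x)%R%:R - (x < a')%R%:R); last first.
      apply/funext => x; case: (ltrgtP x a') => [xa|xa|->].
      + by rewrite ltr0_sg ?subr_lt0// sub0r.
      + by rewrite gtr0_sg ?subr_gt0// subr0.
      + by rewrite subrr sgr0 subrr.
    apply: measurable_funB.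
    + rewrite (_ : (fun _ => _) = (\1_(`]a', +oo[%classic) : R -> R)).
        exact: measurable_indic.
      by apply/funext => x; rewrite indicE mem_setE in_itv /= andbT.
    + rewrite (_ : (fun _ => _) = (\1_(`]-oo, a'[%classic) : R -> R)).
        exact: measurable_indic.
      by apply/funext => x; rewrite indicE mem_setE in_itv.
  by apply: measurable_funB; exact: ms.
pose m := (Num.truncn (Num.max `|a| `|b|)).+1.
have abm : `|a| <= m%:R /\ `|b| <= m%:R.
  have := ltW (truncnS_gt (Num.max `|a| `|b|)); rewrite ge_max => /andP[].
  by split.
have ma : - m%:R <= a by case: abm => am _; rewrite lerNl (le_trans (ler_norm _))// normrN.
have bm : b <= m%:R by case: abm => _ bm; rewrite (le_trans (ler_norm _)).
set D := (b - a) * (8 * kap c / c ^+ 2) + (1 + (2 * m%:R + 1) ^+ 2).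
(* Since [f] itself need not be integrable, the domination relies on the decay [D / (1 + x ^ 2)] of
   the smoothed indicators, uniform in [n]. *)
have lim2 : ccvg (fun n => cintegral (fun x => f x * (poisson_itv c n a b x)%:C))
    (cintegral (fun x => f x * (k x)%:C)).
  apply: (dominated_ccvg (G := fun x => D * cabs (f x * (q x)%:C))).
  - move=> n; apply: cmeasurableM; first by case: f2.
    apply: cmeasurable_real.
    rewrite (_ : poisson_itv c n a b = fun x => apoisson c (en n) (x - a) - apoisson c (en n) (x - b)); last first.
      by apply/funext => x; rewrite poisson_itvE.
    have ma' (a' : R) : measurable_fun setT (fun x : R => apoisson c (en n) (x - a')).
      apply: (@measurableT_comp _ _ _ _ _ _ (apoisson c (en n))).
        apply: continuous_measurable_fun => x.
        have dx := is_derive_apoisson c (en0 n) x.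
        by apply/differentiable_continuous/derivable1_diffP; apply: ex_derive.
      by apply: measurable_funB => //; exact: measurable_cst.
    by apply: measurable_funB; exact: ma'.
  - by apply: cmeasurableM; [case: f2|exact: cmeasurable_real].
  - exact: (integrableZl measurableT D (integrable_cabs (cintegrable_mul_sq f2 q_sq))).
  - move=> n x; rewrite !cabsM mulrCA ler_wpM2l ?cabs_ge0// !cabs_real.
    rewrite ger0_norm ?poisson_itv_ge0// ger0_norm ?invr_ge0 ?(ltW (q0 _))//.
    exact: poisson_itv_le.
  - move=> x; apply: ccvgM; first exact: ccvg_cst.
    apply/ccvgP; split => /=; last exact: cvg_cst.
    under eq_cvg do rewrite poisson_itvE//.
    by apply: cvgB; exact: cvg_apoisson.
transitivity (cintegral (fun x => f x * (k x)%:C)).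
  apply: ae_eq_cintegral.
  - by case: (cintegrable_itv_f a b).
  - by apply: cmeasurableM; [case: f2|exact: cmeasurable_real].
  - have := ae_neq a; have := ae_neq b; apply: filterS2 => x xb xa.
    rewrite mulrC; congr (_ * _%:C); rewrite itvcE /k.
    have [ax|ax|ax] := ltrgtP x a; last by rewrite ax eqxx in xa.
    + rewrite !ltr0_sg ?subr_lt0// ?(lt_trans ax ab)//=; lra.
    + rewrite gtr0_sg ?subr_gt0//=.
      have [bx|bx|bx] := ltrgtP x b; last by rewrite bx eqxx in xb.
      * by rewrite ltr0_sg ?subr_lt0//=; lra.
      * by rewrite gtr0_sg ?subr_gt0//=; lra.
apply: (ccvg_unique lim2).
rewrite (_ : (fun n => _) = fun n => cintegral (fun y => (itvc a b y)%:C * Gn n y))//.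
apply/funext => n; rewrite -(fubini_itv n ab); apply: eq_cintegral => y.
by rewrite poisson_smoothing_L2.
Qed.

(* The inversion formula holds tested against intervals: smooth [f] by the
   Poisson kernel, integrate over the interval and let the parameter tend to 0. *)
Theorem fourier_L2_inversion : {ae mu, forall x, f x = (kap c)%:C * fourier c h x}.
Proof.
suff : {ae mu, forall x, f x - F0 x = 0}.
  by apply: filterS => x /eqP; rewrite subr_eq0 => /eqP.
have E a b : (fun x => (itvc a b x)%:C * (f x - F0 x)) =
    fun x => (itvc a b x)%:C * f x - (itvc a b x)%:C * F0 x.
  by apply/funext => x; rewrite mulrBr.
apply: cae_eq0 => a b; rewrite E; first exact: cintegrableB.
rewrite cintegralB//; have [ab|ba] := ltP a b; first by rewrite itv_eq// subrr.
(* For [b <= a] the indicator vanishes except possibly at the point [a]. *)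
have z (g : R -> R[i]) : cmeasurable (fun x => (itvc a b x)%:C * g x) ->
    cintegral (fun x => (itvc a b x)%:C * g x) = 0.
  move=> mg; rewrite -[RHS]cintegral0; apply: ae_eq_cintegral => //.
  have := ae_neq a; apply: filterS => x xa; rewrite itvcE.
  rewrite (_ : _ && _ = false) ?mul0r//; apply/negbTE.
  rewrite negb_and -!ltNge; move: xa; rewrite neq_lt => /orP[->//|ax].
  by rewrite (le_lt_trans ba ax) orbT.
by rewrite !z ?subrr//; [case: (cintegrable_itv_F0 a b)|case: (cintegrable_itv_f a b)].
Qed.

End L2_inversion.

(** * The Hausdorff-Young inequality *)

Section layers.
Context {R : realType}.

Definition layer (s : R) (i : nat) (t : R) : R := ((s ^+ i <= t) && (t < s ^+ i.+1))%:R.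

Lemma layer0 s i : 0 < s -> layer s i 0 = 0.
Proof. by move=> s0; rewrite /layer lt_geF// exprn_gt0. Qed.

Lemma layer_exists (s t : R) (N : nat) : 1 < s -> 1 <= t < s ^+ N ->
  exists2 i : 'I_N, s ^+ i <= t < s ^+ i.+1 & forall j : 'I_N, layer s j t = (j == i)%:R.
Proof.
move=> s1 /andP[t1 tN].
have [i iN it] : exists2 i, (i < N)%N & s ^+ i <= t < s ^+ i.+1.
  elim: N tN => [|N ih tN]; first by rewrite expr0 ltNge t1.
  have [/ih[i iN it]|Nt] := ltP t (s ^+ N); first by exists i => //; exact: ltnW.
  by exists N => //; rewrite Nt.
exists (Ordinal iN) => // j; rewrite /layer.
have [ji|ij|/val_inj ->] := ltngtP j (Ordinal iN); last by rewrite eqxx /= it.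
- rewrite (_ : (j == _) = false) ?ltn_eqF//; last by apply/negbTE; rewrite -val_eqE /= ltn_eqF.
  have h : s ^+ j.+1 <= t.
    by case/andP: it => /(le_trans _) it _; apply: it; rewrite ler_eXn2l.
  by rewrite [t < _]ltNge h andbF.
- rewrite (_ : (j == _) = false); last by apply/negbTE; rewrite -val_eqE /= gtn_eqF.
  have h : t < s ^+ j.
    by case/andP: it => _ /lt_le_trans; apply; rewrite ler_eXn2l.
  by rewrite leNgt h.
Qed.

Lemma measurable_layer s i : measurable_fun setT (layer s i).
Proof.
rewrite (_ : layer s i = (\1_(`[s ^+ i, s ^+ i.+1[%classic) : R -> R)).
  exact: measurable_indic.
by apply/funext => t; rewrite indicE mem_setE in_itv.
Qed.

Lemma layer_ge0 s i t : 0 <= layer s i t.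
Proof. by rewrite /layer. Qed.

Lemma layer_le1 s i t : layer s i t <= 1.
Proof. by rewrite /layer; case: (_ && _). Qed.

End layers.

(** * Functions with an integrable power of the modulus *)

Section rpower.
Context {R : realType}.
Local Notation mu := (@lebesgue_measure R).
Variable r : R.
Hypothesis r1 : 1 <= r.
Implicit Types a b : R -> R[i].

Definition rintegrable a :=
  cmeasurable a /\ (\int[mu]_x (cabs (a x) `^ r)%:E < +oo)%E.

(** This is the [r]-th power of the usual norm; the root is taken only in the final estimates. *)
Definition rnorm a : R := (\int[mu]_x (cabs (a x) `^ r))%R.

Lemma measurable_rpow a : cmeasurable a -> measurable_fun setT (fun x => cabs (a x) `^ r).
Proof.
by move=> ma; apply: (measurableT_comp (measurable_powR r)); exact: measurable_cabs.
Qed.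

Lemma rintegrableP a : rintegrable a ->
  mu.-integrable setT (EFin \o (fun x => cabs (a x) `^ r)).
Proof.
move=> [ma ai]; apply/integrableP; split.
  by apply/measurable_EFinP; exact: measurable_rpow.
by under eq_integral do rewrite /= ger0_norm ?powR_ge0//.
Qed.

Lemma rnormE a : rintegrable a -> ((rnorm a)%:E = \int[mu]_x (cabs (a x) `^ r)%:E)%E.
Proof.
by move=> ai; rewrite /rnorm /Rintegral fineK//; exact: integrable_fin_num (rintegrableP ai).
Qed.

Lemma rnorm_ge0 a : 0 <= rnorm a.
Proof. by apply: Rintegral_ge0 => x _; exact: powR_ge0. Qed.

Lemma le_rnorm a b : rintegrable a -> rintegrable b ->
  (forall x, cabs (a x) <= cabs (b x)) -> rnorm a <= rnorm b.
Proof.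
move=> ai bi ab; apply: le_Rintegral => //; try exact: rintegrableP.
by move=> x _; rewrite ge0_ler_powR ?nnegrE ?cabs_ge0// (le_trans ler01).
Qed.

Lemma rintegrable_le a b : cmeasurable a -> rintegrable b ->
  (forall x, cabs (a x) <= cabs (b x)) -> rintegrable a.
Proof.
move=> ma [mb bi] ab; split; first exact: ma.
apply: le_lt_trans bi; apply: ge0_le_integral; first exact: measurableT.
- by move=> x _; rewrite lee_fin powR_ge0.
- by apply/measurable_EFinP; exact: measurable_rpow.
- by apply/measurable_EFinP; exact: measurable_rpow.
- by move=> x _; rewrite lee_fin ge0_ler_powR ?nnegrE ?cabs_ge0// (le_trans ler01).
Qed.

(** The dichotomy is the one produced by truncating and rescaling; under it, integrability of the
    [r]-th power yields plain integrability. *)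
Lemma le_rpow (t : R) : t = 0 \/ 1 <= t -> t <= t `^ r.
Proof.
move=> [->|t1]; first exact: powR_ge0.
by rewrite -[leLHS]powRr1 ?(le_trans ler01)// ler_powR.
Qed.

Lemma rintegrable_cintegrable a : rintegrable a ->
  (forall x, cabs (a x) = 0 \/ 1 <= cabs (a x)) -> cintegrable a.
Proof.
move=> ai a1; have [ma _] := ai.
by apply: (cintegrable_le ma (rintegrableP ai)) => x; exact: le_rpow.
Qed.

End rpower.

(** * Complex interpolation with finitely many layers *)

Section hausdorff_young_layered.
Context {R : realType}.
Local Notation mu := (@lebesgue_measure R).
Variable c : R.
Hypothesis c0 : c != 0.
Variable r : R.
Hypotheses (r1 : 1 <= r) (r2 : r <= 2).
Variables (s : R) (N : nat).
Hypothesis s1 : 1 < s.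

Let s0 : 0 < s. Proof. exact: lt_trans ltr01 s1. Qed.
Let r0 : 0 < r. Proof. exact: lt_le_trans ltr01 r1. Qed.

Section one.
Variable a : R -> R[i].
Hypothesis ai : rintegrable r a.
Hypothesis aN : forall x, cabs (a x) = 0 \/ 1 <= cabs (a x) < s ^+ N.

Let a1 x : cabs (a x) = 0 \/ 1 <= cabs (a x).
Proof. by have [->|/andP[]] := aN x; [left|right]. Qed.

Let aL1 : cintegrable a. Proof. exact: rintegrable_cintegrable ai a1. Qed.

Definition piece (i : nat) x : R[i] := (layer s i (cabs (a x)))%:C * a x.

Lemma cintegrable_piece i : cintegrable (piece i).
Proof.
apply: (cintegrable_mul_bounded (M := 1)) => //.
- apply: cmeasurable_real; apply: (measurableT_comp (measurable_layer s i)).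
  by apply: measurable_cabs; case: aL1.
- by move=> x; rewrite cabs_real ger0_norm ?layer_ge0 ?layer_le1.
Qed.

(* Complex interpolation deforms [a] by a power of its modulus; here the modulus
   is first rounded to a power of [s], so that the deformation is polynomial. *)
Definition deform (z : R[i]) x : R[i] := \sum_(i < N) z ^+ i * piece i x.

Lemma cintegrable_deform z : cintegrable (deform z).
Proof. by apply: cintegrable_sum => i; apply: cintegrableZ; exact: cintegrable_piece. Qed.

Lemma deformE z x : cabs (a x) = 0 /\ cabs (deform z x) = 0 \/
  exists i : nat, [/\ s ^+ i <= cabs (a x), cabs (a x) < s ^+ i.+1 & deform z x = z ^+ i * a x].
Proof.
have [a0|ax] := aN x.
  left; split => //; rewrite /deform big1 ?ComplexField.Normc.normc0// => i _.
  by rewrite /piece a0 layer0// mul0r mulr0.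
have [i /andP[i1 i2] iE] := layer_exists s1 ax.
right; exists i; split => //; rewrite /deform (bigD1 i)//= /piece iE eqxx mul1r.
by rewrite big1 ?addr0// => j ji; rewrite iE (negbTE ji) mul0r mulr0.
Qed.

Lemma deform1 x : deform 1 x = a x.
Proof.
have [[a0 d0]|[i [_ _ ->]]] := deformE 1 x; last by rewrite expr1n mul1r.
by rewrite (ComplexField.Normc.eq0_normc a0) (ComplexField.Normc.eq0_normc d0).
Qed.

(** On layer [i] the factor has modulus [(s ^ i)] to the power [r - 1 >= 0], and [s ^ i] is the
    lower edge of the layer. *)
Lemma cabs_deform_L1 z x : cabs z = s `^ (r - 1) ->
  cabs (deform z x) <= cabs (a x) `^ r.
Proof.
move=> zs; have [[a0 ->]|[i [i1 i2 ->]]] := deformE z x; first exact: powR_ge0.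
have apos : 0 < cabs (a x) by rewrite (lt_le_trans _ i1)// exprn_gt0.
have -> : cabs (a x) `^ r = cabs (a x) `^ (r - 1) * cabs (a x).
  by rewrite -[X in _ * X]powRr1 ?cabs_ge0// -powRD ?subrK// gt_eqF ?implybT.
rewrite cabsM cabsX zs ler_wpM2r ?cabs_ge0//.
rewrite -powR_mulrn ?powR_ge0// -powRrM mulrC powRrM powR_mulrn ?(ltW s0)//.
by rewrite ge0_ler_powR ?subr_ge0 ?nnegrE ?exprn_ge0 ?cabs_ge0 ?(ltW s0).
Qed.

(** After squaring, the exponent [r - 2] is nonpositive, so rounding the modulus down enlarges the
    factor. As [s ^ i >= |a x| / s], the loss is at most [s] to the power [2 - r]. *)
Lemma cabs_deform_L2 z x : cabs z = s `^ (r / 2 - 1) ->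
  cabs (deform z x) ^+ 2 <= s `^ (2 - r) * cabs (a x) `^ r.
Proof.
move=> zs; have [[a0 ->]|[i [i1 i2 ->]]] := deformE z x.
  by rewrite expr0n /= mulr_ge0 ?powR_ge0.
have apos : 0 < cabs (a x) by rewrite (lt_le_trans _ i1)// exprn_gt0.
rewrite cabsM cabsX zs exprMn.
have -> : cabs (a x) `^ r = cabs (a x) `^ (r - 2) * cabs (a x) ^+ 2.
  by rewrite -powR_mulrn ?cabs_ge0// -powRD ?subrK// gt_eqF ?implybT.
rewrite mulrA ler_wpM2r ?sqr_ge0//.
have -> : ((s `^ (r / 2 - 1)) ^+ i) ^+ 2 = (s ^+ i) `^ (r - 2).
  rewrite -exprM -powR_mulrn ?powR_ge0// -powRrM -[(s ^+ i)]powR_mulrn ?(ltW s0)//.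
  by rewrite -powRrM; congr (_ `^ _); rewrite natrM; field.
have sa : cabs (a x) / s <= s ^+ i by rewrite ler_pdivrMr// -exprSr ltW.
have as0 : 0 < cabs (a x) / s by rewrite divr_gt0.
have -> : s `^ (2 - r) * cabs (a x) `^ (r - 2) = (cabs (a x) / s) `^ (r - 2).
  rewrite powRM ?cabs_ge0 ?invr_ge0 ?(ltW s0)// mulrC; congr (_ * _).
  by rewrite -powR_inv1 ?(ltW s0)// -powRrM; congr (_ `^ _); ring.
have p (t : R) : 0 < t -> t `^ (r - 2) = (t `^ (2 - r))^-1.
  by move=> t0; rewrite -powRN opprB.
rewrite !p ?exprn_gt0// lef_pV2 ?posrE ?powR_gt0 ?exprn_gt0//.
by rewrite ge0_ler_powR ?subr_ge0 ?nnegrE ?exprn_ge0 ?(ltW s0) ?(ltW as0).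
Qed.

(** A crude bound that serves only to make [deform z] square-integrable. *)
Lemma cabs_deform_bounded z x : cabs (deform z x) <= \sum_(i < N) cabs z ^+ i * s ^+ N.
Proof.
rewrite (le_trans (cabs_sum _ _ _))//; apply: ler_sum => i _.
rewrite cabsM cabsX ler_wpM2l ?exprn_ge0 ?cabs_ge0//.
rewrite /piece cabsM cabs_real ger0_norm ?layer_ge0//.
rewrite (le_trans (ler_piMl (cabs_ge0 _) (layer_le1 _ _ _)))//.
have [->|/andP[_ /ltW]//] := aN x; by rewrite exprn_ge0// ltW.
Qed.

Lemma sq_integrable_deform z : sq_integrable (deform z).
Proof. exact: sq_integrable_bounded (cintegrable_deform z) (cabs_deform_bounded z). Qed.

Lemma deform_L1 z : cabs z = s `^ (r - 1) ->
  (\int[mu]_x cabs (deform z x) <= rnorm r a)%R.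
Proof.
move=> zs; apply: le_Rintegral => //.
- exact: integrable_cabs (cintegrable_deform z).
- exact: rintegrableP.
- by move=> x _; exact: cabs_deform_L1.
Qed.

Lemma deform_L2 z : cabs z = s `^ (r / 2 - 1) ->
  (sqnorm (deform z) <= (s `^ (2 - r) * rnorm r a)%:E)%E.
Proof.
move=> zs; rewrite EFinM rnormE// -ge0_integralZl//; last 3 first.
- by apply/measurable_EFinP; apply: measurable_rpow; case: ai.
- by move=> x _; rewrite lee_fin powR_ge0.
- by rewrite lee_fin powR_ge0.
apply: ge0_le_integral => //.
- by move=> x _; rewrite lee_fin sqr_ge0.
- by apply/measurable_EFinP; apply: measurable_sq; case: (cintegrable_deform z).
- apply: emeasurable_funM => //.
  by apply/measurable_EFinP; apply: measurable_rpow; case: ai.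
- by move=> x _; rewrite -EFinM lee_fin; exact: cabs_deform_L2.
Qed.

End one.

Variables a b : R -> R[i].
Hypothesis ai : rintegrable r a.
Hypothesis aN : forall x, cabs (a x) = 0 \/ 1 <= cabs (a x) < s ^+ N.
Hypothesis bi : rintegrable r b.
Hypothesis bN : forall x, cabs (b x) = 0 \/ 1 <= cabs (b x) < s ^+ N.

Let A := rnorm r a.
Let B := rnorm r b.

(** The endpoint [r = 1] of the interpolation. *)
Lemma cabs_cintegral_fourier_le (f g : R -> R[i]) : cintegrable f -> cintegrable g ->
  cabs (cintegral (fun x => f x * fourier c g x)) <=
  (\int[mu]_x cabs (f x) * \int[mu]_x cabs (g x))%R.
Proof.
move=> fi gi; set M := (\int[mu]_x cabs (g x))%R.
have mT : cmeasurable (fourier c g) by apply: cmeasurable_fourier; case: gi.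
have fT : cintegrable (fun x => f x * fourier c g x).
  under eq_fun do rewrite mulrC.
  by apply: (cintegrable_mul_bounded (M := M)) => // x; exact: fourier_le.
rewrite (le_trans (cabs_cintegral_Rint fT))// mulrC -RintegralZl//; last exact: integrable_cabs.
apply: le_Rintegral => //.
- exact: integrable_cabs.
- exact: (integrableZl measurableT M (integrable_cabs fi)).
- by move=> x _; rewrite cabsM mulrC ler_wpM2r ?cabs_ge0 ?fourier_le.
Qed.

(** With finitely many layers the bilinear form of the two deformed functions is a polynomial in
    [z], so the three-circle theorem applies to it. *)
Let poly : {poly R[i]} := \sum_(i < N) \sum_(l < N)
  (cintegral (fun x => piece a i x * fourier c (piece b l) x))%:P * 'X^(i + l).

Let polyE z : poly.[z] =
  cintegral (fun x => deform a z x * fourier c (deform b z) x).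
Proof.
have pi := cintegrable_piece ai aN; have pl := cintegrable_piece bi bN.
have pTi i l : cintegrable (fun x => piece a i x * fourier c (piece b l) x).
  under eq_fun do rewrite mulrC.
  apply: (cintegrable_mul_bounded (M := \int[mu]_x cabs (piece b l x))) => //.
  - by apply: cmeasurable_fourier; case: (pl l).
  - by move=> x; exact: fourier_le.
transitivity (cintegral (fun x => \sum_(i < N) \sum_(l < N)
    z ^+ (i + l) * (piece a i x * fourier c (piece b l) x))); last first.
  apply: eq_cintegral => x; rewrite /deform fourier_sum; last first.
    by move=> l; apply: cintegrableZ.
  rewrite mulr_suml; apply: eq_bigr => i _; rewrite mulr_sumr.
  apply: eq_bigr => l _; rewrite fourierZ// exprD; ring.
rewrite cintegral_sum; last first.
  by move=> i; apply: cintegrable_sum => l; exact: cintegrableZ.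
rewrite /poly horner_sum; apply: eq_bigr => i _.
rewrite cintegral_sum; last by move=> l; exact: cintegrableZ.
rewrite horner_sum; apply: eq_bigr => l _.
by rewrite cintegralZ// hornerM hornerC hornerXn mulrC.
Qed.

(** The L1 bounds hold on the circle of radius [s ^ (r - 1) >= 1], and the L2 contraction with
    Cauchy-Schwarz on that of radius [s ^ (r / 2 - 1) <= 1]. The original functions sit at [z = 1],
    in between. The power of [s] is the price of rounding and disappears as [s] tends to 1. *)
Lemma hausdorff_young_layered :
  cabs (cintegral (fun x => a x * fourier c b x)) <=
  kap c `^ (- ((r - 1) / r)) * (s ^+ 4) * (A * B) `^ r^-1.
Proof.
have k0 := kap_gt0 c0.
have L1 : cabs (cintegral (fun x => a x * fourier c b x)) <= A * B.
  have a1 x : cabs (a x) = 0 \/ 1 <= cabs (a x) by have [->|/andP[]] := aN x; [left|right].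
  have b1 x : cabs (b x) = 0 \/ 1 <= cabs (b x) by have [->|/andP[]] := bN x; [left|right].
  have aL1 := rintegrable_cintegrable r1 ai a1.
  have bL1 := rintegrable_cintegrable r1 bi b1.
  rewrite (le_trans (cabs_cintegral_fourier_le aL1 bL1))//.
  apply: ler_pM; try by apply: Rintegral_ge0 => x _; rewrite cabs_ge0.
  - apply: le_Rintegral => //; [exact: integrable_cabs|exact: rintegrableP|].
    by move=> x _; apply: le_rpow.
  - apply: le_Rintegral => //; [exact: integrable_cabs|exact: rintegrableP|].
    by move=> x _; apply: le_rpow.
(* If one function is null, the L1 bound is already enough; otherwise both norms are positive, as
   [cauchy_schwarz] requires. *)
have [AB0|AB0] := eqVneq (A * B) 0.
  by rewrite (le_trans L1)// AB0 mulr_ge0 ?powR_ge0// mulr_ge0 ?powR_ge0// exprn_ge0// ltW.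
have [A0 B0] : 0 < A /\ 0 < B.
  by move: AB0; rewrite mulf_eq0 negb_or => /andP[a0 b0];
    rewrite !lt_def a0 b0; split; exact: rnorm_ge0.
have ABpos : 0 < A * B by exact: (mulr_gt0 A0 B0).
(* [th] solves [(r - 1) (1 - th) + (r / 2 - 1) th = 0], which places the intermediate circle at
   radius 1. *)
set th := 2 * (r - 1) / r.
have th01 : 0 <= th <= 1.
  apply/andP; split; first by rewrite /th divr_ge0 ?(ltW r0)// mulr_ge0// subr_ge0.
  by rewrite /th ler_pdivrMr// mul1r mulrBr mulr1 lerBlDr mulr_natl mulr2n lerD2l.
set S := s `^ (2 - r).
have S0 : 0 < S by rewrite powR_gt0.
set M1 := Num.sqrt (S * A * (S * B / kap c)).
have P0 z : cabs z = s `^ (r - 1) -> cabs poly.[z] <= A * B.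
  move=> zs; rewrite polyE (le_trans (cabs_cintegral_fourier_le _ _))//.
  - exact: cintegrable_deform.
  - exact: cintegrable_deform.
  - apply: ler_pM; try by apply: Rintegral_ge0 => x _; rewrite cabs_ge0.
    + exact: deform_L1.
    + exact: deform_L1.
have P1 z : cabs z = s `^ (r / 2 - 1) -> cabs poly.[z] <= M1.
  move=> zs; rewrite polyE.
  have di := cintegrable_deform bi bN z.
  have mT : cmeasurable (fourier c (deform b z)) by apply: cmeasurable_fourier; case: di.
  have h : (sqnorm (fourier c (deform b z)) <= (S * B / kap c)%:E)%E.
    have := le_trans (fourier_contraction c0 di) (deform_L2 bi bN zs).
    under eq_integral do rewrite EFinM; rewrite ge0_integralZl//; last 3 first.
    - by apply/measurable_EFinP; exact: measurable_sq.
    - by move=> x _; rewrite lee_fin sqr_ge0.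
    - by rewrite lee_fin ltW.
    rewrite -/(sqnorm (fourier c (deform b z))).
    by move=> hh; rewrite [S * B / kap c]mulrC EFinM lee_pdivlMl.
  apply: cauchy_schwarz; [by rewrite mulr_gt0|by rewrite divr_gt0// mulr_gt0| | | |exact: h].
  - exact: sq_integrable_deform.
  - by split => //; rewrite (le_lt_trans h)// ltry.
  - exact: deform_L2.
have := @three_circles R poly (s `^ (r - 1)) (s `^ (r / 2 - 1)) (A * B) M1 th
  (powR_gt0 _ s0) (powR_gt0 _ s0) (ltW ABpos) (sqrtr_ge0 _) th01 P0 P1 1.
have -> : cintegral (fun x => a x * fourier c b x) = poly.[1].
  rewrite polyE; apply: eq_cintegral => x; rewrite deform1//; congr (_ * _).
  by apply: eq_cintegral => y; rewrite deform1.
rewrite ComplexField.Normc.normc1.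
have one : 1 = (s `^ (r - 1)) `^ (1 - th) * (s `^ (r / 2 - 1)) `^ th.
  rewrite -!powRrM -powRD ?(gt_eqF s0) ?implybT//.
  rewrite (_ : _ + _ = 0) ?powRr0// /th; field.
  by rewrite gt_eqF.
move=> /(_ one)/le_trans; apply.
have -> : M1 = S * (kap c `^ (- 2^-1) * (A * B) `^ 2^-1).
  rewrite /M1 (_ : _ * _ = S ^+ 2 * ((kap c)^-1 * (A * B))); last by ring.
  rewrite sqrtrM ?sqr_ge0// sqrtr_sqr (ger0_norm (ltW S0)); congr (_ * _).
  rewrite sqrtrM ?invr_ge0 ?(ltW k0)// -!powR12_sqrt ?invr_ge0 ?(ltW k0) ?(ltW ABpos)//.
  by rewrite -powR_inv1 ?(ltW k0)// -powRrM mulN1r.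
have kh0 : 0 <= kap c `^ (- 2^-1) * (A * B) `^ 2^-1 by rewrite mulr_ge0 ?powR_ge0.
rewrite [(S * _) `^ th]powRM ?(ltW S0)// [(kap c `^ _ * _) `^ th]powRM ?powR_ge0//.
rewrite -(powRrM (kap c)) -(powRrM (A * B)).
rewrite (_ : _ * (_ * (_ * _)) = kap c `^ (- 2^-1 * th) * S `^ th *
  ((A * B) `^ (1 - th) * (A * B) `^ (2^-1 * th))); last by ring.
rewrite -powRD ?(gt_eqF ABpos) ?implybT//.
have -> : - 2^-1 * th = - ((r - 1) / r) by rewrite /th; field; rewrite gt_eqF.
have -> : 1 - th + 2^-1 * th = r^-1 by rewrite /th; field; rewrite gt_eqF.
rewrite ler_wpM2r ?powR_ge0// ler_wpM2l ?powR_ge0//.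
(* The accumulated exponent of [s] is [(2 - r) th], a product of two numbers in [[0, 1]]. *)
rewrite /S -powRrM -powR_mulrn ?(ltW s0)// ler_powR ?(ltW s1)//.
move: th01 => /andP[t0 t1]; apply: (@le_trans _ _ (1 * 1)); last by rewrite mulr1 ler1n.
by apply: ler_pM => //; rewrite ?subr_ge0// lerBlDr (_ : 2 = 1 + 1)// lerD2l.
Qed.

End hausdorff_young_layered.

(** * Scaling and truncation *)

Section rnorm_scale.
Context {R : realType}.
Local Notation mu := (@lebesgue_measure R).
Variable r : R.
Hypothesis r1 : 1 <= r.

Lemma rintegrableZ (z : R[i]) (a : R -> R[i]) : rintegrable r a ->
  rintegrable r (fun x => z * a x).
Proof.
move=> ai; have [ma _] := ai; split; first exact: cmeasurableZ.
under eq_integral do rewrite cabsM powRM ?cabs_ge0// EFinM.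
rewrite ge0_integralZl//; last 3 first.
- by apply/measurable_EFinP; exact: measurable_rpow.
- by move=> x _; rewrite lee_fin powR_ge0.
- by rewrite lee_fin powR_ge0.
rewrite lte_mul_pinfty ?lee_fin ?powR_ge0//; by case: ai.
Qed.

Lemma rnormZ (z : R[i]) (a : R -> R[i]) : rintegrable r a ->
  rnorm r (fun x => z * a x) = cabs z `^ r * rnorm r a.
Proof.
move=> ai; rewrite /rnorm -RintegralZl//; last exact: rintegrableP.
by apply: eq_Rintegral => x _; rewrite cabsM powRM ?cabs_ge0.
Qed.

Lemma rintegrable_cintegrable_ge (d : R) (a : R -> R[i]) : 0 < d -> rintegrable r a ->
  (forall x, cabs (a x) = 0 \/ d <= cabs (a x)) -> cintegrable a.
Proof.
move=> d0 ai ad.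
have dn : cabs (d^-1)%:C = d^-1 by rewrite cabs_real gtr0_norm ?invr_gt0.
have h : cintegrable (fun x => (d^-1)%:C * a x).
  apply: (rintegrable_cintegrable r1 (rintegrableZ _ ai)) => x; rewrite cabsM dn.
  have [->|dx] := ad x; first by left; rewrite mulr0.
  by right; rewrite mulrC ler_pdivlMr// mul1r.
have := cintegrableZ d%:C h; rewrite (_ : (fun x => _) = a)//.
apply/funext => x; rewrite mulrA -rmorphM mulfV ?gt_eqF// /real_complex_def.
by rewrite mul1r.
Qed.

(** The lower cut makes the truncation integrable, the upper cut leaves finitely many layers. *)
Definition trunc (n : nat) (a : R -> R[i]) (x : R) : R[i] :=
  ((n.+1%:R^-1 <= cabs (a x)) && (cabs (a x) <= n.+1%:R))%:R%:C * a x.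

Lemma cabs_trunc_le n a x : cabs (trunc n a x) <= cabs (a x).
Proof.
rewrite /trunc cabsM cabs_real; case: (_ && _); rewrite ?normr1 ?mul1r//.
by rewrite normr0 mul0r cabs_ge0.
Qed.

Lemma cabs_trunc n a x : cabs (trunc n a x) = 0 \/
  n.+1%:R^-1 <= cabs (trunc n a x) <= n.+1%:R.
Proof.
rewrite /trunc; have [h|_] := boolP (_ && _).
  by right; rewrite mul1r.
by left; rewrite mul0r ComplexField.Normc.normc0.
Qed.

Lemma cmeasurable_trunc n a : cmeasurable a -> cmeasurable (trunc n a).
Proof.
move=> ma; apply: cmeasurableM => //; apply: cmeasurable_real.
rewrite (_ : (fun x => _) = \1_(`[n.+1%:R^-1, n.+1%:R]%classic) \o (fun x => cabs (a x))).
  by apply: measurableT_comp; [exact: measurable_indic|exact: measurable_cabs].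
by apply/funext => x /=; rewrite indicE mem_setE in_itv.
Qed.

Lemma rintegrable_trunc n a : rintegrable r a -> rintegrable r (trunc n a).
Proof.
move=> ai; apply: (rintegrable_le r1 _ ai); last exact: cabs_trunc_le.
by apply: cmeasurable_trunc; case: ai.
Qed.

Lemma cintegrable_trunc n a : rintegrable r a -> cintegrable (trunc n a).
Proof.
move=> ai; apply: (rintegrable_cintegrable_ge (d := n.+1%:R^-1)).
- by rewrite invr_gt0.
- exact: rintegrable_trunc.
- by move=> x; have [->|/andP[]] := cabs_trunc n a x; [left|right].
Qed.

Lemma ccvg_trunc a x : ccvg (fun n => trunc n a x) (a x).
Proof.
have [a0|a0] := eqVneq (cabs (a x)) 0.
  rewrite (_ : (fun n => _) = fun=> a x); first exact: ccvg_cst.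
  by apply/funext => n; rewrite /trunc (ComplexField.Normc.eq0_normc a0) mulr0.
have apos : 0 < cabs (a x) by rewrite lt_def a0 cabs_ge0.
apply/cvgrPdist_lt => e e0.
exists (maxn (Num.truncn (cabs (a x))) (Num.truncn (cabs (a x))^-1)) => // n /= nm.
have h1 : cabs (a x) <= n.+1%:R.
  rewrite (le_trans (ltW (truncnS_gt _)))// ler_nat ltnS.
  by rewrite (leq_trans _ nm)// leq_maxl.
have h2 : n.+1%:R^-1 <= cabs (a x).
  rewrite -[leRHS]invrK lef_pV2 ?posrE ?invr_gt0//.
  rewrite (le_trans (ltW (truncnS_gt _)))// ler_nat ltnS.
  by rewrite (leq_trans _ nm)// leq_maxr.
by rewrite /trunc h1 h2 mul1r subrr ComplexField.Normc.normc0 subrr normr0.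
Qed.

End rnorm_scale.

(** * Removing the rounding and the truncation *)

Section hausdorff_young.
Context {R : realType}.
Local Notation mu := (@lebesgue_measure R).
Variable c : R.
Hypothesis c0 : c != 0.
Variable r : R.
Hypotheses (r1 : 1 <= r) (r2 : r <= 2).
Implicit Types a b : R -> R[i].

Let r0 : 0 < r. Proof. exact: lt_le_trans ltr01 r1. Qed.

Lemma le_of_le_mul_expr (x y : R) n : 0 <= y -> (forall s, 1 < s -> x <= y * s ^+ n) -> x <= y.
Proof.
rewrite le_eqVlt => /predU1P[<-|y0] h.
  by have := h 2; rewrite ltr1n mul0r; apply.
rewrite leNgt; apply/negP => yx.
have q1 : 1 < x / y by rewrite ltr_pdivlMr// mul1r.
have q0 : 0 < x / y by exact: lt_trans ltr01 q1.
(* For this [s] the hypothesis reads [s ^ (n + 1) <= s ^ n], impossible because [s > 1]. *)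
pose s := (x / y) `^ (n.+1%:R^-1).
have s0 : 0 < s by exact: powR_gt0.
have sE : s ^+ n.+1 = x / y.
  by rewrite /s -powR_mulrn ?powR_ge0// -powRrM mulVf// powRr1// ltW.
have s1 : 1 < s.
  rewrite ltNge; apply/negP => s1; move: q1; rewrite -sE ltNge.
  by rewrite exprn_ile1// ltW.
have := h s s1; rewrite -ler_pdivrMl// mulrC -sE exprSr.
by rewrite ger_pMr ?exprn_gt0// leNgt s1.
Qed.

Lemma expr_unbounded (s K : R) : 1 < s -> exists N, K < s ^+ N.
Proof.
move=> s1; have d0 : 0 < s - 1 by rewrite subr_gt0.
exists (Num.truncn (K / (s - 1))).+1.
have := bernoulli (Num.truncn (K / (s - 1))).+1 (ltW d0).
rewrite [1 + (s - 1)]addrC subrK; apply: lt_le_trans.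
have := truncnS_gt (K / (s - 1)); rewrite ltr_pdivrMr// => /lt_trans; apply.
by rewrite ltrDr.
Qed.

(** Multiplying both functions by [d = n + 1] brings the nonzero moduli into [[1, d ^ 2]], and both
    sides of the inequality scale by [d ^ 2]. Then [s] tends to 1. *)
Lemma hausdorff_young_bounded a b (n : nat) : rintegrable r a -> rintegrable r b ->
  (forall x, cabs (a x) = 0 \/ n.+1%:R^-1 <= cabs (a x) <= n.+1%:R) ->
  (forall x, cabs (b x) = 0 \/ n.+1%:R^-1 <= cabs (b x) <= n.+1%:R) ->
  cabs (cintegral (fun x => a x * fourier c b x)) <=
  kap c `^ (- ((r - 1) / r)) * (rnorm r a * rnorm r b) `^ r^-1.
Proof.
move=> ai bi an bn.
have cge0 : 0 <= kap c `^ (- ((r - 1) / r)) * (rnorm r a * rnorm r b) `^ r^-1.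
  by rewrite mulr_ge0 ?powR_ge0.
apply: (le_of_le_mul_expr (n := 4)) => // s s1.
have [N N1] := expr_unbounded (n.+1%:R * n.+1%:R) s1.
set d : R := n.+1%:R; have d0 : 0 < d by rewrite /d.
have dn : cabs d%:C = d by rewrite cabs_real gtr0_norm.
have scale (f : R -> R[i]) :
    (forall x, cabs (f x) = 0 \/ n.+1%:R^-1 <= cabs (f x) <= n.+1%:R) ->
    forall x, cabs (d%:C * f x) = 0 \/ 1 <= cabs (d%:C * f x) < s ^+ N.
  move=> fn x; rewrite cabsM dn; have [->|/andP[f1 f2]] := fn x; first by left; rewrite mulr0.
  right; apply/andP; split; first by rewrite -ler_pdivrMl// mulr1.
  by rewrite (le_lt_trans _ N1)// ler_wpM2l// ltW.
have aL : cintegrable a.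
  apply: (rintegrable_cintegrable_ge r1 (d := n.+1%:R^-1)) => //.
  by move=> x; have [->|/andP[]] := an x; [left|right].
have bL : cintegrable b.
  apply: (rintegrable_cintegrable_ge r1 (d := n.+1%:R^-1)) => //.
  by move=> x; have [->|/andP[]] := bn x; [left|right].
have := hausdorff_young_layered c0 r1 r2 s1 (rintegrableZ d%:C ai) (scale a an)
  (rintegrableZ d%:C bi) (scale b bn).
rewrite (_ : cintegral _ = (d ^+ 2)%:C * cintegral (fun x => a x * fourier c b x)); last first.
  rewrite -cintegralZ; last first.
    under eq_fun do rewrite mulrC.
    apply: (cintegrable_mul_bounded (M := (\int[mu]_x cabs (b x))%R)) => //.
    - by apply: cmeasurable_fourier; case: bL.
    - by move=> x; exact: fourier_le.
  by apply: eq_cintegral => x; rewrite fourierZ// expr2 rmorphM; ring.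
rewrite !rnormZ// dn cabsM cabs_real ger0_norm ?sqr_ge0//.
rewrite (mulrACA (d `^ r)).
rewrite [(_ * (rnorm r a * _)) `^ _]powRM ?mulr_ge0 ?powR_ge0 ?rnorm_ge0//.
have -> : (d `^ r * d `^ r) `^ r^-1 = d ^+ 2.
  by rewrite powRM ?powR_ge0// -powRrM mulfV ?gt_eqF// powRr1 ?(ltW d0)// expr2.
rewrite mulrCA ler_pM2l ?exprn_gt0// => /le_trans; apply.
by rewrite mulrAC.
Qed.

(** The truncations are removed one at a time. Releasing [b] first is possible because its
    truncations have transforms bounded by the L1 norm of [b]; releasing [a] then relies on the
    integrability of the full product. *)
Theorem hausdorff_young a b : rintegrable r a -> rintegrable r b -> cintegrable b ->
  cintegrable (fun x => a x * fourier c b x) ->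
  cabs (cintegral (fun x => a x * fourier c b x)) <=
  kap c `^ (- ((r - 1) / r)) * (rnorm r a * rnorm r b) `^ r^-1.
Proof.
move=> ai bi bL aTb; set C := kap c `^ _ * _.
have mTb : cmeasurable (fourier c b) by apply: cmeasurable_fourier; case: bL.
have [[ma _] [mb _]] := (ai, bi).
(* The bounded case needs a common level for both functions, here the larger of [n] and [m]. *)
have tr n m : cabs (cintegral (fun x => trunc n a x * fourier c (trunc m b) x)) <= C.
  pose k := maxn n m.
  have wide l (f : R -> R[i]) : (l <= k)%N -> forall x, cabs (trunc l f x) = 0 \/
      k.+1%:R^-1 <= cabs (trunc l f x) <= k.+1%:R.
    move=> lk x; have [->|/andP[h1 h2]] := cabs_trunc l f x; [by left|right].
    rewrite (le_trans _ h1) ?(le_trans h2) ?ler_nat//.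
    by rewrite lef_pV2 ?posrE// ler_nat.
  have ti := rintegrable_trunc r1 n ai; have tj := rintegrable_trunc r1 m bi.
  have := hausdorff_young_bounded ti tj (wide n a (leq_maxl n m)) (wide m b (leq_maxr n m)).
  move=> h.
  apply: (le_trans h).
  have na : rnorm r (trunc n a) <= rnorm r a.
    by apply: (le_rnorm r1 ti ai) => x; exact: cabs_trunc_le.
  have nb : rnorm r (trunc m b) <= rnorm r b.
    by apply: (le_rnorm r1 tj bi) => x; exact: cabs_trunc_le.
  apply: ler_wpM2l.
    exact: powR_ge0.
  apply: ge0_ler_powR.
  - by rewrite invr_ge0 ltW.
  - by rewrite nnegrE mulr_ge0 ?rnorm_ge0.
  - by rewrite nnegrE mulr_ge0 ?rnorm_ge0.
  - exact: (ler_pM (rnorm_ge0 _ _) (rnorm_ge0 _ _) na nb).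
have tr1 n : cabs (cintegral (fun x => trunc n a x * fourier c b x)) <= C.
  have tL := cintegrable_trunc r1 n ai.
  have cv : ccvg (fun m => cintegral (fun x => trunc n a x * fourier c (trunc m b) x))
      (cintegral (fun x => trunc n a x * fourier c b x)).
    pose M := (\int[mu]_x cabs (b x))%R.
    have mTm m : cmeasurable (fourier c (trunc m b)).
      by apply: cmeasurable_fourier; exact: cmeasurable_trunc.
    apply: (dominated_ccvg (G := fun x => M * cabs (trunc n a x))).
    - by move=> m; apply: cmeasurableM => //; case: tL.
    - by apply: cmeasurableM => //; case: tL.
    - exact: (integrableZl measurableT M (integrable_cabs tL)).
    - move=> m x; rewrite cabsM mulrC ler_wpM2r ?cabs_ge0//.
      have bm := cintegrable_trunc r1 m bi.
      rewrite (le_trans (fourier_le c x bm))//; apply: le_Rintegral => //.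
      + exact: integrable_cabs.
      + exact: integrable_cabs.
      + by move=> y _; exact: cabs_trunc_le.
    - move=> x; apply: ccvgM; first exact: ccvg_cst.
      apply: (dominated_ccvg (G := fun y => cabs (b y))).
      + by move=> m; case: (cintegrable_fourier_arg c x (cintegrable_trunc r1 m bi)).
      + by case: (cintegrable_fourier_arg c x bL).
      + exact: integrable_cabs.
      + by move=> m y; rewrite cabsM cabs_expi mulr1; exact: cabs_trunc_le.
      + by move=> y; apply: ccvgM; [exact: ccvg_trunc|exact: ccvg_cst].
  have cvn := ccvg_cabs cv.
  rewrite -(cvg_lim _ cvn)//; apply: limr_le; first by apply/cvg_ex; eexists; exact: cvn.
  by apply: nearW => m; exact: tr.
have cv : ccvg (fun n => cintegral (fun x => trunc n a x * fourier c b x))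
    (cintegral (fun x => a x * fourier c b x)).
  apply: (dominated_ccvg (G := fun x => cabs (a x * fourier c b x))).
  - by move=> n; apply: cmeasurableM => //; exact: cmeasurable_trunc.
  - by case: aTb.
  - exact: integrable_cabs.
  - by move=> n x; rewrite cabsM [leRHS]cabsM ler_wpM2r ?cabs_ge0 ?cabs_trunc_le.
  - by move=> x; apply: ccvgM; [exact: ccvg_trunc|exact: ccvg_cst].
have cvn := ccvg_cabs cv.
rewrite -(cvg_lim _ cvn)//; apply: limr_le; first by apply/cvg_ex; eexists; exact: cvn.
by apply: nearW => m; exact: tr1.
Qed.

End hausdorff_young.

(** * The uncertainty inequality for the Fourier transform *)

Section weighted.
Context {R : realType}.
Local Notation mu := (@lebesgue_measure R).
Variable r : R.
Hypotheses (r1 : 1 <= r) (r2 : r <= 2).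

Definition wt (f : R -> R[i]) (x : R) : R[i] := x%:C * f x.

Lemma cmeasurable_wt f : cmeasurable f -> cmeasurable (wt f).
Proof. by move=> mf; apply: cmeasurableM => //; exact: cmeasurable_real. Qed.

Lemma cabs_wt f x : cabs (wt f x) = `|x| * cabs (f x).
Proof. by rewrite /wt cabsM cabs_real. Qed.

(** Three regimes. For [|x| <= 1] the first and last terms suffice. For [|x| > 1] and [|x| t >= 1]
    the middle one does. Otherwise AM-GM is applied to [t = (|x| t) |x|^-1], and [(|x| t) ^ 2] is
    below the [r]-th power because [r <= 2]. *)
Lemma le_weighted (x t : R) : 0 <= t ->
  t <= t ^+ 2 + (`|x| * t) `^ r + 2 * (1 + x ^+ 2)^-1.
Proof.
move=> t0; set q := (1 + x ^+ 2)^-1; set p := _ `^ r.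
have p0 : 0 <= p by exact: powR_ge0.
have q0 : 0 < q by rewrite invr_gt0 ltr_pwDl// sqr_ge0.
have xx : x ^+ 2 = `|x| ^+ 2 by rewrite real_normK ?num_real.
have [x1|x1] := leP `|x| 1.
  have : 1 <= 2 * q.
    rewrite ler_pdivlMr ?ltr_pwDl ?sqr_ge0// mul1r xx.
    by have := normr_ge0 x; nra.
  by have := sqr_ge0 (2 * t - 1); nra.
have [xt|xt] := leP 1 (`|x| * t).
  have xp : `|x| * t <= p by apply: le_rpow => //; right.
  have tx : t <= `|x| * t by rewrite ler_peMl// ltW.
  by have := sqr_ge0 t; lra.
have xp : (`|x| * t) ^+ 2 <= p.
  have [->|xt0] := eqVneq (`|x| * t) 0; first by rewrite expr0n.
  rewrite -powR_mulrn ?mulr_ge0// ger_powR// lt_def xt0 mulr_ge0//=.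
  exact: ltW.
have q2 : (`|x| ^+ 2)^-1 <= 2 * q.
  have X1 : 1 < `|x| ^+ 2 by rewrite exprn_egt1.
  rewrite /q xx; set X := _ ^+ 2 in X1 *.
  have [X0 X2] : 0 < X /\ 0 < 1 + X by split; lra.
  by rewrite ler_pdivlMr// mulrC ler_pdivrMr//; lra.
have : t <= (`|x| * t) ^+ 2 + (`|x| ^+ 2)^-1.
  have x0 : `|x| != 0 by rewrite gt_eqF// (lt_trans ltr01).
  have e : t = (`|x| * t) * `|x|^-1 by rewrite mulrAC mulfV// mul1r.
  rewrite -exprVn; rewrite {1}e.
  by have := sqr_ge0 (`|x| * t - `|x|^-1); have := sqr_ge0 (`|x| * t);
    have := sqr_ge0 (`|x|^-1); nra.
by have := sqr_ge0 t; lra.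
Qed.

Lemma weighted_cintegrable f : sq_integrable f -> rintegrable r (wt f) -> cintegrable f.
Proof.
move=> f2 wf; apply: (@cintegrable_le _ _ (fun x =>
  cabs (f x) ^+ 2 + cabs (wt f x) `^ r + 2 * cabs ((1 + x ^+ 2)^-1)%:C)).
- by case: f2.
- have h1 := integrableD measurableT (sq_integrableP f2) (rintegrableP wf).
  have h2 := integrableZl measurableT 2 (integrable_cabs (@cintegrable_oneDsqrV R)).
  exact: (integrableD measurableT h1 h2).
- move=> x; rewrite cabs_real ger0_norm; last first.
    by rewrite invr_ge0 addr_ge0// sqr_ge0.
  by rewrite cabs_wt; apply: le_weighted; exact: cabs_ge0.
Qed.

End weighted.

(** * Integration by parts with symmetric differences *)

Section heisenberg.
Context {R : realType}.
Local Notation mu := (@lebesgue_measure R).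
Variable r : R.
Hypotheses (r1 : 1 <= r) (r2 : r <= 2).
Variable c : R.
Hypothesis c0 : c != 0.
Variables (f0 h : R -> R[i]).
Hypotheses (h1 : cintegrable h) (wh : rintegrable r (wt h)).
Hypothesis fE : forall x, f0 x = (kap c)%:C * fourier c h x.
Hypotheses (f1 : cintegrable f0) (wf : rintegrable r (wt f0)).

Let M := kap c * (\int[mu]_x cabs (h x))%R.

Let f0_bounded x : cabs (f0 x) <= M.
Proof.
rewrite fE cabsM cabs_real gtr0_norm ?kap_gt0//.
by rewrite ler_wpM2l ?(ltW (kap_gt0 c0))// fourier_le.
Qed.

Let M0 : 0 <= M. Proof. exact: le_trans (cabs_ge0 _) (f0_bounded 0). Qed.

Let cvg_f0 x (w : nat -> R) : w n @[n --> \oo] --> x -> ccvg (fun n => f0 (w n)) (f0 x).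
Proof.
move=> wx; rewrite fE; rewrite (_ : (fun n => _) = fun n => (kap c)%:C * fourier c h (w n)).
  by apply: ccvgM; [exact: ccvg_cst|exact: ccvg_fourier].
by apply/funext => n; rewrite fE.
Qed.

Let shift_f0 (e : R) : cintegrable (fun x => f0 (x + e)).
Proof. exact: cintegrable_preserving (lebesgue_preserving_shift e) f1. Qed.

(** [wt f0] need not be integrable. Where its modulus is at least 1 it is below its [r]-th power and
    [f0] is bounded; elsewhere the integrable shift of [f0] dominates. *)
Let wt_shift (e : R) : cintegrable (fun x => conjc (wt f0 x) * f0 (x + e)).
Proof.
have [ms _] := shift_f0 e; have [mw _] := wf.
apply: (@cintegrable_le _ _ (fun x => M * cabs (wt f0 x) `^ r + cabs (f0 (x + e)))).
- by apply: cmeasurableM => //; exact: cmeasurable_conj.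
- have iw := integrableZl measurableT M (rintegrableP wf).
  exact: (integrableD measurableT iw (integrable_cabs (shift_f0 e))).
move=> x; rewrite cabsM cabs_conj.
have [w1|w1] := leP 1 (cabs (wt f0 x)).
  have wr : cabs (wt f0 x) <= cabs (wt f0 x) `^ r by apply: le_rpow => //; right.
  apply: (@le_trans _ _ (M * cabs (wt f0 x) `^ r)); last by rewrite lerDl cabs_ge0.
  by rewrite mulrC; apply: ler_pM; rewrite ?cabs_ge0.
apply: (@le_trans _ _ (cabs (f0 (x + e)))).
  by rewrite ler_piMl ?cabs_ge0// ltW.
by rewrite lerDr mulr_ge0// powR_ge0.
Qed.

(** The autocorrelation of [f0], whose value at 0 is the squared L2 norm. *)
Let corr (e : R) := cintegral (fun x => f0 (x + e) * conjc (f0 x)).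

Let cintegrable_corr (e : R) : cintegrable (fun x => f0 (x + e) * conjc (f0 x)).
Proof.
apply: (cintegrable_mul_bounded (M := M)).
- by case: (shift_f0 e).
- exact: cintegrable_conj.
- by move=> x; exact: f0_bounded.
Qed.

(* A symmetric difference quotient plays the role of the derivative in the
   integration by parts [2 Re int x f0 conj(f0') = - int |f0|^2]. *)
Let Re_diff (e : R) : complex.Re (cintegral (fun x => conjc (wt f0 x) * (f0 (x + e) - f0 (x - e)))) =
  - e * complex.Re (corr e).
Proof.
have B1 : cintegrable (fun x => conjc (wt f0 (x + e)) * f0 x).
  have := cintegrable_preserving (lebesgue_preserving_shift e) (wt_shift (- e)).
  by under eq_fun do rewrite addrK.
have -> : cintegral (fun x => conjc (wt f0 x) * (f0 (x + e) - f0 (x - e))) =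
    cintegral (fun x => conjc (wt f0 x) * f0 (x + e) - conjc (wt f0 (x + e)) * f0 x).
  rewrite (cintegralB (wt_shift e) B1).
  under eq_cintegral do rewrite mulrBr.
  rewrite (cintegralB (wt_shift e) (wt_shift (- e))); congr (_ - _).
  have := cintegral_preserving (lebesgue_preserving_shift e) (wt_shift (- e)).1.
  by under eq_cintegral do rewrite addrK.
(* The two products are conjugate to each other up to the weights [x] and [x + e], so their real
   parts leave the coefficient [- e]. *)
rewrite /corr /= -RintegralZl//; last exact: integrable_Re.
apply: eq_Rintegral => x _; rewrite /wt.
by case: (f0 x) => a b; case: (f0 (x + e)) => a' b' /=; ring.
Qed.

Lemma normr_sin_le (t : R) : `|sin t| <= `|t|.
Proof.
wlog t0 : t / 0 <= t => [H|].
  have [/H//|/ltW t0] := leP 0 t.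
  by rewrite -normrN -sinN -(normrN t); apply: H; rewrite oppr_ge0.
have dS (x : R) : x \in `]0, t[%R -> is_derive x 1 sin (cos x) by move=> _; exact: is_derive_sin.
have [x _] := MVT_segment t0 dS (continuous_subspaceT (@continuous_sin R)).
rewrite sin0 !subr0 => ->; rewrite normrM ler_piMl//.
by rewrite ler_norml cos_geN1 cos_le1.
Qed.

(** The symmetric difference of [f0] on the frequency side. Bounding the sine by its argument trades
    the difference for [e] times the weight [w]. *)
Let bdiff (e w : R) : R[i] := (0 +i* (kap c * (2 * sin (c * w * e)))) * h w.

Let bdiffE (e w : R) : bdiff e w =
  (kap c)%:C * (h w * expi (c * w * e) - h w * expi (- (c * w * e))).
Proof.
rewrite /bdiff /expi cosN sinN; case: (h w) => a b; apply/eqP; rewrite eq_complex /=.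
by apply/andP; split; apply/eqP; ring.
Qed.

Let cintegrable_bdiff (e : R) : cintegrable (bdiff e).
Proof.
have me : measurable_fun setT (fun w : R => c * w * e).
  apply: measurable_funM; last exact: measurable_cst.
  by apply: measurable_funM.
rewrite (_ : bdiff e = fun w => (kap c)%:C *
    (h w * expi (c * w * e) - h w * expi (- (c * w * e)))).
  apply: cintegrableZ; apply: cintegrableB; apply: cintegrable_expi => //.
  exact: measurable_funN.
by apply/funext => w; rewrite bdiffE.
Qed.

Let fourier_bdiff (e x : R) : fourier c (bdiff e) x = f0 (x + e) - f0 (x - e).
Proof.
rewrite !fE -mulrBr /fourier.
rewrite -(cintegralB (cintegrable_fourier_arg c (x + e) h1) (cintegrable_fourier_arg c (x - e) h1)).
rewrite -cintegralZ; last first.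
  exact: (cintegrableB (cintegrable_fourier_arg c (x + e) h1) (cintegrable_fourier_arg c (x - e) h1)).
apply: eq_cintegral => w; rewrite bdiffE.
have -> : expi (c * w * (x + e)) = expi (c * w * x) * expi (c * w * e).
  by rewrite mulrDr expiD.
have -> : expi (c * w * (x - e)) = expi (c * w * x) * expi (- (c * w * e)).
  by rewrite mulrBr expiD.
by ring.
Qed.

Let cabs_bdiff (e w : R) : 0 < e ->
  cabs (bdiff e w) <= cabs ((2 * kap c * `|c| * e)%:C * wt h w).
Proof.
move=> e0; have k0 := kap_gt0 c0.
rewrite /bdiff cabsM [leRHS]cabsM cabs_wt [leRHS]mulrA ler_wpM2r ?cabs_ge0// cabs_real.
have -> (y : R) : cabs (0 +i* y) = `|y| by rewrite cabs_def /= expr0n add0r sqrtr_sqr.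
rewrite normrM (gtr0_norm k0) normrM normr_nat.
rewrite [`|2 * _ * _ * _|]ger0_norm; last first.
  by apply: mulr_ge0; [apply: mulr_ge0 => //; apply: mulr_ge0 => //; exact: ltW|exact: ltW].
rewrite (_ : 2 * kap c * `|c| * e * `|w| = kap c * (2 * (`|c| * `|w| * e))); last by ring.
rewrite ler_pM2l// ler_pM2l//.
by rewrite (le_trans (normr_sin_le _))// !normrM (gtr0_norm e0).
Qed.

(** Hausdorff-Young is applied to [conjc (wt f0)] and [bdiff e]. Both sides carry a factor [e], so
    the bound is uniform in [e]; the powers of [kap c] combine as [1 - (r - 1) / r = 1 / r]. *)
Let bound (e : R) : 0 < e -> `|complex.Re (corr e)| <=
  2 * kap c `^ r^-1 * `|c| * (rnorm r (wt f0) * rnorm r (wt h)) `^ r^-1.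
Proof.
move=> e0; have k0 := kap_gt0 c0; have r0 : 0 < r by exact: lt_le_trans ltr01 r1.
have [mwf _] := wf; have [mwh _] := wh.
have whZ := rintegrableZ (2 * kap c * `|c| * e)%:C wh.
have bi : rintegrable r (bdiff e).
  apply: (rintegrable_le r1 _ whZ); first by case: (cintegrable_bdiff e).
  by move=> w; exact: cabs_bdiff.
have ai : rintegrable r (fun x => conjc (wt f0 x)).
  apply: (rintegrable_le r1 _ wf); first exact: cmeasurable_conj.
  by move=> x; rewrite cabs_conj.
have ab : cintegrable (fun x => conjc (wt f0 x) * fourier c (bdiff e) x).
  under eq_fun do rewrite fourier_bdiff mulrBr.
  by apply: cintegrableB; exact: wt_shift.
have := hausdorff_young c0 r1 r2 ai bi (cintegrable_bdiff e) ab.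
under eq_cintegral do rewrite fourier_bdiff.
move=> /(le_trans (normr_Re_le _)); rewrite Re_diff normrM normrN (gtr0_norm e0).
have -> : rnorm r (fun x => conjc (wt f0 x)) = rnorm r (wt f0).
  by apply: eq_Rintegral => x _; rewrite cabs_conj.
have nb : rnorm r (bdiff e) <= (2 * kap c * `|c| * e) `^ r * rnorm r (wt h).
  have d0 : 0 <= 2 * kap c * `|c| * e.
    by apply: mulr_ge0; [apply: mulr_ge0 => //; apply: mulr_ge0 => //; exact: ltW|exact: ltW].
  have -> : (2 * kap c * `|c| * e) `^ r * rnorm r (wt h) =
      rnorm r (fun x => (2 * kap c * `|c| * e)%:C * wt h x).
    by rewrite rnormZ// cabs_real (ger0_norm d0).
  by apply: (le_rnorm r1 bi whZ) => w; exact: cabs_bdiff.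
have A0 := rnorm_ge0 r (wt f0); have B0 := rnorm_ge0 r (wt h).
set A := rnorm r (wt f0) in A0 *; set B := rnorm r (wt h) in B0 nb *.
set d := 2 * kap c * `|c| * e in nb.
have d0 : 0 <= d.
  by apply: mulr_ge0; [apply: mulr_ge0 => //; apply: mulr_ge0 => //; exact: ltW|exact: ltW].
have h2 : (A * rnorm r (bdiff e)) `^ r^-1 <= d * (A * B) `^ r^-1.
  apply: (@le_trans _ _ ((d `^ r * (A * B)) `^ r^-1)).
    apply: ge0_ler_powR.
    - by rewrite invr_ge0 ltW.
    - by rewrite nnegrE; exact: (mulr_ge0 A0 (rnorm_ge0 _ _)).
    - by rewrite nnegrE; exact: (mulr_ge0 (powR_ge0 _ _) (mulr_ge0 A0 B0)).
    - by rewrite mulrCA; exact: (ler_wpM2l A0 nb).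
  rewrite (powRM _ (powR_ge0 _ _) (mulr_ge0 A0 B0)) -powRrM mulfV ?(gt_eqF r0)//.
  by rewrite (powRr1 d0).
move=> h3; rewrite -(ler_pM2l e0); apply: (le_trans h3).
apply: (@le_trans _ _ (kap c `^ (- ((r - 1) / r)) * (d * (A * B) `^ r^-1))).
  exact: (ler_wpM2l (powR_ge0 _ _) h2).
have -> : kap c `^ (- ((r - 1) / r)) = kap c `^ r^-1 / kap c.
  rewrite (_ : - ((r - 1) / r) = r^-1 + (-1)); last by field; rewrite gt_eqF.
  by rewrite powRD ?(gt_eqF k0) ?implybT// (powR_inv1 (ltW k0)).
rewrite le_eqVlt; apply/orP; left; apply/eqP; rewrite /d.
move: (kap c) k0 => k k0; field.
by rewrite gt_eqF.
Qed.

(** Let [e] tend to 0 in [bound]. The autocorrelation converges because [fE] holds at every point,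
    which makes [f0] continuous. *)
Theorem heisenberg_fourier : (\int[mu]_x cabs (f0 x) ^+ 2)%R <=
  2 * kap c `^ r^-1 * `|c| * (rnorm r (wt f0) * rnorm r (wt h)) `^ r^-1.
Proof.
pose en (n : nat) : R := n.+1%:R^-1.
have cv : ccvg (fun n => corr (en n)) (corr 0).
  apply: (dominated_ccvg (G := fun x => M * cabs (f0 x))).
  - by move=> n; case: (cintegrable_corr (en n)).
  - by case: (cintegrable_corr 0).
  - exact: (integrableZl measurableT M (integrable_cabs f1)).
  - by move=> n x; rewrite cabsM cabs_conj ler_wpM2r ?cabs_ge0 ?f0_bounded.
  - move=> x; apply: ccvgM; last exact: ccvg_cst.
    by apply: cvg_f0; apply: cvgD; [exact: cvg_cst|exact: cvg_harmonic].
have -> : (\int[mu]_x cabs (f0 x) ^+ 2)%R = complex.Re (corr 0).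
  by rewrite /corr /=; apply: eq_Rintegral => x _; rewrite addr0 mulr_conjc.
have [/cvg_norm cR _] := (ccvgP _ _).1 cv.
rewrite (le_trans (ler_norm _))// -(cvg_lim _ cR)//; apply: limr_le.
  by apply/cvg_ex; eexists; exact: cR.
by apply: nearW => n; apply: bound; rewrite invr_gt0.
Qed.

End heisenberg.

(** * Completeness of L2 *)

Section riesz_fischer.
Context {R : realType}.
Local Notation mu := (@lebesgue_measure R).

Lemma cvg_half_expr : (2^-1 : R) ^+ n @[n --> \oo] --> (0 : R).
Proof. by apply: cvg_expr; rewrite ger0_norm// invf_lt1// ltr1n. Qed.

Lemma cvge0_squeeze (u : nat -> \bar R) (v : nat -> R) :
  (forall n, 0 <= u n)%E -> (forall n, u n <= (v n)%:E)%E ->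
  v n @[n --> \oo] --> 0 -> u n @[n --> \oo] --> 0%E.
Proof.
move=> u0 uv v0.
apply: (@squeeze_cvge _ _ _ _ (fun=> 0%E) u (fun n => (v n)%:E)).
- by apply: nearW => n; rewrite u0 uv.
- exact: cvg_cst.
- by apply/fine_cvgP; split; [exact: nearW|exact: v0].
Qed.

(** Nested intervals: the lower ends [a k - 2 M 2^-k] increase, the upper ends decrease, and [l] is
    the supremum of the lower ends. *)
Lemma real_fast_cauchy (a : nat -> R) (M : R) :
  (forall k, `|a k.+1 - a k| <= M * 2^-1 ^+ k) ->
  exists l, forall k, `|a k - l| <= 2 * M * 2^-1 ^+ k.
Proof.
move=> aM.
have tE k : (2^-1 : R) ^+ k = 2 * 2^-1 ^+ k.+1 by rewrite exprS mulrA mulfV// mul1r.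
pose b k := a k - 2 * M * 2^-1 ^+ k.
pose d k := a k + 2 * M * 2^-1 ^+ k.
have M0 : 0 <= M by have := aM 0%N; rewrite expr0 mulr1; apply: le_trans.
have bS : {homo b : n m / (n <= m)%N >-> n <= m}.
  apply: homo_leq => [//|x y z|k]; first exact: le_trans.
  have := aM k; rewrite ler_norml => /andP[h _].
  by rewrite /b; move: h; rewrite (tE k); lra.
have dS : {homo d : n m / (n <= m)%N >-> m <= n}.
  apply: homo_leq => [//|x y z h1 h2|k]; first exact: le_trans h2 h1.
  have := aM k; rewrite ler_norml => /andP[_ h].
  by rewrite /d; move: h; rewrite (tE k); lra.
have bd j k : b j <= d k.
  apply: (@le_trans _ _ (b (maxn j k))); first by apply: bS; exact: leq_maxl.
  apply: (@le_trans _ _ (d (maxn j k))); last by apply: dS; exact: leq_maxr.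
  have p : 0 <= 2 * M * 2^-1 ^+ (maxn j k) by rewrite !mulr_ge0// exprn_ge0.
  by rewrite /b /d; lra.
exists (sup (range b)) => k.
have hs : has_sup (range b).
  split; first by exists (b 0%N), 0%N.
  by exists (d 0%N) => _ [j _ <-]; exact: bd.
have h1 : b k <= sup (range b) by apply: ub_le_sup; [case: hs|exists k].
have h2 : sup (range b) <= d k.
  by apply: ge_sup => [|_ [j _ <-]]; [case: hs|exact: bd].
by rewrite ler_norml; move: h1 h2; rewrite /b /d => h1 h2; apply/andP; split; lra.
Qed.

Lemma complex_fast_cauchy (z : nat -> R[i]) (M : R) :
  (forall k, cabs (z k.+1 - z k) <= M * 2^-1 ^+ k) ->
  exists l, forall k, cabs (z k - l) <= 4 * M * 2^-1 ^+ k.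
Proof.
move=> zM.
have [|l1 h1] := @real_fast_cauchy (fun k => complex.Re (z k)) M.
  move=> k; rewrite (le_trans _ (zM k))// (le_trans _ (normr_Re_le _))//.
  by case: (z k.+1) => ? ?; case: (z k).
have [|l2 h2] := @real_fast_cauchy (fun k => complex.Im (z k)) M.
  move=> k; rewrite (le_trans _ (zM k))// (le_trans _ (normr_Im_le _))//.
  by case: (z k.+1) => ? ?; case: (z k).
exists (l1 +i* l2) => k; rewrite (le_trans (cabs_le_ReIm _))//.
have := h1 k; have := h2 k; case: (z k) => x y /= a b.
by apply: le_trans (lerD b a) _; rewrite le_eqVlt; apply/orP; left; apply/eqP; ring.
Qed.

Lemma sqnormB_le (f g : R -> R[i]) : cmeasurable f -> cmeasurable g ->
  (sqnorm (fun x => f x - g x)%R <= 2%:E * sqnorm f + 2%:E * sqnorm g)%E.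
Proof.
move=> mf mg; rewrite /sqnorm -!ge0_integralZl//; last 4 first.
- by apply/measurable_EFinP; exact: measurable_sq.
- by move=> x _; rewrite lee_fin sqr_ge0.
- by apply/measurable_EFinP; exact: measurable_sq.
- by move=> x _; rewrite lee_fin sqr_ge0.
rewrite -ge0_integralD//; last 4 first.
- by move=> x _; rewrite mule_ge0 ?lee_fin ?sqr_ge0.
- by apply: emeasurable_funM => //; apply/measurable_EFinP; exact: measurable_sq.
- by move=> x _; rewrite mule_ge0 ?lee_fin ?sqr_ge0.
- by apply: emeasurable_funM => //; apply/measurable_EFinP; exact: measurable_sq.
apply: ge0_le_integral => //.
- by move=> x _; rewrite lee_fin sqr_ge0.
- by apply/measurable_EFinP; apply: measurable_sq; exact: cmeasurableB.
- by apply: emeasurable_funD; apply: emeasurable_funM => //; apply/measurable_EFinP; exact: measurable_sq.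
- move=> x _; rewrite -!EFinM -EFinD lee_fin.
  have h : cabs (f x - g x) <= cabs (f x) + cabs (g x).
    by rewrite (le_trans (cabsD _ _))// cabsN.
  have : cabs (f x - g x) ^+ 2 <= (cabs (f x) + cabs (g x)) ^+ 2.
    by rewrite ler_pXn2r// nnegrE ?addr_ge0 ?cabs_ge0.
  move=> /le_trans; apply.
  by have := sqr_ge0 (cabs (f x) - cabs (g x)); nra.
Qed.

(** Weighting the squared steps by [4 ^ k] leaves a series [S] with integral at most [2], the sum of
    [2^-k]. Where [S] is finite the steps are at most [sqrt S] times [2^-k], so the sequence
    converges pointwise with an explicit rate. *)
Lemma riesz_fischer_fast (v : nat -> R -> R[i]) : (forall k, sq_integrable (v k)) ->
  (forall k, sqnorm (fun x => v k.+1 x - v k x)%R <= (8^-1 ^+ k)%:E)%E ->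
  exists2 g, sq_integrable g & sqnorm (fun x => v k x - g x) @[k --> \oo] --> 0%E.
Proof.
move=> v2 v8.
pose F k x : \bar R := (4 ^+ k * cabs (v k.+1 x - v k x) ^+ 2)%:E.
have mv k : cmeasurable (v k) by case: (v2 k).
have mF k : measurable_fun setT (F k).
  apply/measurable_EFinP; apply: measurable_funM; first exact: measurable_cst.
  by apply: measurable_sq; exact: cmeasurableB.
have F0 k x : (0 <= F k x)%E by rewrite lee_fin mulr_ge0 ?sqr_ge0// exprn_ge0.
pose S x : \bar R := (\sum_(0 <= k <oo) F k x)%E.
have S0 x : (0 <= S x)%E by apply: nneseries_ge0 => k _ _.
have mS : measurable_fun setT S by apply: ge0_emeasurable_sum => // k x _ _.
have iF k : (\int[mu]_x F k x <= (2^-1 ^+ k)%:E)%E.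
  rewrite /F; under eq_integral do rewrite EFinM.
  rewrite ge0_integralZl; last 4 first.
  - exact: measurableT.
  - by apply/measurable_EFinP; apply: measurable_sq; exact: cmeasurableB.
  - by move=> x _; rewrite lee_fin sqr_ge0.
  - by rewrite lee_fin exprn_ge0.
  apply: (@le_trans _ _ ((4 ^+ k)%:E * (8^-1 ^+ k)%:E)%E).
    by rewrite lee_wpmul2l ?lee_fin ?exprn_ge0//; exact: v8.
  rewrite -EFinM lee_fin -exprMn le_eqVlt; apply/orP; left; apply/eqP.
  by congr (_ ^+ _); lra.
have iS : (\int[mu]_x S x <= 2%:E)%E.
  rewrite integral_nneseries//; apply: lime_le.
    by apply: is_cvg_nneseries => k _ _; exact: integral_ge0.
  apply: nearW => n; apply: (@le_trans _ _ (\sum_(0 <= k < n) (2^-1 ^+ k)%:E)%E).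
    by apply: lee_sum => k _; exact: iF.
  rewrite sumEFin lee_fin.
  suff -> : \sum_(0 <= k < n) (2^-1 : R) ^+ k = 2 - 2 * 2^-1 ^+ n.
    by rewrite gerBl mulr_ge0// exprn_ge0.
  elim: n => [|n ih]; first by rewrite big_nil expr0 mulr1 subrr.
  by rewrite big_nat_recr//= ih exprS; lra.
have IS : mu.-integrable setT S.
  apply/integrableP; split => //; rewrite (_ : integral _ _ _ = \int[mu]_x S x)%E.
    by rewrite (le_lt_trans iS)// ltry.
  by apply: eq_integral => x _; rewrite gee0_abs.
(* Setting the sequence to 0 where [S] is infinite makes the pointwise limit exist everywhere. *)
pose chi x : R := (S x < +oo)%E%:R.
have mchi : measurable_fun setT chi.
  rewrite (_ : chi = (\1_(S @^-1` [set y | (y < +oo)%E]) : R -> R)).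
    apply: measurable_indic; rewrite -[X in measurable X]setTI.
    apply: mS => //.
    have -> : [set y : \bar R | (y < +oo)%E] = `]-oo, (+oo%E : \bar R)[%classic.
      by apply/seteqP; split => y /=; rewrite in_itv.
    exact: emeasurable_itv.
  apply/funext => x; rewrite indicE /chi.
  suff -> : (x \in S @^-1` [set y | (y < +oo)%E]) = (S x < +oo)%E by [].
  by apply/idP/idP => [/set_mem//|h]; apply/mem_set.
pose v' k x := (chi x)%:C * v k x.
pose s x := fine (S x).
have s0 x : 0 <= s x by apply: fine_ge0.
have step k x : cabs (v' k.+1 x - v' k x) <= Num.sqrt (s x) * 2^-1 ^+ k.
  rewrite /v' -mulrBr cabsM cabs_real /chi.
  have [Sx|_] := boolP (S x < +oo)%E; last first.
    by rewrite normr0 mul0r mulr_ge0 ?sqrtr_ge0// exprn_ge0.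
  rewrite normr1 mul1r -(@ler_pXn2r _ 2) ?nnegrE ?cabs_ge0 ?mulr_ge0 ?sqrtr_ge0 ?exprn_ge0//.
  rewrite exprMn sqr_sqrtr// -exprM mulnC exprM.
  have -> : (2^-1 : R) ^+ 2 = 4^-1 by rewrite exprVn; congr (_^-1); ring.
  rewrite exprVn ler_pdivlMr ?exprn_gt0// mulrC -lee_fin.
  rewrite /s fineK ?ge0_fin_numE//.
  have := @nneseries_lim_ge R (fun k => F k x) xpredT 0%N k.+1 (fun j _ _ => F0 j x).
  apply: le_trans; rewrite big_nat_recr//= /F.
  by apply: leeDr; apply: sume_ge0 => i _; exact: F0.
have [g gP] : exists g : R -> R[i], forall x k,
    cabs (v' k x - g x) <= 4 * Num.sqrt (s x) * 2^-1 ^+ k.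
  have /choice[g gP] : forall x, exists l, forall k,
    cabs (v' k x - l) <= 4 * Num.sqrt (s x) * 2^-1 ^+ k.
    by move=> x; apply: complex_fast_cauchy => k; exact: step.
  by exists g.
have cvg' x : ccvg (v' ^~ x) (g x).
  apply: (ccvg_le (gP x)).
  by rewrite -[X in _ --> X](mulr0 (4 * Num.sqrt (s x))); apply: cvgMr; exact: cvg_half_expr.
have mv' k : cmeasurable (v' k) by apply: cmeasurableM => //; exact: cmeasurable_real.
have mg : cmeasurable g.
  split.
  - apply: (measurable_fun_cvg (h := fun k x => complex.Re (v' k x))).
      by move=> k; case: (mv' k).
    by move=> x _; have /ccvgP[] := cvg' x.
  - apply: (measurable_fun_cvg (h := fun k x => complex.Im (v' k x))).
      by move=> k; case: (mv' k).
    by move=> x _; have /ccvgP[] := cvg' x.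
(* The pointwise rate [4 sqrt S 2^-k] squares to [16 S 4^-k], and [S] has integral at most 2. *)
have dist k : (sqnorm (fun x => v k x - g x)%R <= (32 * 4^-1 ^+ k)%:E)%E.
  apply: (@le_trans _ _ (\int[mu]_x ((16 * 4^-1 ^+ k)%:E * S x))%E); last first.
    rewrite ge0_integralZl// ?lee_fin ?mulr_ge0 ?exprn_ge0//.
    apply: (@le_trans _ _ ((16 * 4^-1 ^+ k)%:E * 2%:E)%E).
      by rewrite lee_wpmul2l// lee_fin mulr_ge0 ?exprn_ge0.
    by rewrite -EFinM lee_fin; lra.
  apply: ge0_le_integral => //.
  - by move=> x _; rewrite lee_fin sqr_ge0.
  - by apply/measurable_EFinP; apply: measurable_sq; exact: cmeasurableB.
  - by apply: emeasurable_funM.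
  - move=> x _; have [Sx|Sx] := boolP (S x < +oo)%E; last first.
      move: Sx; rewrite -leNgt leye_eq => /eqP ->.
      by rewrite gt0_muley ?leey// lte_fin mulr_gt0// exprn_gt0.
    have -> : v k x = v' k x by rewrite /v' /chi Sx mul1r.
    rewrite -(@fineK _ (S x)) ?ge0_fin_numE// -EFinM lee_fin -/(s x).
    have G0 : 0 <= 4 * Num.sqrt (s x) * 2^-1 ^+ k.
      by rewrite mulr_ge0 ?exprn_ge0// mulr_ge0 ?sqrtr_ge0.
    have h : cabs (v' k x - g x) ^+ 2 <= (4 * Num.sqrt (s x) * 2^-1 ^+ k) ^+ 2.
      by rewrite lerXn2r ?nnegrE ?cabs_ge0//; exact: gP.
    apply: (le_trans h); rewrite le_eqVlt; apply/orP; left; apply/eqP.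
    rewrite (exprMn _ (4 * _)) (exprMn _ 4) sqr_sqrtr// -exprM mulnC exprM.
    have -> : (2^-1 : R) ^+ 2 = 4^-1 by rewrite exprVn; congr (_^-1); ring.
    by ring.
exists g.
  split => //; have := sqnormB_le (mv 0%N) (cmeasurableB (mv 0%N) mg).
  rewrite (_ : (fun x => _) = g); last by apply/funext => x; rewrite subKr.
  move=> /le_lt_trans; apply; rewrite lte_add_pinfty//.
    by rewrite lte_mul_pinfty//; case: (v2 0%N).
  by rewrite lte_mul_pinfty// (le_lt_trans (dist 0%N))// ltry.
apply: (cvge0_squeeze (fun k => sqnorm_ge0 _) dist).
rewrite -[X in _ --> X](mulr0 32); apply: cvgMr; apply: cvg_expr.
by rewrite ger0_norm// invf_lt1// ltr1n.
Qed.

End riesz_fischer.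

(** * The special affine Fourier transform *)

Section norms.
Context {R : realType}.
Local Notation mu := (@lebesgue_measure R).
Implicit Types f g : R -> R[i].

Lemma cLnorm2E f : cLnorm 2 f = sqrte (sqnorm f).
Proof.
rewrite /cLnorm unlock poweR12_sqrt; last by apply: integral_ge0 => x _; exact: poweR_ge0.
congr sqrte; apply: eq_integral => x _ /=.
by rewrite ger0_norm ?cabs_ge0// powR_mulrn ?cabs_ge0.
Qed.

Lemma sqr_cLnorm2 f : (cLnorm 2 f ^+ 2 = sqnorm f)%E.
Proof. by rewrite cLnorm2E sqr_sqrte// sqnorm_ge0. Qed.

Lemma sqrte_lty (x : \bar R) : (0 <= x)%E -> (sqrte x < +oo)%E = (x < +oo)%E.
Proof. by case: x => [x| |] //= _; rewrite !ltry. Qed.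

Lemma cLp2P f : cLp 2 f <-> sq_integrable f.
Proof.
split => [[mR mI]|[[mR mI] fi]].
  by rewrite cLnorm2E sqrte_lty ?sqnorm_ge0.
by split => //; rewrite cLnorm2E sqrte_lty ?sqnorm_ge0.
Qed.

Lemma cLnorm1E f : (cLnorm 1 f = \int[mu]_x (cabs (f x))%:E)%E.
Proof.
rewrite /cLnorm Lnorm1; apply: eq_integral => x _ /=.
by rewrite ger0_norm ?cabs_ge0.
Qed.

Lemma cLp1P f : cLp 1 f <-> cintegrable f.
Proof.
split => [[mR mI]|[[mR mI] fi]]; first by rewrite cLnorm1E.
by split => //; rewrite cLnorm1E.
Qed.

Lemma sqrte_cvg0 (d : nat -> \bar R) : (forall n, 0 <= d n)%E ->
  sqrte (d n) @[n --> \oo] --> 0%E <-> d n @[n --> \oo] --> 0%E.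
Proof.
move=> d0; split => [h|/fine_cvgP[h1 h2]].
  rewrite (_ : d = (fun n => sqrte (d n) * sqrte (d n))%E); last first.
    by apply/funext => n; rewrite -expe2 sqr_sqrte.
  by rewrite -[X in _ --> X](mule0 0%E); exact: (cvgeM _ h h).
apply/fine_cvgP; split.
  by apply: filterS h1 => n; rewrite sqrte_fin_num.
have h3 : Num.sqrt (fine (d n)) @[n --> \oo] --> Num.sqrt 0.
  by apply: continuous_cvg h2; exact: sqrt_continuous.
rewrite sqrtr0 in h3; apply: cvg_trans h3; apply: near_eq_cvg.
by apply: filterS h1 => n /=; case: (d n).
Qed.

Lemma L2_cvgP (u : nat -> R -> R[i]) f :
  L2_cvg u f <-> sqnorm (fun x => u n x - f x) @[n --> \oo] --> 0%E.
Proof.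
rewrite -sqrte_cvg0; last by move=> n; exact: sqnorm_ge0.
by rewrite /L2_cvg; under eq_fun do rewrite cLnorm2E.
Qed.

Lemma sqnorm_phase (M : R) (a f : R -> R[i]) : (forall x, cabs (a x) = M) ->
  cmeasurable f -> (sqnorm (fun x => a x * f x)%R = (M ^+ 2)%:E * sqnorm f)%E.
Proof.
move=> aM mf; rewrite /sqnorm -ge0_integralZl.
- by apply: eq_integral => x _; rewrite cabsM aM exprMn EFinM.
- exact: measurableT.
- by apply/measurable_EFinP; exact: measurable_sq.
- by move=> x _; rewrite lee_fin sqr_ge0.
- by rewrite lee_fin sqr_ge0.
Qed.

Lemma ae_eq_sqnorm f g : cmeasurable f -> cmeasurable g ->
  {ae mu, forall x, f x = g x} -> sqnorm f = sqnorm g.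
Proof.
move=> mf mg fg; apply: ae_eq_integral => //.
- by apply/measurable_EFinP; exact: measurable_sq.
- by apply/measurable_EFinP; exact: measurable_sq.
- by apply: filterS fg => x -> _.
Qed.

Lemma sqnorm_ae_eq0 f : cmeasurable f -> {ae mu, forall x, f x = 0} -> sqnorm f = 0%E.
Proof.
move=> mf f0; have m0 : cmeasurable (fun _ : R => 0 : R[i]) by exact: cmeasurable_cst.
rewrite (ae_eq_sqnorm mf m0 f0); apply: integral0_eq => x _.
by rewrite ComplexField.Normc.normc0 expr0n.
Qed.

Lemma sqnorm_trunc f : sq_integrable f ->
  sqnorm (fun x => trunc n f x - f x) @[n --> \oo] --> 0%E.
Proof.
move=> f2; have mf := f2.1.
pose d n x := cabs (trunc n f x - f x) ^+ 2.
have md n : cmeasurable (fun x => (d n x)%:C).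
  apply: cmeasurable_real; apply: measurable_sq; apply: cmeasurableB => //.
  exact: cmeasurable_trunc.
have dle n x : d n x <= cabs (f x) ^+ 2.
  rewrite /d /trunc -[X in _ - X]mul1r -mulrBl.
  case: (_ && _); first by rewrite subrr mul0r ComplexField.Normc.normc0 expr0n sqr_ge0.
  by rewrite sub0r mulN1r cabsN.
have dn x : `|d n x| @[n --> \oo] --> (0 : R).
  have h := ccvg_trunc f x; rewrite -[X in _ --> X](mulr0 (0 : R)).
  under eq_fun do rewrite ger0_norm ?sqr_ge0// /d expr2.
  exact: (cvgM h h).
have m0 : cmeasurable (fun _ : R => 0 : R[i]) by exact: cmeasurable_cst.
have : ccvg (fun n => cintegral (fun x => (d n x)%:C)) (cintegral (fun _ : R => 0 : R[i])).
  apply: (dominated_ccvg md m0 (sq_integrableP f2)) => [n x|x].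
    by rewrite cabs_real ger0_norm ?sqr_ge0.
  by rewrite /ccvg; under eq_fun do rewrite subr0 cabs_real; exact: dn.
rewrite cintegral0 /ccvg; under eq_fun do rewrite cintegral_real subr0 cabs_real.
move=> h; apply: (cvge0_squeeze _ _ h) => n; first exact: sqnorm_ge0.
have fn : (sqnorm (fun x => trunc n f x - f x)%R < +oo)%E.
  apply: le_lt_trans f2.2; apply: ge0_le_integral => //.
  - by move=> x _; rewrite lee_fin sqr_ge0.
  - apply/measurable_EFinP; apply: measurable_sq; apply: cmeasurableB => //.
    exact: cmeasurable_trunc.
  - by apply/measurable_EFinP; exact: measurable_sq.
  - by move=> x _; rewrite lee_fin; exact: dle.
rewrite ger0_norm; last by apply: fine_ge0; exact: sqnorm_ge0.
by rewrite fineK// ge0_fin_numE// sqnorm_ge0.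
Qed.

Lemma fast_subsequence (d : nat -> \bar R) (e : nat -> R) :
  d n @[n --> \oo] --> 0%E -> (forall k, 0 < e k) ->
  exists s : nat -> nat, forall k, (d (s k) <= (e k)%:E)%E.
Proof.
move=> d0 e0.
suff /choice[s sP] : forall k, exists n, (d n <= (e k)%:E)%E by exists s.
move=> k; have [h1 h2] := (fine_cvgP _ _).1 d0.
have /cvgrPdist_le/(_ _ (e0 k)) h3 := h2.
have [n [h4 h5]] := @filter_ex _ _ _ _ (filterI h1 h3).
exists n; move: h5; rewrite /= sub0r normrN => h5.
by rewrite -(fineK h4) lee_fin (le_trans (ler_norm _)).
Qed.

End norms.

(** * Reduction to the Fourier transform: chirps, existence and inversion *)

Section saft.
Context {R : realType}.
Local Notation mu := (@lebesgue_measure R).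
Variables A B D p q : R.
Hypothesis B0 : B != 0.

Definition chirp_in (x : R) : R[i] := expi ((A * x ^+ 2 + 2 * x * p) / (2 * B)).

Definition chirp_out (w : R) : R[i] :=
  expi ((D * w ^+ 2 - 2 * w * (D * p - B * q)) / (2 * B)).

Local Notation K := (conjc (saft_const B)).
Local Notation c := (B^-1).

Lemma measurable_chirp_in : cmeasurable chirp_in.
Proof.
apply: cmeasurable_expi; apply: measurable_funM => //.
by apply: measurable_funD; exact: measurable_funM.
Qed.

Lemma measurable_chirp_out : cmeasurable chirp_out.
Proof.
apply: cmeasurable_expi; apply: measurable_funM => //.
by apply: measurable_funB; do 2?apply: measurable_funM => //.
Qed.

Lemma cexpE (a y : R) : cexp ('i%C / a%:C * y%:C) = expi (y / a).
Proof.
have -> : 'i%C / a%:C * y%:C = 0 +i* (y / a).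
  rewrite (_ : a%:C^-1 = (a^-1)%:C); last by rewrite -fmorphV.
  by apply/eqP; rewrite eq_complex /= !mul0r !mul1r !mulr0 !subr0 ?addr0 ?mul0r ?add0r mulrC eqxx; apply/andP; split.
by rewrite /cexp /= expR0 !mul1r.
Qed.

Lemma saft_kernelE x w : saft_kernel A B D p q x w =
  K * chirp_out w * (chirp_in x * expi (- c * x * w)).
Proof.
rewrite /saft_kernel cexpE -[RHS]mulrA; congr (_ * _).
rewrite /chirp_out /chirp_in -!expiD; congr expi.
by field.
Qed.

Lemma cintegrable_chirp f : cintegrable f -> cintegrable (fun x => chirp_in x * f x).
Proof.
move=> fi; apply: (cintegrable_mul_bounded (M := 1)) => //.
  exact: measurable_chirp_in.
by move=> x; rewrite cabs_expi.
Qed.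

Lemma saft_intE f w : cintegrable f -> saft_int A B D p q f w =
  K * chirp_out w * fourier (- c) (fun x => chirp_in x * f x) w.
Proof.
move=> fi; rewrite /saft_int /fourier -cintegralZ.
  by apply: eq_cintegral => x; rewrite saft_kernelE; ring.
by apply: cintegrable_fourier_arg; exact: cintegrable_chirp.
Qed.

Lemma saft_intB f g w : cintegrable f -> cintegrable g ->
  saft_int A B D p q (fun x => f x - g x) w =
  saft_int A B D p q f w - saft_int A B D p q g w.
Proof.
move=> fi gi.
have E : (fun x => chirp_in x * (f x - g x)) =
    fun x => chirp_in x * f x - chirp_in x * g x.
  by apply/funext => x; rewrite mulrBr.
rewrite (saft_intE _ (cintegrableB fi gi)) (saft_intE _ fi) (saft_intE _ gi) E.
by rewrite (fourierB _ _ (cintegrable_chirp fi) (cintegrable_chirp gi)) mulrBr.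
Qed.

(** Squaring removes the principal root, so the sign of [B] does not matter. This is exactly the
    normalisation of [fourier_contraction]. *)
Lemma sqr_cabs_saft_const : cabs K ^+ 2 = kap c.
Proof.
rewrite cabs_conj /saft_const -cabsX exprVn sqr_sqrtc.
rewrite (_ : _^-1 = ((2 * pi * B)^-1)%:C); last by rewrite -fmorphV.
have p0 := pi_gt0 R.
have P0 : 0 < 2 * pi :> R by rewrite mulr_gt0.
rewrite cabs_real /kap [in RHS]normrV ?unitfE// normrV ?unitfE; last first.
  by rewrite mulf_neq0// gt_eqF.
by rewrite normrM (gtr0_norm P0) invfM mulrC.
Qed.

Lemma saft_const_neq0 : K != 0.
Proof.
apply/eqP => K0; have := sqr_cabs_saft_const.
rewrite K0 ComplexField.Normc.normc0 expr0n => /eqP; rewrite eq_sym gt_eqF//.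
by apply: kap_gt0; rewrite invr_neq0.
Qed.

Lemma cmeasurable_saft_int f : cintegrable f -> cmeasurable (saft_int A B D p q f).
Proof.
move=> fi; rewrite (_ : saft_int _ _ _ _ _ _ = fun w =>
  K * chirp_out w * fourier (- c) (fun x => chirp_in x * f x) w); last first.
  by apply/funext => w; rewrite saft_intE.
apply: cmeasurableM; first by apply: cmeasurableZ; exact: measurable_chirp_out.
by apply: cmeasurable_fourier; case: (cintegrable_chirp fi).
Qed.

Lemma sqnorm_chirp f : cmeasurable f -> sqnorm (fun x => chirp_in x * f x)%R = sqnorm f.
Proof.
move=> mf; rewrite (sqnorm_phase (M := 1)) ?expr1n ?mul1e//.
by move=> x; exact: cabs_expi.
Qed.

Lemma sqnorm_saft_int f : cintegrable f ->
  (sqnorm (saft_int A B D p q f) <= sqnorm f)%E.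
Proof.
move=> fi; have mf := fi.1; rewrite -(sqnorm_chirp mf).
have Nc0 : - c != 0 by rewrite oppr_eq0 invr_neq0.
apply: le_trans (fourier_contraction Nc0 (cintegrable_chirp fi)).
rewrite le_eqVlt; apply/orP; left; apply/eqP; apply: eq_integral => w _.
rewrite saft_intE// [cabs _]cabsM cabsM cabs_expi mulr1 exprMn sqr_cabs_saft_const.
by rewrite /kap normrN.
Qed.

(** [saft] is a choice with default value 0, so it has content only once a representative exists.
    The contraction turns fast truncations of [f] into a fast Cauchy sequence of transforms. *)
Lemma is_saft_exists f : sq_integrable f -> exists g, is_saft A B D p q f g.
Proof.
move=> f2; have mf := f2.1.
(* The quarter absorbs the factor 2 in [sqnormB_le]: consecutive truncations then differ by at most
   [8^-1 ^ k] in squared norm. *)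
have [s sP] : exists s : nat -> nat, forall k,
    (sqnorm (fun x => trunc (s k) f x - f x)%R <= (8^-1 ^+ k / 4)%:E)%E.
  by apply: fast_subsequence (sqnorm_trunc f2) _ => k; rewrite divr_gt0// exprn_gt0.
pose u k := trunc (s k) f.
have r2 : rintegrable 2 f.
  split => //; apply: le_lt_trans f2.2; rewrite le_eqVlt; apply/orP; left; apply/eqP.
  by apply: eq_integral => x _; rewrite powR_mulrn ?cabs_ge0.
have u1 k : cintegrable (u k).
  by apply: (@cintegrable_trunc R 2) => //; rewrite ler1n.
have u2 k : sq_integrable (u k).
  split; first by case: (u1 k).
  apply: le_lt_trans f2.2; apply: ge0_le_integral => //.
  - by move=> x _; rewrite lee_fin sqr_ge0.
  - by apply/measurable_EFinP; apply: measurable_sq; case: (u1 k).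
  - by apply/measurable_EFinP; exact: measurable_sq.
  - move=> x _; rewrite lee_fin lerXn2r ?nnegrE ?cabs_ge0//.
    exact: cabs_trunc_le.
have mu_ k : cmeasurable (u k) by case: (u1 k).
pose v k := saft_int A B D p q (u k).
have v2 k : sq_integrable (v k).
  split; first exact: cmeasurable_saft_int.
  by apply: le_lt_trans (u2 k).2; exact: sqnorm_saft_int.
have v8 k : (sqnorm (fun x => v k.+1 x - v k x)%R <= (8^-1 ^+ k)%:E)%E.
  rewrite (_ : (fun x => _) = saft_int A B D p q (fun x => u k.+1 x - u k x)); last first.
    by apply/funext => w; rewrite saft_intB.
  apply: le_trans (sqnorm_saft_int (cintegrableB (u1 _) (u1 _))) _.
  rewrite (_ : (fun x => _) = (fun x => (u k.+1 x - f x) - (u k x - f x))); last first.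
    by apply/funext => x; rewrite opprB addrA subrK.
  apply: le_trans (sqnormB_le (cmeasurableB (mu_ _) mf) (cmeasurableB (mu_ _) mf)) _.
  apply: le_trans (leeD (lee_wpmul2l _ (sP k.+1)) (lee_wpmul2l _ (sP k))) _ => //.
  rewrite -!EFinM -EFinD lee_fin exprS.
  have : (0 : R) <= 8^-1 ^+ k by rewrite exprn_ge0.
  by lra.
have [g g2 vg] := riesz_fischer_fast v2 v8.
exists g; split; first exact/cLp2P.
exists u; split.
- by move=> n; split; [exact/cLp1P|exact/cLp2P].
- apply/L2_cvgP; apply: (cvge0_squeeze (v := fun k => 8^-1 ^+ k / 4)) => [n|n|].
  + exact: sqnorm_ge0.
  + exact: sP.
  + rewrite -[X in _ --> X](mul0r (4^-1 : R)); apply: cvgMl; apply: cvg_expr.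
    by rewrite ger0_norm// invf_lt1// ltr1n.
- by apply/L2_cvgP; exact: vg.
Qed.

Lemma saftP f : sq_integrable f -> is_saft A B D p q f (saft A B D p q f).
Proof. by move=> f2; rewrite /saft; apply: xgetPex; exact: is_saft_exists. Qed.

(** This undoes the constant and the outer chirp, so that the demodulated transform of [f] is the
    plain Fourier transform of the chirped [f]. *)
Definition demod (g : R -> R[i]) w := K^-1 * conjc (chirp_out w) * g w.

Lemma cabs_demod g w : cabs (demod g w) = (cabs K)^-1 * cabs (g w).
Proof.
rewrite /demod cabsM cabsM cabs_conj cabs_expi mulr1; congr (_ * _).
have K0 := saft_const_neq0.
have h : cabs K^-1 * cabs K = 1.
  by rewrite -cabsM mulVf// (cabs_real 1) normr1.
by rewrite -[LHS]mulr1 -(mulfV (x := cabs K)) ?mulrA ?h ?mul1r//; apply/eqP => h0;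
  move: h; rewrite h0 mulr0 => /eqP; rewrite eq_sym oner_eq0.
Qed.

Lemma cmeasurable_demod g : cmeasurable g -> cmeasurable (demod g).
Proof.
move=> mg; apply: cmeasurableM => //; apply: cmeasurableZ.
by apply: cmeasurable_conj; exact: measurable_chirp_out.
Qed.

Lemma sqnorm_demod g : cmeasurable g ->
  sqnorm (demod g) = (((cabs K)^-1 ^+ 2)%:E * sqnorm g)%E.
Proof.
move=> mg; rewrite -(@sqnorm_phase _ _ (fun w => ((cabs K)^-1)%:C) g)//.
  by apply: eq_integral => w _; rewrite cabs_demod cabsM cabs_real ger0_norm ?invr_ge0 ?cabs_ge0.
by move=> w; rewrite cabs_real ger0_norm ?invr_ge0 ?cabs_ge0.
Qed.

Lemma sq_integrable_demod g : sq_integrable g -> sq_integrable (demod g).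
Proof.
move=> [mg g2]; split; first exact: cmeasurable_demod.
by rewrite sqnorm_demod// lte_mul_pinfty// lee_fin sqr_ge0.
Qed.

(** The sequence supplied by [is_saft], once chirped, has Fourier transforms equal to the
    demodulated integrals [saft_int], which converge to [demod g]; this is the setting of
    [fourier_L2_inversion]. *)
Lemma saft_inversion f g : sq_integrable f -> is_saft A B D p q f g ->
  cintegrable (demod g) ->
  {ae mu, forall x, chirp_in x * f x = (kap c)%:C * fourier c (demod g) x}.
Proof.
move=> f2 [/cLp2P g2 [u [u12 /L2_cvgP uf /L2_cvgP ug]]] h1.
have u1 n : cintegrable (u n) by apply/cLp1P; case: (u12 n).
have u2 n : sq_integrable (u n) by apply/cLp2P; case: (u12 n).
have sqc k : sq_integrable k -> sq_integrable (fun x => chirp_in x * k x).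
  move=> [mk k2]; split; last by rewrite sqnorm_chirp.
  by apply: cmeasurableM => //; exact: measurable_chirp_in.
have c0 : c != 0 by rewrite invr_neq0.
have K0 := saft_const_neq0.
apply: (fourier_L2_inversion c0 (sqc _ f2) h1 (sq_integrable_demod g2)
  (fun n => cintegrable_chirp (u1 n)) (fun n => sqc _ (u2 n))).
  apply: cvg_trans uf; apply: near_eq_cvg; apply: nearW => n.
  rewrite -sqnorm_chirp; last by apply: cmeasurableB; [case: (u1 n)|case: f2].
  by congr sqnorm; apply/funext => x; rewrite mulrBr.
have sE n : (sqnorm (fun w => fourier (- c) (fun x => chirp_in x * u n x) w - demod g w)%R =
    ((cabs K)^-1 ^+ 2)%:E * sqnorm (fun w => saft_int A B D p q (u n) w - g w)%R)%E.
  rewrite -sqnorm_demod; last first.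
    by apply: cmeasurableB; [exact: cmeasurable_saft_int|case: g2].
  congr sqnorm; apply/funext => w; rewrite /demod saft_intE// mulrBr; congr (_ - _).
  have E : conjc (chirp_out w) * chirp_out w = 1.
    by rewrite conjc_expi -expiD addNr expi0.
  transitivity (K^-1 * K * (conjc (chirp_out w) * chirp_out w) *
     fourier (- c) (fun x => chirp_in x * u n x) w); last by ring.
  by rewrite E mulVf// !mul1r.
have h := cvgeZl (erefl : ((cabs K)^-1 ^+ 2)%:E \is a fin_num) ug; rewrite mule0 in h.
by apply: cvg_trans h; apply: near_eq_cvg; apply: nearW => n; rewrite sE.
Qed.

End saft.

(** * Constants, degenerate cases and transfer to the SAFT *)

Section uncertainty.
Context {R : realType}.
Local Notation mu := (@lebesgue_measure R).
Variable r : R.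
Hypotheses (r1 : 1 <= r) (r2 : r <= 2).

Let r0 : 0 < r. Proof. exact: lt_le_trans ltr01 r1. Qed.

Lemma powR_wt (f : R -> R[i]) x : `|x| `^ r * cabs (f x) `^ r = cabs (wt f x) `^ r.
Proof. by rewrite cabs_wt powRM ?cabs_ge0. Qed.

Lemma ae_eq0_wt (f : R -> R[i]) : cmeasurable f ->
  (\int[mu]_x (cabs (wt f x) `^ r)%:E = 0)%E -> {ae mu, forall x, f x = 0}.
Proof.
move=> mf f0.
have mw := measurable_rpow r (cmeasurable_wt mf).
have /ae_eq_integral_abs h : (\int[mu]_x `|(cabs (wt f x) `^ r)%:E| = 0)%E.
  by rewrite -[RHS]f0; apply: eq_integral => x _; rewrite gee0_abs// lee_fin powR_ge0.
have {}h := h measurableT ((measurable_EFinP _ _).2 mw).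
apply: filterS2 (ae_neq (0 : R)) h => x x0 /(_ I) /= [] /eqP.
rewrite powR_eq0 => /andP[/eqP/ComplexField.Normc.eq0_normc/eqP + _].
rewrite /wt mulf_eq0 => /orP[/eqP/(congr1 (@complex.Re R)) /= x00|/eqP//].
by rewrite x00 eqxx in x0.
Qed.

(** The left side is [b K ^ 2] to the power [1/r - 1/2], which is nonnegative since [r <= 2]. In the
    application [b = |B|] and [K ^ 2 = kap B^-1], so that [b K ^ 2 = 1 / (2 pi)]. *)
Lemma saft_constant_le (b K : R) : 0 < b -> 0 < K -> b * K ^+ 2 <= 1 ->
  b `^ ((r + 2) / (2 * r)) * (K ^+ 2) `^ r^-1 * b^-1 * K^-1 <= 1.
Proof.
move=> b0 K0 bK.
have s0 : 0 <= r^-1 - 2^-1 by rewrite subr_ge0 lef_pV2 ?posrE.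
have -> : (r + 2) / (2 * r) = (r^-1 - 2^-1) + 1 by field; rewrite gt_eqF.
have -> : (K ^+ 2) `^ r^-1 = (K ^+ 2) `^ (r^-1 - 2^-1) * K.
  have {3}-> : K = (K ^+ 2) `^ 2^-1.
    by rewrite powR12_sqrt ?sqr_ge0// sqrtr_sqr gtr0_norm.
  have K20 : K ^+ 2 != 0 by rewrite gt_eqF// exprn_gt0.
  by rewrite -powRD ?subrK// K20 implybT.
have b1 : b != 0 by rewrite gt_eqF.
rewrite powRD ?b1 ?implybT// powRr1 ?(ltW b0)//.
have -> : forall u v : R, u * b * (v * K) * b^-1 * K^-1 = u * v.
  by move=> u v; field; rewrite !gt_eqF.
rewrite -powRM ?(ltW b0) ?sqr_ge0//.
apply: (@le_trans _ _ (1 `^ (r^-1 - 2^-1))); last by rewrite powR1.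
apply: ge0_ler_powR => //; rewrite nnegrE ?ler01//.
exact: (mulr_ge0 (ltW b0) (sqr_ge0 K)).
Qed.

(** Here [s] and [t] stand for the [rnorm] of [wt f] and [wt g]; the factor [K^-1] to the power [r]
    comes from demodulation. *)
Lemma constant_bound (b K s t S : R) : 0 < b -> 0 < K -> b * K ^+ 2 <= 1 ->
  0 <= s -> 0 <= t ->
  S <= 2 * (K ^+ 2) `^ r^-1 * b^-1 * (s * (K^-1 `^ r * t)) `^ r^-1 ->
  b `^ ((r + 2) / (2 * r)) / 2 * S <= s `^ r^-1 * t `^ r^-1.
Proof.
move=> b0 K0 bK s0 t0.
have cst := saft_constant_le b0 K0 bK.
have KV0 : 0 <= K^-1 by rewrite invr_ge0 ltW.
have -> : (s * (K^-1 `^ r * t)) `^ r^-1 = K^-1 * (s `^ r^-1 * t `^ r^-1).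
  rewrite (powRM _ s0 (mulr_ge0 (powR_ge0 _ _) t0)) (powRM _ (powR_ge0 _ _) t0).
  by rewrite -powRrM mulfV ?gt_eqF// powRr1// mulrCA.
have st0 : 0 <= s `^ r^-1 * t `^ r^-1 := mulr_ge0 (powR_ge0 _ _) (powR_ge0 _ _).
move: (s `^ _ * _) st0 cst => y y0.
move: (b `^ _) (powR_ge0 b ((r + 2) / (2 * r))) ((K ^+ 2) `^ _) => u u0 v cst SK.
have u2 : 0 <= u / 2 by rewrite divr_ge0.
apply: (le_trans (ler_wpM2l u2 SK)).
apply: (@le_trans _ _ (u * v * b^-1 * K^-1 * y)).
  by rewrite le_eqVlt; apply/orP; left; apply/eqP; field; rewrite !gt_eqF.
by rewrite -[leRHS]mul1r; exact: ler_wpM2r.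
Qed.

Lemma kapV_le (B : R) : B != 0 -> `|B| * kap B^-1 <= 1.
Proof.
move=> B0; have p2 := pi_ge2 R.
have P0 : 1 <= 2 * pi :> R by lra.
have -> : `|B| * kap B^-1 = (2 * pi)^-1.
  by rewrite /kap normrV ?unitfE// mulrA mulfV ?normr_eq0// mul1r.
by rewrite invf_le1// (lt_le_trans ltr01).
Qed.

Variables A B D p q : R.
Hypothesis B0 : B != 0.
Variables f g : R -> R[i].
Hypotheses (f2 : sq_integrable f) (fg : is_saft A B D p q f g).

Let g2 : sq_integrable g. Proof. by apply/cLp2P; case: fg. Qed.
Let mf : cmeasurable f. Proof. by case: f2. Qed.
Let mg : cmeasurable g. Proof. by case: g2. Qed.
Let F x := chirp_in A B p x * f x.
Let h := demod B D p q g.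
Let F0 x : R[i] := (kap B^-1)%:C * fourier B^-1 h x.

Let mF : cmeasurable F.
Proof. by apply: cmeasurableM => //; exact: measurable_chirp_in. Qed.

(** Injectivity of the transform, by inversion. It settles the case where the frequency integral is
    0, even if the other one is infinite. *)
Lemma sqnorm_eq0_of_saft_eq0 : {ae mu, forall w, g w = 0} -> sqnorm f = 0%E.
Proof.
move=> g0.
have h0 : {ae mu, forall w, h w = 0} by apply: filterS g0 => w; rewrite /h /demod => ->; rewrite mulr0.
have mh : cmeasurable h by exact: cmeasurable_demod.
have m0 : cmeasurable (fun _ : R => 0 : R[i]) by exact: cmeasurable_cst.
have h1 : cintegrable h.
  split => //; rewrite (@ae_eq_integral _ _ _ mu setT (fun=> 0%E)) ?integral0//.
  - by apply/measurable_EFinP; exact: measurable_cabs.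
  - by apply: filterS h0 => w /= -> _; rewrite ComplexField.Normc.normc0.
have F00 x : fourier B^-1 h x = 0.
  rewrite /fourier -[RHS](@cintegral0 R); apply: ae_eq_cintegral => //.
    by apply: (cintegrable_fourier_arg _ _ h1).1.
  by apply: filterS h0 => w ->; rewrite mul0r.
rewrite -(sqnorm_chirp A B p mf); apply: sqnorm_ae_eq0 => //.
by apply: filterS (saft_inversion B0 f2 fg h1) => x ->; rewrite F00 mulr0.
Qed.

Hypotheses (wf : rintegrable r (wt f)) (wg : rintegrable r (wt g)).

Lemma saft_heisenberg_finite :
  `|B| `^ ((r + 2) / (2 * r)) / 2 * fine (sqnorm f) <=
  rnorm r (wt f) `^ r^-1 * rnorm r (wt g) `^ r^-1.
Proof.
have [K [K0 K2 hK]] : exists K : R, [/\ 0 < K, kap B^-1 = K ^+ 2 &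
    forall w, cabs (h w) = K^-1 * cabs (g w)].
  exists (cabs (conjc (saft_const B))); split => [||w].
  - rewrite lt_neqAle cabs_ge0 andbT eq_sym; apply/eqP.
    by move=> /ComplexField.Normc.eq0_normc/eqP; exact/negP/saft_const_neq0.
  - by rewrite sqr_cabs_saft_const.
  - exact: cabs_demod.
have K00 : K != 0 by rewrite gt_eqF.
have cabsF x : cabs (F x) = cabs (f x) by rewrite /F cabsM cabs_expi mul1r.
have F2 : sq_integrable F by split => //; rewrite sqnorm_chirp//; case: f2.
have wF : rintegrable r (wt F).
  apply: (rintegrable_le r1 _ wf); first exact: cmeasurable_wt.
  by move=> x; rewrite !cabs_wt cabsF.
have F1 := weighted_cintegrable r1 r2 F2 wF.
have h2 : sq_integrable h by exact: sq_integrable_demod.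
have wth x : wt h x = (K^-1)%:C * (K%:C * wt h x).
  by rewrite mulrA -rmorphM/= mulVf// mul1r.
have Kwth x : cabs (K%:C * wt h x) = cabs (wt g x).
  rewrite cabsM cabs_real (gtr0_norm K0) !cabs_wt hK.
  by rewrite mulrCA [K * _]mulrA mulfV// mul1r.
have wKh : rintegrable r (fun x => K%:C * wt h x).
  apply: (rintegrable_le r1 _ wg); last by move=> x; rewrite Kwth.
  by apply: cmeasurableZ; apply: cmeasurable_wt; exact: h2.1.
have wh : rintegrable r (wt h).
  by rewrite (_ : wt h = fun x => (K^-1)%:C * (K%:C * wt h x));
    [exact: rintegrableZ|apply/funext => x; exact: wth].
have nh : rnorm r (wt h) = K^-1 `^ r * rnorm r (wt g).
  rewrite {1}(_ : wt h = fun x => (K^-1)%:C * (K%:C * wt h x)); last by apply/funext => x; exact: wth.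
  have KV0 : 0 < K^-1 by rewrite invr_gt0.
  rewrite (rnormZ _ wKh) cabs_real (gtr0_norm KV0); congr (_ * _).
  by apply: eq_Rintegral => x _; exact: (congr1 (fun t => t `^ r) (Kwth x)).
have h1 := weighted_cintegrable r1 r2 h2 wh.
(* [heisenberg_fourier] wants the inversion formula at every point, so [F] is replaced by the
   representative [F0]; the integrals do not change. *)
have FF0 : {ae mu, forall x, F x = F0 x} by exact: saft_inversion.
have mF0 : cmeasurable F0.
  by apply: cmeasurableZ; apply: cmeasurable_fourier; case: h1.
have F01 : cintegrable F0.
  split => //; rewrite (@ae_eq_integral _ _ _ mu setT (fun x => (cabs (F x))%:E))//; first exact: F1.2.
  - by apply/measurable_EFinP; exact: measurable_cabs.
  - by apply/measurable_EFinP; exact: measurable_cabs.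
  - by apply: filterS FF0 => x /= -> _.
have EF0 : (\int[mu]_x (cabs (wt F0 x) `^ r)%:E = \int[mu]_x (cabs (wt f x) `^ r)%:E)%E.
  apply: ae_eq_integral => //.
  - by apply/measurable_EFinP; apply: measurable_rpow; exact: cmeasurable_wt.
  - by apply/measurable_EFinP; apply: measurable_rpow; exact: cmeasurable_wt.
  - by apply: filterS FF0 => x E _; congr (_ `^ _)%:E; rewrite !cabs_wt -(cabsF x) E.
have wF0 : rintegrable r (wt F0).
  by split; [exact: cmeasurable_wt|rewrite EF0; exact: wf.2].
have nF0 : rnorm r (wt F0) = rnorm r (wt f) by rewrite /rnorm /Rintegral EF0.
have c0 : B^-1 != 0 by rewrite invr_neq0.
have key := heisenberg_fourier r1 r2 c0 h1 wh (fun x => erefl) F01 wF0.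
have sF0 : fine (sqnorm f) = \int[mu]_x cabs (F0 x) ^+ 2.
  rewrite -(sqnorm_chirp A B p mf) /Rintegral; congr fine.
  exact: ae_eq_sqnorm.
rewrite -sF0 nF0 nh in key.
have bK : `|B| * K ^+ 2 <= 1 by rewrite -K2; exact: kapV_le.
have aB0 : 0 < `|B| by rewrite normr_gt0.
rewrite K2 normfV in key.
exact: (constant_bound aB0 K0 bK (rnorm_ge0 r _) (rnorm_ge0 r _) key).
Qed.

End uncertainty.

Theorem theorem4p1 (R : realType) (A B C D p q : R)
    (hdet : A * D - B * C = 1) (hB : B != 0)
    (r : R) (hr1 : 1 <= r) (hr2 : r <= 2)
    (f : R -> R[i]) (hf : cLp 2 f) :
  (((\int[lebesgue_measure]_x (`|x| `^ r * cabs (f x) `^ r)%:E) `^ r^-1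
    * (\int[lebesgue_measure]_w
         (`|w| `^ r * cabs (saft A B D p q f w) `^ r)%:E) `^ r^-1)
   >= (`|B| `^ ((r + 2) / (2 * r)) / 2)%:E * (cLnorm 2 f) ^+ 2)%E.
Proof.
have {hf} f2 := (cLp2P f).1 hf; have mf := f2.1.
have := saftP A D p q hB f2; move: (saft _ _ _ _ _ _) => g fg.
have g2 : sq_integrable g by apply/cLp2P; case: fg.
have mg := g2.1.
have rV : r^-1 != 0 by rewrite invr_neq0// gt_eqF// (lt_le_trans ltr01).
rewrite sqr_cLnorm2.
have wtE (k : R -> R[i]) : (\int[lebesgue_measure]_x (`|x| `^ r * cabs (k x) `^ r)%:E =
    \int[lebesgue_measure]_x (cabs (wt k x) `^ r)%:E)%E.
  by apply: eq_integral => x _; rewrite powR_wt.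
rewrite !wtE.
set X := (\int[lebesgue_measure]_x (cabs (wt f x) `^ r)%:E)%E.
set W := (\int[lebesgue_measure]_x (cabs (wt g x) `^ r)%:E)%E.
have X0 : (0 <= X)%E by apply: integral_ge0 => x _; rewrite lee_fin powR_ge0.
have W0 : (0 <= W)%E by apply: integral_ge0 => x _; rewrite lee_fin powR_ge0.
(* Since [0 * +oo = 0], the zero factors are settled before the infinite ones; once both are
   positive, an infinite factor makes the product infinite. *)
have LHS0 : (sqnorm f = 0 -> (`|B| `^ ((r + 2) / (2 * r)) / 2)%:E * sqnorm f <=
    X `^ r^-1 * W `^ r^-1)%E.
  by move=> ->; rewrite mule0 mule_ge0// poweR_ge0.
have [Xz|Xz] := eqVneq X 0%E.
  by apply: LHS0; exact: sqnorm_ae_eq0 mf (ae_eq0_wt mf Xz).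
have [Wz|Wz] := eqVneq W 0%E.
  apply: LHS0; apply: (sqnorm_eq0_of_saft_eq0 hB f2 fg).
  exact: (ae_eq0_wt mg Wz).
have {Xz}Xp : (0 < X)%E by rewrite lt_neqAle eq_sym Xz X0.
have {Wz}Wp : (0 < W)%E by rewrite lt_neqAle eq_sym Wz W0.
have [Xoo|Xoo] := eqVneq X +oo%E.
  by rewrite Xoo poweRyr// gt0_mulye ?leey// poweR_gt0.
have [Woo|Woo] := eqVneq W +oo%E.
  by rewrite Woo poweRyr// gt0_muley ?leey// poweR_gt0.
have wf : rintegrable r (wt f) by split; [exact: cmeasurable_wt|rewrite ltey].
have wg : rintegrable r (wt g) by split; [exact: cmeasurable_wt|rewrite ltey].
have key := saft_heisenberg_finite hr1 hr2 hB f2 fg wf wg.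
have sf : sqnorm f \is a fin_num by rewrite ge0_fin_numE ?sqnorm_ge0//; case: f2.
by rewrite -(fineK sf) /X /W -(rnormE wf) -(rnormE wg) !poweR_EFin -!EFinM lee_fin.
Qed.
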